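(* Assume the setting below and let $\mathfrak{a}$ be an integral ideal of $\mathcal{O}_K$. Then $$\sum_{\varepsilon(\mathfrak{a})}\#S(\mathfrak{a},\lambda_{\varepsilon(\mathfrak{a})},\ell)=\sum_{x\text{ satisfies (C)}}\delta(x)\cdot\#S_1(\mathfrak{a},x,\ell)=w_K\sum_{x\text{ satisfies (C)}}\delta(x)\cdot\#S_2(\mathfrak{a},x,\ell),$$ where the first sum runs over all $2^\tau$ sign vectors $\varepsilon(\mathfrak{a})$ and $w_K$ is the number of roots of unity in $K$. Furthermore, $$\sum_{\varepsilon(\mathfrak{a})}\#S(\mathfrak{a},\lambda_{\varepsilon(\mathfrak{a})},\ell)=\sum_{\mathfrak{c}}\#S(\mathfrak{a}\mathfrak{c},\lambda_{\mathfrak{a}\mathfrak{c}},\ell),$$ where $\mathfrak{c}$ runs over the integral ideals of $\mathcal{O}_K$ dividing $\sqrt{d}\,\mathcal{O}_K$ (i.e. the products of distinct ramified primes $\tilde{\mathfrak{q}}$).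
   Context: Setting: $L$ totally real of degree $g$, strict class number $1$; $K$ a CM field with $K^+=L$, bar = complex conjugation; $\mathcal{O}_K=\mathcal{O}_L[t]$, $t^2+at+b=0$, $a,b\in\mathcal{O}_L$, $d=a^2-4b$ totally negative, $\mathcal{D}=(\sqrt{d})$ the relative different, $(d,2)=1$; $p$ an odd prime unramified in $K$ with $(d,p)=1$, every prime of $L$ above $p$ of even residue degree splits in $K$ and every one of odd residue degree is inert in $K$. $B_{p,L}=B_{p,\infty}\otimes_{\mathbb{Q}}L$. $\alpha_0\in\mathcal{O}_L$ is a totally negative prime element with $(\alpha_0,2pd)=1$, $\alpha_0\equiv p$ mod each prime $\mathfrak{q}\mid d$, $\alpha_0\equiv1\pmod p$, $B_{p,L}\cong\left(\frac{d,\alpha_0p}{L}\right)$, $\alpha_0\mathcal{O}_K=\mathcal{A}\bar{\mathcal{A}}$; $B_{p,L}$ is identified with $\{[\alpha,\beta]=\begin{pmatrix}\alpha&\beta\\ \alpha_0p\bar\beta&\bar\alpha\end{pmatrix}:\alpha,\beta\in K\}$, with reduced trace $\alpha+\bar\alpha$ and reduced norm $\alpha\bar\alpha-\alpha_0p\beta\bar\beta$. For each prime $\mathfrak{q}\mid d$ of $\mathcal{O}_L$ fix $\lambda_{\mathfrak{q}}$ with $\lambda_{\mathfrak{q}}^2\equiv\alpha_0p\pmod{\mathfrak{q}}$, and let $\mathfrak{q}\mathcal{O}_K=\tilde{\mathfrak{q}}^2$; $\tau$ is the number of primes $\mathfrak{q}\mid d$. A sign vector $\varepsilon(\mathfrak{a})=(\varepsilon(\mathfrak{a},\mathfrak{q}))_{\mathfrak{q}\mid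 d}\in\{\pm1\}^\tau$; $\lambda_{\varepsilon(\mathfrak{a})}\in\mathcal{O}_L$ is an element with $\lambda_{\varepsilon(\mathfrak{a})}\equiv\varepsilon(\mathfrak{a},\mathfrak{q})\lambda_{\mathfrak{q}}\pmod{\mathfrak{q}}$ for all $\mathfrak{q}\mid d$ and $\lambda_{\varepsilon(\mathfrak{a})}\mathcal{A}^{-1}\mathfrak{a}^{-1}\bar{\mathfrak{a}}$ integral; $\lambda_{\mathfrak{a}}$ is $\lambda_{\varepsilon(\mathfrak{a})}$ for the signs $\varepsilon(\mathfrak{a},\mathfrak{q})=(-1)^{\mathrm{val}_{\tilde{\mathfrak{q}}}(\mathfrak{a})}$. $\ell\in\mathcal{O}_L$ is nonzero and coprime to $\alpha_0d\,\mathfrak{a}^{-1}\bar{\mathfrak{a}}$. $R(\mathfrak{a},\lambda,\ell)=\{[\alpha,\beta]:\alpha\in\mathcal{D}^{-1},\ \beta\in\mathcal{D}^{-1}\mathcal{A}^{-1}\ell\,\mathfrak{a}^{-1}\bar{\mathfrak{a}},\ \alpha\equiv\lambda\beta\pmod{\mathcal{O}_K}\}$. $K'$ is a CM field with $K'^+=L$, $\mathcal{O}_{K'}=\mathcal{O}_L[w]$, and $d'=\mathrm{Tr}(w)^2-4\mathrm{N}(w)$ (trace and norm relative to $K'/L$), totally negative. $S(\mathfrak{a},\lambda,\ell)=\{[\alpha,\beta]\in R(\mathfrak{a},\lambda,\ell): \alpha+\bar\alpha=\mathrm{Tr}(w),\ \alpha\bar\alpha-\alpha_0p\beta\bar\beta=\mathrm{N}(w)\}$.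 $x\in\mathcal{O}_L$ satisfies (C) if $x\equiv a\,\mathrm{Tr}(w)\pmod{2\mathcal{O}_L}$, $\frac{x^2-dd'}{4p\ell^2}\in\mathcal{O}_L$, and $x^2-dd'$ is totally negative. $\delta(x)=2^{\#\{\mathfrak{q}\mid d:\ x\equiv0\ (\mathrm{mod}\ \mathfrak{q})\}}$. $S_1(\mathfrak{a},x,\ell)=\{\gamma\in\mathcal{A}^{-1}\mathfrak{a}^{-1}\bar{\mathfrak{a}}:\gamma\bar\gamma=\frac{x^2-dd'}{4\alpha_0p\ell^2}\}$ and $S_2(\mathfrak{a},x,\ell)=\{\mathfrak{b}\text{ integral ideal of }\mathcal{O}_K:\mathrm{N}_{K/L}(\mathfrak{b})=\frac{x^2-dd'}{4p\ell^2}\mathcal{O}_L,\ \mathfrak{b}\text{ in the class of }\mathfrak{a}^2\mathcal{A}\}$.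
   Formalization: The formal theorem also assumes that K and K' are not isomorphic over L; if they are, [w,0] lies in every S but corresponds to x² = dd', which (C) excludes, so the first identity fails. *)

(* Defs.v *)
From HB Require Import structures.
From mathcomp Require Import all_boot all_order all_algebra all_field.
From mathcomp Require Import finmap boolp classical_sets functions cardinality.
From mathcomp Require Import fsbigop reals.

Set Implicit Arguments.
Unset Strict Implicit.
Unset Printing Implicit Defensive.

Import Order.TTheory GRing.Theory Num.Theory.

Local Open Scope classical_set_scope.
Local Open Scope ring_scope.

(* Number of elements of a finite set; it is 0 on infinite sets, so statements
   using it should come with a finiteness assertion. *)
Definition card_of (T : choiceType) (A : set T) : nat := #|` fset_set A|%fset.

Section Ideals.
Variable F : fieldType.

Definition ringint : set F := [set x | integralOver (intr : int -> F) x].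

(* Nonzero fractional ideals of the ring of integers of F. *)
Definition fractional (I : set F) : Prop :=
  [/\ forall x y, I x -> I y -> I (x + y),
      forall r x, ringint r -> I x -> I (r * x),
      exists2 x, I x & x != 0 &
      exists r, [/\ ringint r, r != 0 & forall x, I x -> ringint (r * x)]].

Definition integral_ideal (I : set F) : Prop :=
  fractional I /\ I `<=` ringint.

(* Nonzero prime ideals. *)
Definition prime_ideal (P : set F) : Prop :=
  [/\ integral_ideal P, P <> ringint &
      forall x y, ringint x -> ringint y -> P (x * y) -> P x \/ P y].

Definition principal (x : F) : set F := [set x * y | y in ringint].

Definition imul (I J : set F) : set F :=
  [set z | exists n (u v : 'I_n -> F),
     (forall i, I (u i) /\ J (v i)) /\ z = \sum_(i < n) u i * v i].

Definition iinv (I : set F) : set F :=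
  [set x | forall y, I y -> ringint (x * y)].

Definition ipow (I : set F) (n : nat) : set F := iter n (imul I) ringint.

Definition idvd (I J : set F) : Prop :=
  exists2 C, integral_ideal C & J = imul I C.

(* exponent of the prime P in the integral ideal I *)
Definition ival (P I : set F) : nat :=
  xget 0%N [set n | idvd (ipow P n) I /\ ~ idvd (ipow P n.+1) I].

Definition icoprime (I J : set F) : Prop :=
  exists u v, [/\ I u, J v & u + v = 1].

(* No prime dividing the integral ideal I occurs in the factorization of the
   fractional ideal J. *)
Definition icoprime_frac (I J : set F) : Prop :=
  exists N D, [/\ integral_ideal N, integral_ideal D, J = imul N (iinv D),
                  icoprime I N & icoprime I D].

Definition same_class (I J : set F) : Prop :=
  exists2 x : F, x != 0 & I = imul (principal x) J.

Definition roots_of_unity : set F := [set z | exists2 n, (0 < n)%N & z ^+ n = 1].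

(* f is the dimension of ringint / P over the field with p elements: e is a
   family of integers whose classes form a basis. *)
Definition residue_degree (p : nat) (P : set F) (f : nat) : Prop :=
  exists e : 'I_f -> F, (forall i, ringint (e i)) /\
    forall x, ringint x ->
      exists! c : {ffun 'I_f -> 'I_p}, P (x - \sum_(i < f) e i *+ c i).

End Ideals.

Arguments ringint {F}.
Arguments roots_of_unity {F}.

Notation "I &* J" := (imul I J) (at level 40, left associativity).

Section TotallyReal.
Variable L : fieldExtType rat.

Definition totally_real : Prop :=
  forall (f : {rmorphism L -> algC}) x, f x \is Num.real.

Definition tot_pos (x : L) : Prop :=
  forall f : {rmorphism L -> algC}, 0 < f x.

Definition tot_neg (x : L) : Prop :=
  forall f : {rmorphism L -> algC}, f x < 0.

Definition strict_class_number_one : Prop :=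
  forall I : set L, fractional I -> exists2 x, tot_pos x & I = principal x.

End TotallyReal.

Section Relative.
Variables (L : fieldExtType rat) (K : fieldExtType L).

(* K is a CM field with maximal totally real subfield L: a totally imaginary
   quadratic extension of the totally real field L. *)
Definition CM_over : Prop :=
  [/\ totally_real L, \dim {:K} = 2 &
      forall f : {rmorphism K -> algC}, exists x, f x \isn't Num.real].

Definition complex_conjugation (bar : {rmorphism K -> K}) : Prop :=
  forall (f : {rmorphism K -> algC}) x, f (bar x) = (f x)^*.

(* trace and norm of K / L: those of the multiplication by x *)
Definition mulmx_of (x : K) : 'M[L]_(\dim {:K}) :=
  passmx.mxof (vbasis {:K}) (vbasis {:K}) (amull x).
Definition relTr (x : K) : L := \tr (mulmx_of x).
Definition relN (x : K) : L := \det (mulmx_of x).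

(* ringint L [w] *)
Definition adjoin_int (w : K) : set K :=
  [set q | exists2 P : {poly L}, (forall i, ringint P`_i) &
           q = (map_poly (in_alg K) P).[w]].

(* the extension to K of an ideal of L *)
Definition iext (I : set L) : set K :=
  [set z | exists n (u : 'I_n -> L) (v : 'I_n -> K),
     (forall i, I (u i) /\ ringint (v i)) /\ z = \sum_(i < n) (u i)%:A * v i].

(* relative norm of an ideal: the ideal of L generated by the norms of its
   elements *)
Definition idealN (b : set K) : set L :=
  [set z | exists n (u : 'I_n -> L) (v : 'I_n -> K),
     (forall i, ringint (u i) /\ b (v i)) /\
     z = \sum_(i < n) u i * relN (v i)].

(* relative different: the inverse of the trace dual of the integers of K *)
Definition rel_different : set K :=
  iinv [set x : K | forall y : K, ringint y -> ringint (relTr (x * y))].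

Definition unramified_at (p : nat) : Prop :=
  forall P : set K, prime_ideal P -> P p%:R ->
    ~ idvd (P &* P) (principal (p%:R : K)).

Definition splits (P : set L) : Prop :=
  exists Q1 Q2 : set K,
    [/\ prime_ideal Q1, prime_ideal Q2, Q1 <> Q2 & iext P = Q1 &* Q2].

Definition inert (P : set L) : Prop := prime_ideal (iext P).

End Relative.

Arguments rel_different {L} K.
Arguments iext {L} K.

Section Quaternion.

(* B is the quaternion algebra (a, b / F). *)
Definition quaternion_algebra (F : fieldType) (a b : F) (B : falgType F) :=
  exists i j : B, [/\ i * i = a%:A, j * j = b%:A, j * i = - (i * j) &
                      basis_of {:B} [:: 1; i; j; i * j]].

(* B' is the scalar extension of B to F', through the canonical map iota. *)
Definition scalar_extension (F F' : fieldType) (B : falgType F)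
    (B' : falgType F') (iota : {rmorphism B -> B'}) : Prop :=
  forall X : seq B, basis_of {:B} X -> basis_of {:B'} (map iota X).

Definition padic_norm (p : nat) (r : rat) : rat :=
  if r == 0 then 0
  else p%:R ^ ((logn p `|denq r|)%:Z - (logn p `|numq r|)%:Z).

(* F, with absolute value nrm, is the completion of rat at the prime p. *)
Definition padic_field (p : nat) (F : fieldType) (nrm : F -> rat) : Prop :=
  [/\ [/\ forall x, 0 <= nrm x, forall x, (nrm x == 0) = (x == 0),
          forall x y, nrm (x * y) = nrm x * nrm y &
          forall x y, nrm (x + y) <= Num.max (nrm x) (nrm y)],
      forall r : rat, nrm (ratr r) = padic_norm p r,
      forall x (e : rat), 0 < e -> exists r : rat, nrm (x - ratr r) < e &
      forall u : nat -> F,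
        (forall e : rat, 0 < e -> exists N, forall m n,
           (N <= m)%N -> (N <= n)%N -> nrm (u m - u n) < e) ->
        exists l, forall e : rat, 0 < e -> exists N, forall n,
           (N <= n)%N -> nrm (u n - l) < e].

Definition division_over (F : fieldType) (B : falgType rat) : Prop :=
  forall (B' : falgType F) (iota : {rmorphism B -> B'}),
    scalar_extension iota -> forall x : B', x != 0 -> x \is a GRing.unit.

Definition ramified_at_prime (q : nat) (B : falgType rat) : Prop :=
  forall (F : fieldType) (nrm : F -> rat),
    padic_field q nrm -> division_over F B.

Definition ramified_at_infinity (B : falgType rat) : Prop :=
  forall R : realType, division_over R B.

Definition is_Bpinf (p : nat) (B : falgType rat) : Prop :=
  [/\ exists u v : rat, [/\ u != 0, v != 0 & quaternion_algebra u v B],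
      ramified_at_infinity B &
      forall q, prime q -> (ramified_at_prime q B <-> q = p)].

End Quaternion.

Section Counting.
Variables (L : fieldExtType rat) (K : fieldExtType L).
Variables (bar : {rmorphism K -> K}) (p : nat) (alpha0 : L) (A : set K).

(* the matrix written [alpha, beta] *)
Definition quat (alpha beta : K) : 'M[K]_2 :=
  \matrix_(i, j)
    if i == 0 then (if j == 0 then alpha else beta)
    else (if j == 0 then alpha0%:A * p%:R * bar beta else bar alpha).

(* the fractional ideal fa^-1 fabar *)
Definition twist (fa : set K) : set K := iinv fa &* (bar @` fa).

(* lam is an admissible lambda for fa and the signs (-1) ^+ e i at q i, the
   lamq i being fixed square roots of alpha0 * p modulo q i. *)
Definition is_lambda (tau : nat) (q : 'I_tau -> set L) (lamq : 'I_tau -> L)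
    (fa : set K) (e : {ffun 'I_tau -> bool}) (lam : L) : Prop :=
  [/\ ringint lam,
      forall i, q i (lam - (-1) ^+ e i * lamq i) &
      principal (lam%:A : K) &* iinv A &* twist fa `<=` ringint].

Definition sign_of (tau : nat) (qt : 'I_tau -> set K) (fa : set K) :
    {ffun 'I_tau -> bool} :=
  [ffun i => odd (ival (qt i) fa)].

Definition Rset (fa : set K) (lam ell : L) : set 'M[K]_2 :=
  [set M | exists alpha beta,
     [/\ M = quat alpha beta,
         iinv (rel_different K) alpha,
         (iinv (rel_different K) &* iinv A &* principal (ell%:A : K)
            &* twist fa) beta &
         ringint (alpha - lam%:A * beta)]].

(* s and n stand for the trace and the norm of w *)
Definition Sset (s n : L) (fa : set K) (lam ell : L) : set 'M[K]_2 :=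
  [set M | exists alpha beta,
     [/\ M = quat alpha beta, Rset fa lam ell M,
         alpha + bar alpha = s%:A &
         alpha * bar alpha - alpha0%:A * p%:R * (beta * bar beta) = n%:A]].

Definition condC (a s d d' ell : L) : set L :=
  [set x | [/\ ringint x, principal (2 : L) (x - a * s),
               ringint ((x ^+ 2 - d * d') / (4 * p%:R * ell ^+ 2)) &
               tot_neg (x ^+ 2 - d * d')]].

Definition delta (tau : nat) (q : 'I_tau -> set L) (x : L) : nat :=
  (2 ^ #|[pred i : 'I_tau | `[< q i x >]]|)%N.

Definition S1set (d d' : L) (fa : set K) (x ell : L) : set K :=
  [set gamma | (iinv A &* twist fa) gamma /\
     gamma * bar gamma =
       ((x ^+ 2 - d * d') / (4 * alpha0 * p%:R * ell ^+ 2))%:A].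

Definition S2set (d d' : L) (fa : set K) (x ell : L) : set (set K) :=
  [set b | [/\ integral_ideal b,
     idealN b = principal ((x ^+ 2 - d * d') / (4 * p%:R * ell ^+ 2)) &
     same_class b (fa &* fa &* A)]].

End Counting.

(* Main.v *)
(* Write alpha = u / r and beta = ell * g / r with r = sqrt d. The trace equation
   says u = (x + Tr(w) r) / 2 for some x in L, and the norm equation becomes
   N(g) = (x ^ 2 - d d') / (4 alpha0 p ell ^ 2); so a matrix of S is a pair
   (x, g) with x satisfying (C), g in S1(x) and u = lambda ell g modulo (r).
   As (r) is the product of the primes qt i and every integer is congruent to
   its conjugate modulo qt i, this says, prime by prime, 2 lambda ell g = x
   modulo qt i, while (2 lambda ell g) ^ 2 = x ^ 2 always holds: one sign of
   lambda at q i is admissible, or both if q i divides x. Summing over signs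
   gives delta(x).

   The map g |-> (g) A fa fabar^-1 sends S1 to S2 with fibers the orbits of the
   roots of unity. It is onto because totally positive units of L are squares:
   by strict class number one there are units of all signatures, and a
   pigeonhole argument in the manner of Dirichlet bounds the number of units
   independent modulo squares.

   For the last identity, the ideals dividing (r) are the intersections of
   sets of qt i; they are fixed by conjugation, so multiplying fa by one of
   them does not change fa^-1 fabar and only flips the corresponding signs.

   Ideal theory in K is elementary here: the ideal of L generated by the norms
   from I is principal, generated by n say, and I * Ibar = (n). *)

Require Import Defs.
From HB Require Import structures.
From mathcomp Require Import all_boot all_order all_algebra all_field.
From mathcomp Require Import finmap boolp classical_sets functions cardinality.
From mathcomp Require Import fsbigop reals.
From mathcomp Require Import ring zify.
Set Implicit Arguments.
Unset Strict Implicit.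
Unset Printing Implicit Defensive.

Import Order.TTheory GRing.Theory Num.Theory.

Local Open Scope classical_set_scope.
Local Open Scope ring_scope.

(* iinv alone would be the inverse image choice function of fintype. *)
Local Notation iinv := Defs.iinv.

(** * Counting in finite sets *)

(** The strict sign in (C) comes from K and K' being distinct: N(g) is totally nonnegative, so x^2 -
    d d' is at most 0 at every place, and equality would make d d' a square, hence K and K'
    isomorphic over L. Divisibility by r can be tested at the primes qt i because d is squarefree:
    were pi^2 to divide d, r / pi would be integral, which O_K = O_L[t], r = 2 t + a and the
    coprimality of d and 2 forbid. Surjectivity onto S2 is at first obstructed by a unit: an ideal
    of the right class comes from some g0 whose norm is correct only up to a totally positive unit
    e; since e = v^2 = N(v), dividing g0 by v repairs it. In the last identity lambda is chosen
    independently for each ideal fa c; these choices are comparable because S depends on lambda only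
    through its residues modulo the q i. *)

Section Cardinality.
Implicit Types T U : choiceType.

Lemma card_of_uniq T (A : set T) (s : seq T) : uniq s -> (forall z, z \in s <-> A z) ->
  finite_set A /\ card_of A = size s.
Proof.
move=> us sA; have AE : A = [set` s] by apply/seteqP; split=> z /sA.
have fA : finite_set A by rewrite AE; exact: finite_seq.
split=> //; rewrite /card_of; apply: perm_size; apply: uniq_perm => //.
move=> z; have := in_fset_set fA z => ->; apply/idP/idP; first by rewrite inE => /sA.
by move=> /sA; rewrite inE.
Qed.

Lemma mem_fset_set T (A : set T) z : finite_set A -> z \in (fset_set A : seq T) <-> A z.
Proof.
move=> fA; have := in_fset_set fA z => ->; rewrite inE.
by split.
Qed.

(** A section of [phi] identifies X with Y times R through [act]. No group law on R is required:
    each fiber only has to be swept exactly once from any of its points. *)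
Lemma card_of_fibers T U (R : set T) (X : set T) (Y : set U) (act : T -> T -> T) (phi : T -> U) :
  finite_set R -> finite_set X ->
  (forall x, X x -> Y (phi x)) ->
  (forall y, Y y -> exists2 x, X x & phi x = y) ->
  (forall x c, X x -> R c -> X (act c x) /\ phi (act c x) = phi x) ->
  (forall x x', X x -> X x' -> phi x = phi x' -> exists2 c, R c & x' = act c x) ->
  (forall x c c', X x -> act c x = act c' x -> c = c') ->
  finite_set Y /\ card_of X = (card_of R * card_of Y)%N.
Proof.
move=> fR fX XY YX actX fib free.
have fY : finite_set Y.
  apply: (@sub_finite_set _ _ (phi @` X)); last exact: finite_image.
  by move=> y /YX [x Xx <-]; exists x.
split=> //.
(* T may be empty, so the section takes values in [option T]; on Y it is always [Some]. *)
have [sec secP] : exists sec : U -> option T, forall y, Y y -> exists x, [/\ sec y = Some x, X x & phi x = y].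
  have ex y : exists o : option T, Y y -> exists x, [/\ o = Some x, X x & phi x = y].
    have [/YX [x Xx e]|nY] := pselect (Y y); first by exists (Some x) => _; exists x.
    by exists None.
  have [sec h] := choice ex; by exists sec.
pose g y c := if sec y is Some x then act c x else c.
pose sY : seq U := fset_set Y; pose sR : seq T := fset_set R.
have mY y : y \in sY <-> Y y by exact: mem_fset_set.
have mR c : c \in sR <-> R c by exact: mem_fset_set.
have [|| _ ->] := @card_of_uniq T X [seq g y c | y <- sY, c <- sR].
- apply: allpairs_uniq; try exact: fset_uniq.
  move=> [y c] [y' c'] /allpairsP [[y1 c1] /= [/mY hy /mR hc [-> ->]]].
  move=> /allpairsP [[y2 c2] /= [/mY hy' /mR hc' [-> ->]]] /=.
  have [x [sx Xx ex]] := secP _ hy; have [x' [sx' Xx' ex']] := secP _ hy'.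
  rewrite /g sx sx' => E.
  have Ey : y1 = y2.
    by have := (actX _ _ Xx hc).2; rewrite E (actX _ _ Xx' hc').2 ex ex'.
  move: sx'; rewrite -Ey sx => -[Exx]; rewrite -Exx in E.
  by rewrite (free _ _ _ Xx E).
- move=> z; split=> [/allpairsP [[y c] /= [/mY hy /mR hc ->]]|Xz].
    by have [x [sx Xx _]] := secP _ hy; rewrite /g sx; case: (actX _ _ Xx hc).
  have hy := XY _ Xz; have [x [sx Xx ex]] := secP _ hy.
  have [c hc Ez] := fib _ _ Xx Xz ex.
  by apply/allpairsP; exists (phi z, c); split=> /=; [exact/mY|exact/mR|rewrite /g sx].
by rewrite size_allpairs mulnC.
Qed.

End Cardinality.

(** * Arithmetic of ideals *)

Section IdealArithmetic.
Variable F : fieldType.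
Implicit Types (x y z : F) (I J C : set F).

Lemma ringint1 : ringint (1 : F). Proof. exact: integral1. Qed.
Lemma ringint0 : ringint (0 : F). Proof. exact: integral0. Qed.
Lemma ringintD x y : ringint x -> ringint y -> ringint (x + y).
Proof. exact: integral_add. Qed.
Lemma ringintN x : ringint x -> ringint (- x).
Proof. exact: integral_opp. Qed.
Lemma ringintB x y : ringint x -> ringint y -> ringint (x - y).
Proof. exact: integral_sub. Qed.
Lemma ringintM x y : ringint x -> ringint y -> ringint (x * y).
Proof. exact: integral_mul. Qed.
Lemma ringintX x n : ringint x -> ringint (x ^+ n).
Proof.
by move=> hx; elim: n => [|n IH]; rewrite ?expr0 ?exprS; [exact: ringint1|exact: ringintM].
Qed.
Lemma ringint_nat n : ringint (n%:R : F). Proof. exact: integral_nat. Qed.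

Lemma ringint_sum (A : Type) (r : seq A) (P : pred A) (f : A -> F) :
  (forall i, P i -> ringint (f i)) -> ringint (\sum_(i <- r | P i) f i).
Proof. by move=> h; apply: big_ind => //; [exact: ringint0|exact: ringintD]. Qed.

Lemma ringint_prod (A : Type) (r : seq A) (P : pred A) (f : A -> F) :
  (forall i, P i -> ringint (f i)) -> ringint (\prod_(i <- r | P i) f i).
Proof. by move=> h; apply: big_ind => //; [exact: ringint1|exact: ringintM]. Qed.

Lemma frac0 I : fractional I -> I 0.
Proof. by case=> _ hM [x Ix _] _; rewrite -(mul0r x); apply: hM => //; exact: ringint0. Qed.

Lemma fracD I x y : fractional I -> I x -> I y -> I (x + y).
Proof. by case=> h _ _ _; exact: h. Qed.

Lemma fracM I x y : fractional I -> ringint x -> I y -> I (x * y).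
Proof. by case=> _ h _ _; exact: h. Qed.

Lemma fracN I x : fractional I -> I x -> I (- x).
Proof.
move=> hI Ix; rewrite -mulN1r; apply: fracM => //; apply: ringintN; exact: ringint1.
Qed.

Lemma fracB I x y : fractional I -> I x -> I y -> I (x - y).
Proof. by move=> hI Ix Iy; apply: fracD => //; exact: fracN. Qed.

Lemma frac_sum I (A : Type) (r : seq A) (P : pred A) (f : A -> F) :
  fractional I -> (forall i, P i -> I (f i)) -> I (\sum_(i <- r | P i) f i).
Proof.
by move=> hI h; apply: big_ind => //; [exact: frac0|move=> *; exact: fracD].
Qed.

Lemma fractional_ringint : fractional (@ringint F).
Proof.
split; [exact: ringintD|exact: ringintM| |].
  by exists 1; [exact: ringint1|exact: oner_neq0].
by exists 1; split=> [||x]; rewrite ?mul1r ?oner_neq0 //; exact: ringint1.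
Qed.

Lemma integral_ringint : integral_ideal (@ringint F).
Proof. by split=> //; exact: fractional_ringint. Qed.

Lemma principalP x y : x != 0 -> principal x y <-> ringint (x^-1 * y).
Proof.
move=> x0; split=> [[z hz <-]|h]; first by rewrite mulKf.
by exists (x^-1 * y); rewrite ?mulVKf.
Qed.

Lemma principal_id x : principal x x.
Proof. by exists 1; rewrite ?mulr1 //; exact: ringint1. Qed.

Lemma principal_mem I x : fractional I -> I x -> principal x `<=` I.
Proof. by move=> hI Ix _ [y hy <-]; rewrite mulrC; exact: fracM. Qed.

Lemma imul_mem I J x y : I x -> J y -> (I &* J) (x * y).
Proof. by move=> Ix Jy; exists 1%N, (fun=> x), (fun=> y); rewrite big_ord1. Qed.

Lemma imul0 I J : (I &* J) 0.
Proof. by exists 0%N, (fun=> 0), (fun=> 0); rewrite big_ord0; split=> // -[]. Qed.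

Lemma imulD I J x y : (I &* J) x -> (I &* J) y -> (I &* J) (x + y).
Proof.
move=> [n [u [v [h ->]]]] [m [u' [v' [h' ->]]]].
exists (n + m)%N, (fun i : 'I_(n + m) => match fintype.split i with inl j => u j | inr j => u' j end),
  (fun i : 'I_(n + m) => match fintype.split i with inl j => v j | inr j => v' j end).
split=> [i|]; first by case: (fintype.split i).
rewrite big_split_ord /=; congr (_ + _); apply: eq_bigr => i _.
  by rewrite (unsplitK (inl i)).
by rewrite (unsplitK (inr i)).
Qed.

(** Elements of [I &* J] are sums of products, so C need only be closed under sums; it is also
    applied to preimages of ideals under multiplication. *)
Lemma imul_sub I J C : C 0 -> (forall x y, C x -> C y -> C (x + y)) ->
  (forall x y, I x -> J y -> C (x * y)) -> I &* J `<=` C.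
Proof.
move=> C0 CD h _ [n [u [v [huv ->]]]].
by apply: big_ind => // i _; have [? ?] := huv i; exact: h.
Qed.

Lemma imul_subf I J C : fractional C ->
  (forall x y, I x -> J y -> C (x * y)) -> I &* J `<=` C.
Proof.
by move=> hC; apply: imul_sub; [exact: frac0|move=> *; exact: fracD].
Qed.

Lemma imulS I I' J J' : I `<=` I' -> J `<=` J' -> I &* J `<=` I' &* J'.
Proof.
move=> sI sJ; apply: imul_sub; [exact: imul0|exact: imulD|].
by move=> x y Ix Jy; apply: imul_mem; auto.
Qed.

Lemma imulC I J : I &* J = J &* I.
Proof.
suff h I' J' : I' &* J' `<=` J' &* I' by apply/seteqP; split; exact: h.
apply: imul_sub; [exact: imul0|exact: imulD|].
by move=> x y Ix Jy; rewrite mulrC; exact: imul_mem.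
Qed.

Lemma imulA I J C : I &* (J &* C) = I &* J &* C.
Proof.
apply/seteqP; split.
  apply: imul_sub; [exact: imul0|exact: imulD|].
  move=> x _ Ix [n [u [v [h ->]]]]; rewrite mulr_sumr.
  apply: big_ind; [exact: imul0|exact: imulD|].
  by move=> i _; have [? ?] := h i; rewrite mulrA; do 2!apply: imul_mem => //.
apply: imul_sub; [exact: imul0|exact: imulD|].
move=> _ x [n [u [v [h ->]]]] Cx; rewrite mulr_suml.
apply: big_ind; [exact: imul0|exact: imulD|].
by move=> i _; have [? ?] := h i; rewrite -mulrA; do 2!apply: imul_mem => //.
Qed.

Lemma imulCA I J C : I &* (J &* C) = J &* (I &* C).
Proof. by rewrite !imulA (imulC I). Qed.

Lemma imulACA I J C D : (I &* J) &* (C &* D) = (I &* C) &* (J &* D).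
Proof. by rewrite -!imulA (imulCA J). Qed.

Lemma imul1 I : fractional I -> I &* ringint = I.
Proof.
move=> hI; apply/seteqP; split.
  by apply: imul_subf => // x y Ix hy; rewrite mulrC; exact: fracM.
by move=> x Ix; rewrite -(mulr1 x); apply: imul_mem => //; exact: ringint1.
Qed.

Lemma mul1i I : fractional I -> ringint &* I = I.
Proof. by rewrite imulC; exact: imul1. Qed.

Lemma principal1 : principal 1 = @ringint F.
Proof.
apply/seteqP; split=> [_ [y hy <-]|y hy]; first by rewrite mul1r.
by exists y; rewrite ?mul1r.
Qed.

Lemma principalM x y : principal x &* principal y = principal (x * y).
Proof.
apply/seteqP; split.
  apply: imul_sub.
  - by exists 0; rewrite ?mulr0 //; exact: ringint0.
  - move=> _ _ [u hu <-] [v hv <-]; exists (u + v); rewrite ?mulrDr //.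
    exact: ringintD.
  - move=> _ _ [u hu <-] [v hv <-]; exists (u * v); first exact: ringintM.
    by rewrite mulrACA.
move=> _ [u hu <-]; rewrite -mulrA; apply: imul_mem; first exact: principal_id.
by exists u.
Qed.

Lemma principal_mulP x I z : x != 0 -> fractional I ->
  (principal x &* I) z <-> I (x^-1 * z).
Proof.
move=> x0 hI; split; last first.
  by move=> h; rewrite -(mulVKf x0 z); apply: imul_mem => //; exact: principal_id.
move: z; apply: (@imul_sub _ _ [set z | I (x^-1 * z)]) => /=.
- by rewrite mulr0; exact: frac0.
- by move=> u v hu hv; rewrite mulrDr; exact: fracD.
- by move=> _ v [u hu <-] Iv; rewrite -mulrA mulKf //; exact: fracM.
Qed.

Lemma fractional_mul I J : fractional I -> fractional J -> fractional (I &* J).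
Proof.
move=> hI hJ; have [_ _ [x Ix x0] [r [hr r0 hrI]]] := hI.
have [_ _ [y Jy y0] [s [hs s0 hsJ]]] := hJ; split.
- exact: imulD.
- move=> c z hc [n [u [v [h ->]]]]; rewrite mulr_sumr.
  apply: big_ind; [exact: imul0|exact: imulD|].
  move=> i _; have [? ?] := h i; rewrite mulrA; apply: imul_mem => //.
  exact: fracM.
- by exists (x * y); [exact: imul_mem|exact: mulf_neq0].
- exists (r * s); split; [exact: ringintM|exact: mulf_neq0|].
  apply: imul_sub => /=.
  + by rewrite mulr0; exact: ringint0.
  + by move=> u v hu hv; rewrite mulrDr; exact: ringintD.
  + by move=> u v Iu Jv; rewrite mulrACA; apply: ringintM; auto.
Qed.

Lemma integral_ideal_mul I J :
  integral_ideal I -> integral_ideal J -> integral_ideal (I &* J).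
Proof.
move=> [hI sI] [hJ sJ]; split; first exact: fractional_mul.
apply: imul_subf; first exact: fractional_ringint.
by move=> x y /sI hx /sJ hy; exact: ringintM.
Qed.

Lemma prime_proper (P : set F) : prime_ideal P -> ~ P 1.
Proof.
move=> [[fP sP] neP _] P1; apply: neP; apply/seteqP; split=> // y hy.
by rewrite -(mulr1 y); exact: fracM.
Qed.

(** Existence of denominators, supplied for number fields by [fieldExt_denominator] and [denK]; it
    makes principal ideals and inverses fractional. *)
Hypothesis frac_field : forall x, exists r, [/\ ringint r, r != 0 & ringint (r * x)].

Lemma fractional_principal x : x != 0 -> fractional (principal x).
Proof.
move=> x0; split.
- move=> _ _ [u hu <-] [v hv <-]; exists (u + v); rewrite ?mulrDr //.
  exact: ringintD.
- by move=> s _ hs [u hu <-]; exists (s * u); [exact: ringintM|rewrite mulrCA].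
- by exists x => //; exact: principal_id.
- have [r [hr r0 hrx]] := frac_field x; exists r; split=> // _ [u hu <-].
  by rewrite mulrA; exact: ringintM.
Qed.

Lemma integral_principal x : x != 0 -> ringint x -> integral_ideal (principal x).
Proof.
move=> x0 hx; split; first exact: fractional_principal.
by move=> _ [y hy <-]; exact: ringintM.
Qed.

Lemma fractional_inv I : fractional I -> fractional (iinv I).
Proof.
move=> hI; have [_ _ [x Ix x0] [r [hr r0 hrI]]] := hI; split.
- by move=> u v hu hv y Iy; rewrite mulrDl; apply: ringintD; auto.
- by move=> s u hs hu y Iy; rewrite -mulrA; apply: ringintM; auto.
- by exists r.
- have [s [hs s0 hsx]] := frac_field x.
  exists (s * x); split=> //; first exact: mulf_neq0.
  by move=> y hy; rewrite -mulrA (mulrC x); apply: ringintM => //; exact: hy.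
Qed.

Lemma inv_principal x : x != 0 -> iinv (principal x) = principal x^-1.
Proof.
move=> x0; apply/seteqP; split=> y; last first.
  move=> [u hu <-] _ [v hv <-]; rewrite mulrAC mulKf // mulrC; exact: ringintM.
by move=> h; apply/principalP; rewrite ?invr_neq0 // invrK mulrC; apply: h; exact: principal_id.
Qed.

Lemma inv_unique I J : fractional I -> fractional J -> I &* J = ringint ->
  iinv I = J.
Proof.
move=> hI hJ e; apply/seteqP; split=> y; last first.
  by move=> Jy x Ix; rewrite -e mulrC; exact: imul_mem.
move=> h; have : ringint (1 : F) by exact: ringint1.
rewrite -e => -[n [u [v [huv e1]]]].
rewrite -(mulr1 y) e1 mulr_sumr; apply: frac_sum => // i _.
by have [? ?] := huv i; rewrite mulrA; apply: fracM => //; exact: h.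
Qed.

End IdealArithmetic.

(* Clear denominators, then multiply a root of q by the leading coefficient c
   of q: it is a root of the monic \sum_i q_i c ^ (n - 1 - i) X ^ i. *)
Lemma algebraic_denominator (F : fieldType) (iota : {rmorphism rat -> F}) (x : F) :
  algebraicOver iota x ->
  exists2 m : int, m != 0 & integralOver (intr : int -> F) (m%:~R * x).
Proof.
move=> [p0 p0nz p0x].
have [p [c cnz Ep]] := rat_poly_scale p0.
have intrF_inj : injective (intr : int -> F).
  move=> u v e; apply: (@intr_inj rat); apply: (fmorph_inj iota).
  by rewrite !rmorph_int.
have px : root (map_poly (intr : int -> F) p) x.
  move: p0x; rewrite Ep /root linearZ /= hornerZ mulf_eq0 fmorph_eq0 invr_eq0.
  rewrite intr_eq0 (negPf cnz) /= -map_poly_comp.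
  by congr (_.[x] == 0); apply: eq_map_poly => i /=; rewrite rmorph_int.
have pnz : p != 0.
  by apply: contraNneq p0nz => e; rewrite Ep e rmorph0 scaler0.
have lnz : lead_coef p != 0 by rewrite lead_coef_eq0.
exists (lead_coef p) => //.
have [sp1|sp1] := leqP (size p) 1.
  move: px; rewrite (size1_polyC sp1) map_polyC /= rootC => /eqP e.
  have p00 : p`_0 = 0 by apply: intrF_inj.
  by move: pnz; rewrite (size1_polyC sp1) p00 eqxx.
set n := (size p).-1; have szp : size p = n.+1 by rewrite /n prednK // ltnW.
have n0 : (0 < n)%N by rewrite -ltnS -szp.
pose c' := lead_coef p.
have c'E : c' = p`_n by [].
pose s : {poly int} := 'X^n + \poly_(i < n) (p`_i * c' ^+ (n.-1 - i)).
exists s.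
  rewrite monicE /s lead_coefDl ?lead_coefXn //.
  by rewrite size_polyXn ltnS size_poly.
have e0 : \sum_(i < n.+1) (p`_i)%:~R * x ^+ i = 0 :> F.
  move: px; rewrite /root horner_coef size_map_inj_poly ?szp // => /eqP px.
  by rewrite -[RHS]px; apply: eq_bigr => i _; rewrite coef_map.
rewrite /root /s rmorphD /= map_polyXn hornerD hornerXn.
rewrite (_ : map_poly _ _ = \poly_(i < n) (p`_i * c' ^+ (n.-1 - i))%:~R); last first.
  by apply/polyP => i; rewrite coef_map !coef_poly; case: ifP.
rewrite horner_poly; apply/eqP.
transitivity ((c' ^+ n.-1)%:~R * \sum_(i < n.+1) (p`_i)%:~R * x ^+ i : F).
  rewrite big_ord_recr /= mulrDr addrC; congr (_ + _).
    rewrite mulr_sumr; apply: eq_bigr => i _.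
    have -> : c' ^+ n.-1 = c' ^+ (n.-1 - i) * c' ^+ i.
      by rewrite -exprD subnK // -ltnS prednK.
    by rewrite exprMn !rmorphM !rmorphXn /=; ring.
  rewrite exprMn -c'E mulrA -rmorphM -exprSr prednK // rmorphXn.
  by [].
by rewrite e0 mulr0.
Qed.

(** * Embeddings of number fields *)

Section Embeddings.
Variable L : fieldExtType rat.
Local Notation evalL q x := (map_poly (in_alg L) q).[x].
Local Notation pQtoC := (map_poly (ratr : rat -> algC)).

(** Primitive element theorem: evaluation at x identifies L with Q[X]/(m). Separability will make
    the complex roots of m distinct. *)
Lemma number_field_generator :
  exists x (m : {poly rat}), [/\ m \is monic, separable_poly m,
    forall y : L, exists q, y = evalL q x &
    forall q, (evalL q x == 0) = (m %| q)].
Proof.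
have pcharL : [pchar L] =i pred0.
  by move=> p; rewrite (fmorph_pchar (in_alg L)); exact: pchar_num.
have sepL (y : L) : separable_element 1 y.
  (* The derivative of the monic minimal polynomial has the degree as leading coefficient, nonzero
     in characteristic 0. *)
  rewrite separable_nz_der; apply/eqP => /(congr1 (size : {poly L} -> nat)).
  rewrite size_poly0; set m := minPoly _ _ => e.
  have sm : (1 < size m)%N by rewrite size_minPoly ltnS /adjoin_degree prednK // divn_gt0 ?adim_gt0 // dimvS ?subv_adjoin.
  move/eqP: e; rewrite size_poly_eq0 => /eqP/(congr1 (fun p : {poly L} => p`_(size m).-2)).
  rewrite coef_deriv coef0 prednK; last by case: (size m) sm => [|[]].
  have -> : m`_(size m).-1 = 1 by apply/eqP; exact: monic_minPoly.
  case: (size m) sm => [|[|k]] // _ /= /eqP; apply/negP.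
  by have /pcharf0P -> := pcharL.
have sepLL : separable 1 {:L} by apply/allP => y _; exact: sepL.
pose x : L := separable_generator 1 {:L}.
have genx : ({:L} <= <<1; x>>)%VS by apply: sub_adjoin_separable_generator.
have Om : minPoly 1 x \is a polyOver 1%VS := minPolyOver 1%AS x.
have [m Em] : exists m, minPoly 1 x = map_poly (in_alg L) m by apply/polyOver1P.
exists x, m; split.
- by have h : minPoly 1 x \is monic := monic_minPoly 1%AS x; rewrite Em map_monic in h.
- by have h := sepL x; rewrite /separable_element Em separable_map in h.
- move=> y; have /Fadjoin_polyP [p /polyOver1P [q ->] ->] : y \in <<1; x>>%VS.
    by apply: (subvP genx); exact: memvf.
  by exists q.
- move=> q; rewrite -(dvdp_map (in_alg L)) -Em; apply/eqP/idP => [e|/dvdpP [s ->]].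
    apply: minPoly_dvdp; last exact/rootP.
    by apply/polyOver1P; exists q.
  by rewrite hornerM minPolyxx mulr0.
Qed.

(** The representatives [P y] are arbitrary, but [P (q(x)) - q] is a multiple of m, which vanishes
    at z; so q(x) |-> q(z) is well defined and a morphism. *)
Lemma generator_embedding x (m : {poly rat}) (z : algC) :
  (forall y : L, exists q, y = evalL q x) ->
  (forall q, (evalL q x == 0) = (m %| q)) ->
  root (pQtoC m) z ->
  exists f : {rmorphism L -> algC}, f x = z.
Proof.
move=> gen ann mz.
pose P y := sval (cid (gen y)).
have PE y : evalL (P y) x = y by rewrite /P; case: (cid _) => q.
pose f y := (pQtoC (P y)).[z].
have fE q : f (evalL q x) = (pQtoC q).[z].
  have : m %| P (evalL q x) - q by rewrite -ann rmorphB hornerD hornerN PE subrr.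
  move=> /dvdpP [s /(congr1 (fun p => (pQtoC p).[z]))].
  rewrite rmorphB rmorphM hornerM (rootP mz) mulr0 hornerD hornerN.
  by move/eqP; rewrite subr_eq0 => /eqP.
have f_add : zmod_morphism f.
  move=> u v; rewrite -{1}(PE u) -{1}(PE v) -hornerN -hornerD -rmorphB fE.
  by rewrite rmorphB hornerD hornerN.
have f_mul : monoid_morphism f.
  split=> [|u v].
    have {1}-> : (1 : L) = evalL 1 x by rewrite rmorph1 hornerC.
    by rewrite fE rmorph1 hornerC.
  by rewrite -{1}(PE u) -{1}(PE v) -hornerM -rmorphM fE rmorphM hornerM.
pose f1 := GRing.isZmodMorphism.Build L algC f f_add.
pose f2 := GRing.isMonoidMorphism.Build L algC f f_mul.
pose ff : {rmorphism L -> algC} := HB.pack f f1 f2.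
exists ff => /=.
have -> : x = evalL 'X x by rewrite map_polyX hornerX.
by rewrite fE map_polyX hornerX.
Qed.

(** One embedding for each root of m. They are as many as the powers of x that span L, so the
    Vandermonde matrix of the conjugates of x is square. *)
Lemma separating_embeddings :
  exists n (x : L) (f : 'I_n.+1 -> {rmorphism L -> algC}),
    injective (fun i => f i x) /\
    forall y, exists c : 'I_n.+1 -> rat, y = \sum_j c j *: x ^+ j.
Proof.
have [x [m [mm sm gen ann]]] := number_field_generator.
have [r Er] := closed_field_poly_normal (pQtoC m).
rewrite (monicP _) ?monic_map // scale1r in Er.
have ur : uniq r.
  by rewrite -separable_prod_XsubC -Er separable_map.
have szm : size m = (size r).+1.
  by rewrite -(size_map_poly (ratr : {rmorphism rat -> algC})) Er size_prod_XsubC.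
have nr : (0 < size r)%N.
  rewrite lt0n; apply/eqP => r0; have m1 : m %| 1 by rewrite dvdp1 szm r0.
  by rewrite -ann rmorph1 hornerC oner_eq0 in m1.
have rE : size r = (size r).-1.+1 by rewrite prednK.
set n := (size r).-1 in rE.
have ex (i : 'I_n.+1) : exists f : {rmorphism L -> algC}, f x = r`_i.
  apply: (generator_embedding gen ann).
  by rewrite Er root_prod_XsubC mem_nth // rE.
exists n, x, (fun i => sval (cid (ex i))); split.
  move=> i j; case: (cid _) => fi /= ->; case: (cid _) => fj /= -> /eqP.
  by rewrite nth_uniq ?rE // => /eqP e; exact: val_inj.
move=> y; have [q ->] := gen y; exists (fun j => (q %% m)`_j).
have -> : evalL q x = evalL (q %% m) x.
  rewrite [in LHS](divp_eq q m) rmorphD rmorphM hornerD hornerM.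
  by have /eqP -> : evalL m x == 0; rewrite ?ann // mulr0 add0r.
rewrite (@horner_coef_wide _ n.+1); last first.
  rewrite size_map_poly -ltnS -rE -szm ltn_modp; apply: monic_neq0 => //.
by apply: eq_bigr => j _; rewrite coef_map /= mulr_algl.
Qed.

End Embeddings.

Lemma ringint_Aint (F : fieldType) (f : {rmorphism F -> algC}) (y : F) :
  ringint y -> f y \in Aint.
Proof.
move=> [p mp py]; apply: (@root_monic_Aint (map_poly intr p)).
- have -> : map_poly (intr : int -> algC) p = map_poly f (map_poly intr p).
    by rewrite -map_poly_comp; apply: eq_map_poly => i /=; rewrite rmorph_int.
  by rewrite /root horner_map (rootP py) rmorph0.
- exact: monic_map.
- by apply/polyOverP => i; rewrite coef_map /= intr_int.
Qed.

Lemma algC_common_denominator (I : finType) (h : I -> algC) :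
  exists2 D : int, D != 0 & forall i, D%:~R * h i \in Aint.
Proof.
have ex i : exists m : int, m != 0 /\ m%:~R * h i \in Aint.
  have [r [_ mr] dv] := minCpolyP (h i).
  have [|m m0 im] := @algebraic_denominator _ (ratr : {rmorphism rat -> algC}) (h i).
    by exists r; rewrite ?monic_neq0 // dv.
  by exists m; split=> //; exact: (@ringint_Aint _ idfun).
have [m hm] := choice ex.
exists (\prod_i m i); first by apply/prodf_neq0 => i _; case: (hm i).
move=> i; rewrite (bigD1 i) //= rmorphM mulrAC rpredM //; first by case: (hm i).
exact: Aint_int.
Qed.

(** * Integers with bounded conjugates, and norms of nonzero integers *)

Section NumberField.
Variables (L : fieldExtType rat) (n : nat) (x : L).
Variable f : 'I_n.+1 -> {rmorphism L -> algC}.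
Hypothesis f_inj : injective (fun i => f i x).
Hypothesis power_span : forall y, exists c : 'I_n.+1 -> rat, y = \sum_j c j *: x ^+ j.

Let W : 'M[algC]_n.+1 := Vandermonde n.+1 (\row_i f i x).
Let conj y : 'rV[algC]_n.+1 := \row_i f i y.

Let unitW : W \in unitmx.
Proof.
rewrite unitmxE unitfE det_Vandermonde; apply/prodf_neq0 => i _.
apply/prodf_neq0 => j ij; rewrite !mxE subr_eq0; apply: contraTneq ij.
by move=> /f_inj ->; rewrite ltnn.
Qed.

Let conjE (c : 'I_n.+1 -> rat) :
  conj (\sum_j c j *: x ^+ j) = (\row_j ratr (c j)) *m W.
Proof.
apply/rowP => i; rewrite !mxE rmorph_sum; apply: eq_bigr => j _.
by rewrite !mxE rmorphZ_num rmorphXn.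
Qed.

(** The rational coordinates of y on the powers of x are recovered from its conjugates by [invmx W].
    Multiplied by D, which clears the denominators of [invmx W], they are rational algebraic
    integers, hence integers, bounded by B. *)
Lemma finite_integral_bounded (b : 'I_n.+1 -> nat) :
  finite_set [set y : L | ringint y /\ forall i, `|f i y| <= (b i)%:R].
Proof.
have [D D0 hD] := algC_common_denominator (fun ij : 'I_n.+1 * 'I_n.+1 => invmx W ij.1 ij.2).
pose B : algC := `|D%:~R| * \sum_j \sum_i (b i)%:R * `|invmx W i j|.
have B0 : 0 <= B.
  rewrite mulr_ge0 // sumr_ge0 // => j _; rewrite sumr_ge0 // => i _.
  by rewrite mulr_ge0.
pose N := Num.bound B; have BN : B < N%:R by exact: archi_boundP.
(* A value k in 0..2N stands for the integer k - N. *)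
pose g (k : {ffun 'I_n.+1 -> 'I_(N + N).+1}) : L :=
  \sum_j (((k j)%:Z - N%:Z)%:~R / D%:~R : rat) *: x ^+ j.
apply: (@sub_finite_set _ _ (g @` [set: _])); last first.
  by apply: finite_image; exact: finite_finset.
move=> y [iy by_].
have [c Ec] := power_span y.
have cE j : ratr (c j) = \sum_i f i y * invmx W i j.
  have := congr1 (fun M => (M *m invmx W) 0 j) (conjE c).
  rewrite -Ec mulmxK // !mxE => <-; apply: eq_bigr => i _.
  by rewrite /conj mxE.
have ck j : exists k : 'I_(N + N).+1, c j = ((k : nat)%:Z - N%:Z)%:~R / D%:~R.
  have DcA : (D%:~R * ratr (c j) : algC) \in Num.int.
    apply: Cint_rat_Aint.
      by rewrite rpredM ?Crat_rat // rpred_int.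
    rewrite cE mulr_sumr rpred_sum // => i _.
    by rewrite mulrCA rpredM ?(hD (i, j)) // ringint_Aint.
  have [k Ek] := intrP DcA.
  have kB : `|k%:~R : algC| <= B.
    rewrite -Ek normrM ler_wpM2l // cE [leRHS](bigD1 j) //=.
    apply: (@le_trans _ _ (\sum_i (b i)%:R * `|invmx W i j|)).
      apply: (le_trans (ler_norm_sum _ _ _)); apply: ler_sum => i _.
      by rewrite normrM ler_wpM2r.
    rewrite lerDl sumr_ge0 // => l _; rewrite sumr_ge0 // => i _.
    by rewrite mulr_ge0.
  have kN : (`|k| < N%:Z)%R.
    have : `|k%:~R : algC| < N%:R by exact: le_lt_trans BN.
    by rewrite -intr_norm pmulrn ltr_int.
  have kk : (absz (k + N%:Z)%R < (N + N).+1)%N by lia.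
  exists (Ordinal kk) => /=.
  have -> : (absz (k + N%:Z)%R)%:Z - N%:Z = k by lia.
  apply: (fmorph_inj (ratr : {rmorphism rat -> algC})).
  rewrite rmorphM fmorphV !rmorph_int -Ek mulrAC mulfV ?mul1r //.
  by rewrite intr_eq0.
have [k hk] := choice ck.
exists (finfun k) => //; rewrite Ec; apply: eq_bigr => j _.
by rewrite ffunE hk.
Qed.

(** The rational matrix C of multiplication by y on the powers of x is conjugated by W to the
    diagonal of the conjugates of y. Their product is thus det C, rational, and also an algebraic
    integer: a nonzero integer. *)
Lemma norm_prod_embeddings y : ringint y -> y != 0 -> 1 <= `|\prod_i f i y|.
Proof.
move=> iy y0.
have ex j : exists c : 'I_n.+1 -> rat, x ^+ (j : 'I_n.+1) * y = \sum_k c k *: x ^+ k.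
  exact: power_span.
have [c hc] := choice ex.
pose C : 'M[rat]_n.+1 := \matrix_(j, k) c j k.
have e : W *m diag_mx (conj y) = map_mx ratr C *m W.
  apply/row_matrixP => j; rewrite !row_mul.
  have := conjE (c j); rewrite -hc => e.
  have -> : row j (map_mx (ratr : rat -> algC) C) = \row_k ratr (c j k).
    by apply/rowP => k; rewrite !mxE.
  rewrite -e; apply/rowP => i; rewrite mul_mx_diag !mxE rmorphM rmorphXn.
  by [].
have := congr1 determinant e; rewrite !det_mulmx det_diag det_map_mx mulrC.
move/(mulIf _); rewrite -unitfE -unitmxE => /(_ unitW).
rewrite (eq_bigr (fun i => f i y)) => [Ed|i _]; last by rewrite mxE.
have pz : \prod_i f i y \in Num.int.
  apply: Cint_rat_Aint; first by rewrite Ed Crat_rat.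
  by apply: rpred_prod => i _; exact: ringint_Aint.
apply: norm_intr_ge1 => //; apply/prodf_neq0 => i _.
by rewrite fmorph_eq0.
Qed.

End NumberField.

(** The index k names the dyadic interval of z: numbers with the same index differ by a factor less
    than 2, as the pigeonhole argument requires. *)
Lemma natr_lt_half (z : algC) (k : nat) : (1 <= z) ->
  (trunc_log 2 (Num.truncn z) = k)%N -> (2 ^+ k <= z < 2 ^+ k.+1).
Proof.
move=> z1 e; have z0 : 0 <= z by exact: le_trans z1.
have t0 : (0 < Num.truncn z)%N by rewrite truncn_gt0.
have /andP [h1 h2] := trunc_log_bounds (isT : 1 < 2)%N t0.
have /andP [g1 g2] := truncn_itv z0.
rewrite -!natrX -e; apply/andP; split.
  by apply: le_trans g1; rewrite ler_nat.
by apply: (lt_le_trans g2); rewrite ler_nat.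
Qed.

Lemma neg_exprn (z : algC) k : z < 0 ->
  (0 < z ^+ k) = ~~ odd k /\ (z ^+ k < 0) = odd k.
Proof.
move=> z0; elim: k => [|k [IH1 IH2]].
  by rewrite expr0 ltr01 ltr10.
rewrite exprS /=; case ok: (odd k) IH1 IH2 => /= IH1 IH2.
  by rewrite (nmulr_rgt0 _ z0) (nmulr_rlt0 _ z0) IH2 IH1.
by rewrite (nmulr_rgt0 _ z0) (nmulr_rlt0 _ z0) IH2 IH1.
Qed.

Lemma fieldExt_denominator (F : fieldExtType rat) (y : F) :
  exists r, [/\ ringint r, r != 0 & ringint (r * y)].
Proof.
have [|m m0 im] := @algebraic_denominator F (in_alg F) y.
  have Om : minPoly 1 y \is a polyOver 1%VS := minPolyOver 1%AS y.
  have [q Eq] : exists q, minPoly 1 y = map_poly (in_alg F) q by apply/polyOver1P.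
  exists q; last by rewrite -Eq; exact: root_minPoly.
  rewrite -(map_poly_eq0 (in_alg F)) -Eq; apply: monic_neq0.
  exact: (monic_minPoly 1%AS y).
exists m%:~R; split=> //; first exact: integral_id.
rewrite -(rmorph_int (in_alg F)) fmorph_eq0 intr_eq0 //.
Qed.

(** * Units and signatures *)

Section Units.
Variables (L : fieldExtType rat) (n : nat) (x : L).
Variable f : 'I_n.+1 -> {rmorphism L -> algC}.
Hypothesis f_inj : injective (fun i => f i x).
Hypothesis power_span : forall y, exists c : 'I_n.+1 -> rat, y = \sum_j c j *: x ^+ j.

Definition is_unit (y : L) := [/\ y != 0, ringint y & ringint y^-1].

Variable U : 'I_n.+1 -> L.
Hypothesis unitU : forall i, is_unit (U i).

Let P (e : 'I_n.+1 -> nat) := \prod_i U i ^+ e i.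

Let unitP e : is_unit (P e).
Proof.
split; first by apply/prodf_neq0 => i _; rewrite expf_neq0 //; case: (unitU i).
  by apply: ringint_prod => i _; apply: ringintX; case: (unitU i).
rewrite /P -prodfV; apply: ringint_prod => i _; rewrite -exprVn.
by apply: ringintX; case: (unitU i).
Qed.

(** On the logarithmic scale in base 2 the conjugates of [P e] stay within c N of 0, where c adds up
    bounds for the U j and their inverses at all places. *)
Let P_bound : exists c : nat, forall i e N, (forall j, (e j < N)%N) ->
  `|f i (P e)| <= 2 ^+ (c * N) /\ 1 <= 2 ^+ (c * N) * `|f i (P e)|.
Proof.
have ex (ij : 'I_n.+1 * 'I_n.+1) : exists c : nat,
    `|f ij.1 (U ij.2)| <= 2 ^+ c /\ `|f ij.1 (U ij.2)|^-1 <= 2 ^+ c.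
  set z := `|_|; have z0 : 0 <= z by rewrite normr_ge0.
  have two_bound k : k%:R <= 2 ^+ k :> algC by rewrite -natrX ler_nat ltnW // ltn_expl.
  exists (maxn (Num.bound z) (Num.bound z^-1)); split.
    apply: (@le_trans _ _ ((Num.bound z)%:R)); first exact/ltW/archi_boundP.
    apply: (le_trans (two_bound _)); apply: ler_weXn2l; first by rewrite ler1n.
    by rewrite leq_maxl.
  apply: (@le_trans _ _ ((Num.bound z^-1)%:R)).
    by apply/ltW/archi_boundP; rewrite invr_ge0.
  apply: (le_trans (two_bound _)); apply: ler_weXn2l; first by rewrite ler1n.
  by rewrite leq_maxr.
have [c hc] := choice ex.
exists (\sum_i \sum_j c (i, j))%N => i e N eN.
have two1 : 1 <= 2 :> algC by rewrite ler1n.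
have two0 : 0 <= 2 :> algC by rewrite ler0n.
have le1 : (\sum_j c (i, j) * N <= (\sum_i \sum_j c (i, j)) * N)%N.
  by rewrite -big_distrl /= leq_mul2r [leqRHS](bigD1 i) //= leq_addr orbT.
have key (z : 'I_n.+1 -> algC) : (forall j, 0 <= z j) ->
    (forall j, z j <= 2 ^+ c (i, j)) ->
    \prod_j z j ^+ e j <= 2 ^+ ((\sum_i \sum_j c (i, j)) * N).
  move=> z0 zc; apply: (@le_trans _ _ (\prod_j 2 ^+ (c (i, j) * N))).
    apply: ler_prod => j _; rewrite exprn_ge0 //=.
    apply: (@le_trans _ _ ((2 ^+ c (i, j)) ^+ e j)).
      by apply: lerXn2r; rewrite ?nnegrE ?exprn_ge0.
    by rewrite -exprM; apply: ler_weXn2l => //; rewrite leq_mul2l (ltnW (eN j)) orbT.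
  by rewrite prodrXr; exact: ler_weXn2l.
have EP : `|f i (P e)| = \prod_j `|f i (U j)| ^+ e j.
  by rewrite rmorph_prod normr_prod; apply: eq_bigr => j _; rewrite rmorphXn normrX.
have fP0 : 0 < `|f i (P e)| by rewrite normr_gt0 fmorph_eq0; case: (unitP e).
split; first by rewrite EP; apply: key => // j; case: (hc (i, j)).
rewrite -ler_pdivrMr // mul1r EP -prodfV.
rewrite (eq_bigr (fun j => `|f i (U j)|^-1 ^+ e j)); last by move=> j _; rewrite exprVn.
by apply: key => j; [rewrite invr_ge0|case: (hc (i, j))].
Qed.

(* Pigeonhole: the N ^ n.+1 products P e with exponents below N fall in
   O(N ^ n) dyadic boxes for the first n absolute values; since the norm is
   1 in absolute value, two products in the same box differ by one of
   finitely many units. *)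
Lemma multiplicative_relation : exists e e' : 'I_n.+1 -> nat,
  (exists i, e i != e' i) /\ P e = P e'.
Proof.
have [c hc] := P_bound.
(* Ratios of products in the same box are at most 2 in absolute value at the places other than
   [ord0], and at most 2^n at [ord0]; 2^(n+1) serves for all places. *)
have /finite_seqP [w Ew] :=
  finite_integral_bounded f_inj power_span (fun=> 2 ^ n.+1)%N.
pose B := size w.
pose h := (2 * c + 1)%N.
(* Each place has 2 T + 1 <= h N boxes, and N > h^n B makes N^(n+1) exceed (h N)^n B. *)
pose N := (h ^ n * B).+1.
pose T := (c * N)%N.
apply: contrapT => no_rel.
have injP (e e' : {ffun 'I_n.+1 -> 'I_N}) : P (fun i => e i) = P (fun i => e' i) -> e = e'.
  move=> E; apply/ffunP => i; apply/eqP; apply: contrapT => /negP ne.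
  by apply: no_rel; exists (fun i => e i), (fun i => e' i); split=> //; exists i.
pose v (e : {ffun 'I_n.+1 -> 'I_N}) := P (fun i => e i).
(* The factor 2^T moves the absolute values into the interval from 1 to 2^(2T), so that their dyadic
   indices are natural numbers. *)
pose mag (e : {ffun 'I_n.+1 -> 'I_N}) i := 2 ^+ T * `|f i (v e)|.
have mag1 e i : 1 <= mag e i by apply: (hc i (fun i => e i) N _).2.
have magT e i : mag e i <= 2 ^+ (2 * T).
  rewrite mul2n -addnn exprD /mag; apply: ler_wpM2l; first by rewrite exprn_ge0.
  exact: (hc i (fun i => e i) N _).1.
have idx e i : (trunc_log 2 (Num.truncn (mag e i)) < (2 * T).+1)%N.
  have /andP [h1 _] := natr_lt_half (mag1 e i) (erefl _).
  rewrite ltnS -(leq_exp2l _ _ (isT : 1 < 2)%N) -(ler_nat algC) !natrX.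
  exact: le_trans h1 _.
pose box e : {ffun 'I_n -> 'I_(2 * T).+1} := [ffun i => Ordinal (idx e (lift ord0 i))].
have lt2 e e' i : box e = box e' -> `|f (lift ord0 i) (v e / v e')| <= 2.
  move=> /ffunP /(_ i); rewrite !ffunE => /(congr1 val) /= Ei.
  have /andP [_ h1] := natr_lt_half (mag1 e (lift ord0 i)) Ei.
  have /andP [h2 _] := natr_lt_half (mag1 e' (lift ord0 i)) (erefl _).
  have h3 : mag e (lift ord0 i) <= 2 * mag e' (lift ord0 i).
    by apply: (le_trans (ltW h1)); rewrite exprS ler_wpM2l ?ler0n.
  have v'0 : 0 < `|f (lift ord0 i) (v e')|.
    by rewrite normr_gt0 fmorph_eq0; case: (unitP (fun i => e' i)).
  rewrite fmorph_div normrM normfV ler_pdivrMr //.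
  by move: h3; rewrite /mag mulrCA ler_pM2l // exprn_gt0.
have ratio e e' : box e = box e' -> (v e / v e') \in w.
  move=> E; have [ve0 ive iveV] := unitP (fun i => e i).
  have [ve'0 ive' ive'V] := unitP (fun i => e' i).
  suff : [set` w] (v e / v e') by [].
  rewrite -Ew /=; split; first exact: ringintM.
  have two1 : 1 <= 2 :> algC by rewrite ler1n.
  move=> i; rewrite natrX; case: (unliftP ord0 i) => [j ->|->].
    by apply: (le_trans (lt2 e e' j E)); rewrite -{1}(expr1 2) ler_weXn2l.
  (* At [ord0], which the boxes leave out: the inverse ratio has norm at least 1, so the ratio is
     bounded there by n factors, each at most 2. *)
  have iq : ringint (v e' / v e) by exact: ringintM.
  have q0 : v e' / v e != 0 by rewrite mulf_neq0 ?invr_eq0.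
  have := norm_prod_embeddings f_inj power_span iq q0.
  rewrite big_ord_recl normrM -invf_div fmorphV normfV.
  rewrite ler_pdivlMl ?normr_gt0 ?fmorph_eq0 ?mulf_neq0 ?invr_eq0 // mulr1.
  move/le_trans; apply; rewrite normr_prod.
  apply: (@le_trans _ _ (\prod_(i < n) 2)).
    by apply: ler_prod => j _; rewrite normr_ge0 /= invf_div; exact: lt2.
  by rewrite prodr_const card_ord ler_weXn2l.
have fiber b : (#|[set e | box e == b]%SET| <= B)%N.
  have [->|[e0]] := set_0Vmem [set e | box e == b]%SET; first by rewrite cards0.
  rewrite inE => /eqP E0.
  rewrite cardE -(size_map (fun e => v e / v e0)); apply: uniq_leq_size.
    rewrite map_inj_uniq ?enum_uniq // => e e' /mulIf E; apply: injP; apply: E.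
    by rewrite invr_eq0; case: (unitP (fun i => e0 i)).
  move=> y /mapP [e]; rewrite mem_enum inE => /eqP E ->.
  by apply: ratio; rewrite E E0.
have : (#|{ffun 'I_n.+1 -> 'I_N}| <= #|{ffun 'I_n -> 'I_(2 * T).+1}| * B)%N.
  rewrite -sum1_card (partition_big box predT) //=.
  rewrite -sum_nat_const; apply: leq_sum => b _.
  by rewrite sum1_card; have := fiber b; rewrite cardsE.
rewrite !card_ffun !card_ord => bad.
have : (N ^ n.+1 <= (h * N) ^ n * B)%N.
  apply: (leq_trans bad); rewrite leq_mul2r; apply/orP; right.
  have [n0|n0] := posnP n; first by rewrite n0.
  rewrite leq_exp2r // /h /T; nia.
by rewrite expnMn expnS mulnAC leq_pmul2r ?expn_gt0 // ltnn.
Qed.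

End Units.

(** * Totally positive units are squares *)

Section TotallyPositiveUnits.
Variables (L : fieldExtType rat) (n : nat) (x : L).
Variable f : 'I_n.+1 -> {rmorphism L -> algC}.
Hypothesis f_inj : injective (fun i => f i x).
Hypothesis power_span : forall y, exists c : 'I_n.+1 -> rat, y = \sum_j c j *: x ^+ j.
Hypothesis hL : totally_real L.
Hypothesis hcl : strict_class_number_one L.

(* With q the integer part of f_i (m x) and m large, (m x - q) ^ 2 - 1 is
   negative exactly at the i-th place. *)
Lemma sign_element (i : 'I_n.+1) : exists y : L,
  f i y < 0 /\ forall k, k != i -> 0 < f k y.
Proof.
(* m > B makes m |f k x - f i x| exceed 2 for every k other than i, while m f_i x lies within 1 of
   its integer part q. *)
pose B : algC := \sum_(k | k != i) 2 / `|f k x - f i x|.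
have B0 : 0 <= B by apply: sumr_ge0 => k _; rewrite mulr_ge0 ?ler0n ?invr_ge0.
pose m := Num.bound B; have mB : B < m%:R by exact: archi_boundP.
pose z : algC := m%:R * f i x.
have zR : z \is Num.real by rewrite rpredM ?realn ?hL.
pose q := Num.floor z.
exists ((m%:R * x - q%:~R) ^+ 2 - 1).
have fE k : f k ((m%:R * x - q%:~R) ^+ 2 - 1) = (m%:R * f k x - q%:~R) ^+ 2 - 1.
  by rewrite !(rmorphB, rmorphXn, rmorphM, rmorph1, rmorph_nat, rmorph_int).
have /andP [q1 q2] := real_floor_itv zR.
have s0 : 0 <= z - q%:~R by rewrite subr_ge0.
have s1 : z - q%:~R < 1 by rewrite ltrBlDl -(intrD _ _ 1).
split=> [|k ki]; rewrite fE.
  by rewrite subr_lt0 expr_lt1.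
have dk : 0 < `|f k x - f i x|.
  by rewrite normr_gt0 subr_eq0; apply: contra ki => /eqP /f_inj ->.
have h2 : 2 < `|m%:R * f k x - z|.
  rewrite /z -mulrBr normrM normr_nat -ltr_pdivrMr //.
  apply: le_lt_trans mB; rewrite /B (bigD1 k) //= lerDl.
  by apply: sumr_ge0 => l _; rewrite mulr_ge0 ?ler0n ?invr_ge0.
have wR : m%:R * f k x - q%:~R \is Num.real.
  by rewrite rpredB ?rpredM ?realn ?hL // Rreal_int ?intr_int.
rewrite subr_gt0 -real_normK // expr_gt1 //.
have -> : m%:R * f k x - q%:~R = (m%:R * f k x - z) + (z - q%:~R) by rewrite addrA subrK.
have h3 := lerB_normD (m%:R * f k x - z) (z - q%:~R).
apply: lt_le_trans h3; rewrite ltrBrDl (ger0_norm s0).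
by apply: lt_trans h2; rewrite (_ : 2 = 1 + 1) // ltrD2r.
Qed.

(** By strict class number one the ideal (y) has a totally positive generator z; the unit y / z has
    the signs of y. *)
Lemma sign_unit (i : 'I_n.+1) : exists U : L,
  [/\ is_unit U, f i U < 0 & forall k, k != i -> 0 < f k U].
Proof.
have [y [yi yk]] := sign_element i.
have y0 : y != 0 by rewrite -(fmorph_eq0 (f i)) lt_eqF.
have [z zp Ez] := hcl (fractional_principal (@fieldExt_denominator L) y0).
have z0 : z != 0 by rewrite -(fmorph_eq0 (f i)) gt_eqF //; exact: zp.
have : principal z y by rewrite -Ez; exact: principal_id.
have : principal y z by rewrite Ez; exact: principal_id.
move=> /(principalP _ y0) h1 /(principalP _ z0) h2.
exists (z^-1 * y); split.
- by split; rewrite ?mulf_neq0 ?invr_eq0 // invfM invrK mulrC.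
- by rewrite rmorphM fmorphV pmulr_rlt0 ?invr_gt0 ?zp.
- by move=> k ki; rewrite rmorphM fmorphV pmulr_rgt0 ?invr_gt0 ?zp ?yk.
Qed.

(* A relation between eta and units U i of prescribed signs has even
   exponents, by signs, unless it makes eta a square; halve it. *)
Lemma totally_positive_unit_square (eta : L) :
  is_unit eta -> tot_pos eta -> exists v, eta = v ^+ 2.
Proof.
move=> ueta peta.
have [V hV] := choice sign_unit.
(* All the [U i] are positive at [ord0], and at another place i only [U i] is negative: the sign of
   a product there reveals the parity of its exponent of [U i]. *)
pose U i := if i == ord0 then eta else V i.
have unitU i : is_unit (U i).
  by rewrite /U; case: eqP => // _; case: (hV i).
have U0 i : U i != 0 by case: (unitU i).
have Uneg i : i != ord0 -> f i (U i) < 0.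
  by rewrite /U => /negPf ->; case: (hV i).
have Upos i k : k != i -> 0 < f k (U i).
  rewrite /U; case: (i == ord0) => ki; first exact: peta.
  by case: (hV i) => _ _; apply.
pose P (e : 'I_n.+1 -> nat) := \prod_i U i ^+ e i.
have P0 e : P e != 0 by apply/prodf_neq0 => i _; rewrite expf_neq0.
have Psg e i : i != ord0 -> (0 < f i (P e)) = ~~ odd (e i).
  move=> i0; rewrite /P (bigD1 i) //= rmorphM rmorphXn rmorph_prod /=.
  rewrite pmulr_lgt0; first by case: (neg_exprn (e i) (Uneg i i0)).
  by apply: prodr_gt0 => k ki; rewrite rmorphXn exprn_gt0 // Upos // eq_sym.
have Ppos e : 0 < f ord0 (P e).
  rewrite rmorph_prod; apply: prodr_gt0 => k _; rewrite rmorphXn exprn_gt0 //.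
  have [->|k0] := eqVneq k ord0; first by rewrite /U eqxx; exact: peta.
  by apply: Upos; rewrite eq_sym.
have [e [e' [ne E]]] := multiplicative_relation f_inj power_span unitU.
(* Descent on the sum of the exponents: when all parities agree, the relation is an equality of
   squares and halves, up to a sign that positivity at [ord0] excludes. *)
have [N] := ubnP (\sum_i (e i + e' i))%N.
elim: N e e' ne E => // N IH e e' ne E ltN.
pose h i := (e i)./2; pose h' i := (e' i)./2.
have odd_eq i : i != ord0 -> odd (e i) = odd (e' i).
  by move=> i0; apply: negb_inj; rewrite -!(Psg _ i i0) /P E.
pose R := \prod_(i | i != ord0) U i ^+ odd (e i).
have R0 : R != 0 by apply/prodf_neq0 => i _; rewrite expf_neq0.
have halve d : (forall i, i != ord0 -> odd (d i) = odd (e i)) ->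
    P d = P (fun i => (d i)./2) ^+ 2 * R * eta ^+ odd (d ord0).
  move=> hd; pose Q := \prod_(i | i != ord0) U i ^+ (d i)./2.
  have EQ : \prod_(i | i != ord0) U i ^+ d i = Q ^+ 2 * R.
    rewrite -prodrXl -big_split /=; apply: eq_bigr => i i0.
    by rewrite -exprM muln2 -hd // -exprD addnC odd_double_half.
  have Ee : eta ^+ d ord0 = (eta ^+ (d ord0)./2) ^+ 2 * eta ^+ odd (d ord0).
    by rewrite -exprM muln2 -exprD addnC odd_double_half.
  have UE : U ord0 = eta by rewrite /U eqxx.
  rewrite /P (bigD1 ord0) //= EQ [in RHS](bigD1 ord0) //= -/Q UE Ee.
  by ring.
move: E; rewrite -/(P e) -/(P e') (halve e) // (halve e'); last by move=> i /odd_eq.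
have Ph0 := P0 h; have Ph'0 := P0 h'.
have eta0 : eta != 0 by case: ueta.
have sq (u v : L) : u != 0 -> u ^+ 2 * R * eta = v ^+ 2 * R -> eta = (v / u) ^+ 2.
  move=> u0; rewrite mulrAC => /(mulIf R0) e1.
  by rewrite expr_div_n -e1 mulrAC mulfV ?mul1r // expf_neq0.
(* Opposite parities at [ord0] leave a single factor eta, which is then the quotient of two
   squares. *)
have [oo|] := eqVneq (odd (e ord0)) (odd (e' ord0)); last first.
  case: (odd (e ord0)); case: (odd (e' ord0)) => //= _; rewrite ?expr1 ?expr0 ?mulr1.
    by move/(sq _ _ Ph0) => ->; eexists.
  by move/esym/(sq _ _ Ph'0) => ->; eexists.
rewrite oo => /(mulIf (expf_neq0 _ eta0))/(mulIf R0)/eqP.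
rewrite eqf_sqr => /orP [/eqP Eh|/eqP Eh]; last first.
  by have := Ppos h; rewrite Eh rmorphN oppr_gt0 lt_gtF // Ppos.
apply: (IH h h') => //.
  case: ne => i ne; exists i; apply: contra ne => /eqP hh.
  have oi : odd (e i) = odd (e' i).
    by have [->|/odd_eq] := eqVneq i ord0.
  by rewrite -(odd_double_half (e i)) -(odd_double_half (e' i)) oi -/(h i) hh.
case: ne => i ne; rewrite (bigD1 i) //= in ltN; rewrite (bigD1 i) //=.
have hs : (\sum_(j | j != i) (h j + h' j) <= \sum_(j | j != i) (e j + e' j))%N.
  by apply: leq_sum => j _; rewrite /h /h'; lia.
have hi : (h i + h' i < e i + e' i)%N by rewrite /h /h'; lia.
by rewrite -ltnS; apply: leq_trans ltN; rewrite ltnS; exact: leq_add hi hs.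
Qed.

End TotallyPositiveUnits.

(** * Quadratic extensions *)

Section ScalarEmbedding.
Variables (L : fieldType) (K : fieldExtType L).
Implicit Types u v : L.

Lemma algD u v : (u + v)%:A = u%:A + v%:A :> K. Proof. exact: scalerDl. Qed.
Lemma algN u : (- u)%:A = - u%:A :> K. Proof. exact: scaleNr. Qed.
Lemma algB u v : (u - v)%:A = u%:A - v%:A :> K. Proof. exact: scalerBl. Qed.
Lemma algM u v : (u * v)%:A = u%:A * v%:A :> K.
Proof. exact: (rmorphM (in_alg K)). Qed.
Lemma algX u n : (u ^+ n)%:A = u%:A ^+ n :> K.
Proof. exact: (rmorphXn (in_alg K)). Qed.
Lemma algV u : (u^-1)%:A = (u%:A)^-1 :> K.
Proof. exact: (fmorphV (in_alg K)). Qed.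
Lemma alg0 : (0 : L)%:A = 0 :> K. Proof. exact: scale0r. Qed.
Lemma alg1 : (1 : L)%:A = 1 :> K. Proof. exact: scale1r. Qed.
Lemma alg_nat n : (n%:R : L)%:A = n%:R :> K.
Proof. exact: (rmorph_nat (in_alg K)). Qed.
Lemma alg_eq0 u : (u%:A == 0 :> K) = (u == 0).
Proof. exact: (fmorph_eq0 (in_alg K)). Qed.
Lemma alg_inj u v : u%:A = v%:A :> K -> u = v.
Proof. exact: (fmorph_inj (in_alg K)). Qed.
Definition algE := (algD, algB, algN, algM, algX, algV, alg0, alg1).

End ScalarEmbedding.

Section QuadraticExtension.
Variables (L : fieldExtType rat) (K : fieldExtType L) (r : K) (d : L).
Hypothesis dimK : \dim {:K} = 2.
Hypothesis r_sqr : r ^+ 2 = d%:A.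
Hypothesis r_notin : forall c : L, r != c%:A.

Lemma quad_indep (u v : L) : u%:A + v%:A * r = 0 :> K -> u = 0 /\ v = 0.
Proof.
move=> e; have v0 : v = 0.
  apply/eqP; apply: contrapT => /negP v0.
  have va0 : v%:A != 0 :> K by rewrite alg_eq0.
  have : r = (- (v^-1 * u))%:A.
    rewrite !algE; apply: (mulfI va0).
    by rewrite mulrN mulVKf //; apply/eqP; rewrite -addr_eq0 addrC e.
  by apply/eqP; exact: r_notin.
split=> //; move: e; rewrite v0 alg0 mul0r addr0 => /eqP.
by rewrite alg_eq0 => /eqP.
Qed.

Lemma quad_inj (u v u' v' : L) :
  u%:A + v%:A * r = u'%:A + v'%:A * r :> K -> u = u' /\ v = v'.
Proof.
move=> e; have [|/eqP h /eqP h'] := @quad_indep (u - u') (v - v').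
  by rewrite !algE; apply/eqP; rewrite mulrBl addrACA -opprD subr_eq0 e.
by split; apply/eqP; rewrite -subr_eq0.
Qed.

Lemma quad_decomp (z : K) : exists u v : L, z = u%:A + v%:A * r.
Proof.
have fr : free [tuple 1; r].
  apply/freeP => k; rewrite !big_ord_recl big_ord0 /= addr0 => e i.
  have [|e0 e1] := @quad_indep (k ord0) (k (lift ord0 ord0)).
    by rewrite mulr_algl.
  by case: (unliftP ord0 i) => [j ->|-> //]; rewrite (ord1 j).
have bs : basis_of {:K} [tuple 1; r].
  by rewrite basisEfree fr subvf /= dimK.
exists (coord [tuple 1; r] ord0 z), (coord [tuple 1; r] (lift ord0 ord0) z).
rewrite {1}(coord_basis bs (memvf z)) !big_ord_recl big_ord0 addr0 /=.
by rewrite mulr_algl.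
Qed.

(** Source of the complex embeddings of K, of the conjugation of K' over L, and of the isomorphism
    between K and K' that has to be excluded. *)
Lemma quad_extend (E : fieldType) (f : {rmorphism L -> E}) (rho : E) :
  rho ^+ 2 = f d -> exists F : {rmorphism K -> E},
    (forall c, F c%:A = f c) /\ F r = rho.
Proof.
move=> rho_sqr.
have ex z : exists uv : L * L, z = uv.1%:A + uv.2%:A * r.
  by have [u [v ->]] := quad_decomp z; exists (u, v).
have [c hc] := choice ex.
pose F z := f (c z).1 + f (c z).2 * rho.
have FE u v : F (u%:A + v%:A * r) = f u + f v * rho.
  by rewrite /F; have [<- <-] := quad_inj (hc (u%:A + v%:A * r)).
have F_add : zmod_morphism F.
  move=> y z; rewrite {1}(hc y) {1}(hc z) opprD addrACA -mulrBl -!algB FE /F.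
  by rewrite !rmorphB /=; ring.
have F_mul : monoid_morphism F.
  split=> [|y z].
    have -> : 1 = (1 : L)%:A + (0 : L)%:A * r by rewrite !algE; ring.
    by rewrite FE rmorph1 rmorph0 mul0r addr0.
  rewrite (hc y) (hc z); move: (c y) (c z) => [u v] [u' v'] /=.
  have -> : (u%:A + v%:A * r) * (u'%:A + v'%:A * r) =
      (u * u' + v * v' * d)%:A + (u * v' + v * u')%:A * r.
    by rewrite !algE -r_sqr; ring.
  by rewrite !FE !(rmorphD, rmorphM) /= -rho_sqr; ring.
pose F1 := GRing.isZmodMorphism.Build K E F F_add.
pose F2 := GRing.isMonoidMorphism.Build K E F F_mul.
pose FF : {rmorphism K -> E} := HB.pack F F1 F2.
exists FF => /=; split=> [u|].
  have {1}-> : u%:A = u%:A + (0 : L)%:A * r by rewrite !algE mul0r addr0.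
  by rewrite FE rmorph0 mul0r addr0.
have {1}-> : r = (0 : L)%:A + (1 : L)%:A * r by rewrite !algE add0r mul1r.
by rewrite FE rmorph0 rmorph1 mul1r add0r.
Qed.

End QuadraticExtension.

(** * Trace and norm as coefficients of the characteristic polynomial *)

Section TraceNorm.
Import passmx.
Variables (L : fieldExtType rat) (K : fieldExtType L).
Hypothesis dimK : \dim {:K} = 2.

(** Coordinates are row vectors, so the row of basis elements is multiplied by y under M^T: it is an
    eigenvector with eigenvalue y. *)
Lemma char_poly_mulmx_of (y : K) :
  root (map_poly (in_alg K) (char_poly (mulmx_of y))) y.
Proof.
rewrite map_char_poly; set M := map_mx _ _; set e := vbasis {:K}.
have be : basis_of {:K} e := vbasisP _.
have -> : char_poly M = char_poly M^T.
  rewrite /char_poly -det_tr; congr (\det _); apply/matrixP => i j.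
  by rewrite !mxE eq_sym.
rewrite -eigenvalue_root_char; apply/eigenvalueP.
exists (\row_i e`_i).
  apply/rowP => i; rewrite !mxE.
  have := vecof_delta e i => ei.
  have /esym := rVof_app e be (amull y) e`_i.
  move/(congr1 (vecof e)); rewrite (rVofK be) lfunE /= => <-.
  rewrite (rVofE be) -rowE /vecof; apply: eq_bigr => j _.
  by rewrite !mxE mulrC mulr_algl.
have e0 : e`_0 != 0.
  by apply: (free_not0 (basis_free be)); rewrite mem_nth // size_tuple dimK.
have k0 : (0 < \dim {:K})%N by rewrite dimK.
apply/eqP => /rowP /(_ (Ordinal k0)); rewrite !mxE => /eqP.
exact/negP.
Qed.

Lemma quad_char_eq (y : K) : y ^+ 2 - (relTr y)%:A * y + (relN y)%:A = 0.
Proof.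
have := char_poly_mulmx_of y; set P := char_poly _.
have sP : size (map_poly (in_alg K) P) = 3.
  by rewrite size_map_poly size_char_poly dimK.
rewrite /root horner_coef sP !big_ord_recl big_ord0 /= !coef_map /= => /eqP <-.
have h1 : (\dim {:K}).-1 = 1%N by rewrite dimK.
have s1 : (-1) ^+ \dim {:K} = 1 :> L by rewrite dimK sqrrN expr1n.
have -> : P`_0 = relN y by rewrite /P char_poly_det s1 mul1r.
have -> : P`_1 = - relTr y.
  transitivity (P`_(\dim {:K}).-1); first by rewrite h1.
  by apply: char_poly_trace; rewrite dimK.
have -> : P`_2 = 1.
  transitivity (P`_(\dim {:K})); first by rewrite dimK.
  have /monicP := char_poly_monic (mulmx_of y).
  by rewrite lead_coefE size_char_poly.
by rewrite !algE /bump /= !addn0 expr0 expr1; ring.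
Qed.

Lemma mulmx_of_scalar (c : L) : mulmx_of (c%:A : K) = c%:M.
Proof.
have be : basis_of {:K} (vbasis {:K}) := vbasisP _.
have E : amull (c%:A : K) = c *: \1%VF.
  by apply/lfunP => z; rewrite !lfunE /= lfunE /= mulr_algl.
by rewrite /mulmx_of E linearZ /= mxof1 ?(basis_free be) // scalemx1.
Qed.

Lemma relN_scalar (c : L) : relN (c%:A : K) = c ^+ 2.
Proof. by rewrite /relN mulmx_of_scalar det_scalar dimK. Qed.

End TraceNorm.

Lemma ringint_rmorph (F E : fieldType) (f : {rmorphism F -> E}) (x : F) :
  ringint (f x) <-> ringint x.
Proof.
have Ef p : map_poly (intr : int -> E) p = map_poly f (map_poly intr p).
  by rewrite -map_poly_comp; apply: eq_map_poly => i /=; rewrite rmorph_int.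
split=> -[p mp px]; exists p => //; move: px; rewrite Ef fmorph_root //.
Qed.

(** * Class number one *)

Section PrincipalIdealDomain.
Variable L : fieldExtType rat.
Hypothesis pid : forall I : set L, fractional I -> exists2 x : L, x != 0 & I = principal x.
Implicit Types (c x y : L).

(** The ideals (i / c^n) increase inside the integers. Their union I is principal, so the chain
    stops, which makes c a unit. *)
Lemma infinite_divisor (c i : L) : i != 0 -> c != 0 -> ringint c ->
  (forall n, ringint (c ^- n * i)) -> ringint c^-1.
Proof.
move=> i0 c0 hc hn.
pose I := [set y : L | exists n, ringint (c ^+ n / i * y)].
have up n m y : ringint (c ^+ n / i * y) -> ringint (c ^+ (n + m) / i * y).
  move=> h; rewrite addnC exprD -!mulrA; apply: ringintM; first exact: ringintX.
  by rewrite mulrA.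
have [|x x0 Ex] := pid (I := I).
  split.
  - move=> u v [n hu] [m hv]; exists (n + m)%N; rewrite mulrDr.
    by apply: ringintD; [exact: up|rewrite addnC; exact: up].
  - by move=> s u hs [n hu]; exists n; rewrite mulrCA; exact: ringintM.
  - by exists i => //; exists 0%N; rewrite expr0 mul1r mulVf //; exact: ringint1.
  - exists 1; split; [exact: ringint1|exact: oner_neq0|].
    move=> y [n h]; rewrite mul1r.
    have := ringintM (hn n) h; congr ringint.
    by field; rewrite i0 expf_neq0.
have [n hx] : I x by rewrite Ex; exact: principal_id.
have : I (c ^- n.+1 * i).
  exists n.+1; rewrite (_ : _ * _ = 1); first exact: ringint1.
  by field; rewrite i0 expf_neq0.
rewrite Ex => -[y hy e].
have := ringintM hx hy; congr ringint; rewrite -(mulrA _ x y) e exprS.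
by field; rewrite c0 i0 expf_neq0.
Qed.

(* A maximal element, given by Zorn's lemma, among the proper ideals that
   contain c. *)
Lemma nonunit_in_prime c : c != 0 -> ringint c -> ~ ringint c^-1 ->
  exists2 P : set L, prime_ideal P & P c.
Proof.
move=> c0 hc cV.
pose good (I : set L) := [/\ integral_ideal I, I c & ~ I 1].
have denL := @fieldExt_denominator L.
have goodc : good (principal c).
  split; [exact: integral_principal|exact: principal_id|].
  by move=> /(principalP _ c0); rewrite mulr1.
pose P := [set I : set L | I = set0 \/ good I].
have [|M [PM maxM]] := @Zorn_bigcup _ P.
  move=> C CP totC; have [[I0 [CI0 I0c]]|noC] := pselect (exists I0, C I0 /\ I0 c); last first.
    left; apply/seteqP; split=> // y [I CI Iy].
    case: (CP _ CI) => [I0|gI]; first by rewrite I0 in Iy.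
    by case: noC; exists I; split=> //; case: gI.
  right; pose J := \bigcup_(I in C) I.
  have gI I y : C I -> I y -> good I by move=> /CP [->|].
  have sJ : J `<=` ringint by move=> y [I CI Iy]; case: (gI I y CI Iy) => -[_ s] _ _; exact: s.
  split.
  - split=> //; split.
    + move=> u v [I CI Iu] [I' CI' Iv].
      have [II'|I'I] := totC _ _ CI CI'.
        exists I' => //; case: (gI _ _ CI' Iv) => -[h _] _ _; apply: fracD => //.
        exact: II'.
      exists I => //; case: (gI _ _ CI Iu) => -[h _] _ _; apply: fracD => //.
      exact: I'I.
    + move=> s u hs [I CI Iu]; exists I => //.
      by case: (gI _ _ CI Iu) => -[h _] _ _; exact: fracM.
    + by exists c => //; exists I0.
    + exists 1; split; [exact: ringint1|exact: oner_neq0|].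
      by move=> y /sJ; rewrite mul1r.
  - by exists I0.
  - by move=> [I CI I1]; case: (gI _ _ CI I1).
have gM : good M.
  case: PM => // M0; exfalso; apply: (maxM (principal c)); last by right.
  by rewrite M0; split=> // h; have := h c (principal_id c).
have [[fM sM] Mc M1] := gM.
exists M => //; split=> //.
  by move=> e; apply: M1; rewrite e; exact: ringint1.
move=> x y hx hy Mxy; apply: contrapT => /not_orP [nx ny].
have big z : ringint z -> ~ M z -> exists m s, [/\ M m, ringint s & m + s * z = 1].
  move=> hz nz; pose J := [set u | exists m s, [/\ M m, ringint s & u = m + s * z]].
  have sMJ : M `<=` J by move=> m Mm; exists m, 0; rewrite mul0r addr0; split=> //; exact: ringint0.
  have sJ : J `<=` ringint.
    by move=> _ [m [s [/sM hm hs ->]]]; apply: ringintD => //; exact: ringintM.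
  apply: contrapT => no1.
  have gJ : good J.
    split.
    - split=> //; split.
      + move=> _ _ [m [s [Mm hs ->]]] [m' [s' [Mm' hs' ->]]].
        exists (m + m'), (s + s'); split; [exact: fracD|exact: ringintD|by ring].
      + move=> t _ ht [m [s [Mm hs ->]]].
        by exists (t * m), (t * s); split; [exact: fracM|exact: ringintM|ring].
      + by exists c => //; exact: sMJ.
      + exists 1; split; [exact: ringint1|exact: oner_neq0|].
        by move=> u /sJ; rewrite mul1r.
    - exact: sMJ.
    - by move=> [m [s [Mm hs /esym e]]]; apply: no1; exists m, s.
  apply: (maxM J); last by right.
  split=> // sJM; apply: nz; apply: sJM; exists 0, 1.
  by split; [exact: frac0|exact: ringint1|rewrite add0r mul1r].
have [m [s [Mm hs e]]] := big x hx nx.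
have [m' [s' [Mm' hs' e']]] := big y hy ny.
apply: M1.
(* This expands (m + s x) (m' + s' y); every term lies in M, the last one because x y does. *)
have -> : 1 = m * m' + m * (s' * y) + s * x * m' + s * s' * (x * y).
  by rewrite -[LHS]mulr1 -{1}e -e'; ring.
do 3?apply: fracD => //.
- by apply: fracM => //; exact: sM.
- by rewrite mulrC; apply: fracM => //; exact: ringintM.
- by apply: fracM => //; exact: ringintM.
- by apply: fracM => //; exact: ringintM.
Qed.

Lemma prime_generator (P : set L) : prime_ideal P ->
  exists2 pi, pi != 0 & [/\ P = principal pi, ringint pi & ~ ringint pi^-1].
Proof.
move=> [[fP sP] neP _]; have [pi pi0 E] := pid fP.
have Ppi : P pi by rewrite E; exact: principal_id.
exists pi => //; split=> //; first exact: sP.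
move=> h; apply: neP; apply/seteqP; split=> // y hy.
by rewrite E; apply/principalP => //; exact: ringintM.
Qed.

(** Write pi = rho c. Primality of P puts rho or c in P, and c in P would make rho a unit. *)
Lemma prime_subset_eq (P Q : set L) : prime_ideal P -> prime_ideal Q ->
  P `<=` Q -> P = Q.
Proof.
move=> pP pQ PQ; have [pi pi0 [EP hpi _]] := prime_generator pP.
have [rho rho0 [EQ hrho rhoV]] := prime_generator pQ.
have Ppi : P pi by rewrite EP; exact: principal_id.
have hc : ringint (rho^-1 * pi) by apply/principalP => //; rewrite -EQ; exact: PQ.
have fP : fractional P by case: pP => -[].
have [_ _ /(_ rho (rho^-1 * pi) hrho hc)] := pP; rewrite mulVKf // => /(_ Ppi) [Pr|Pc].
  by apply/seteqP; split=> //; rewrite EQ; exact: principal_mem.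
case: rhoV; move: Pc; rewrite EP => /(principalP _ pi0).
by rewrite mulrCA mulVf // mulr1.
Qed.

(* Let e generate the annihilator of x modulo d. A prime pi dividing e divides
   d, hence x, so that d / pi annihilates x too: e divides d / pi. *)
Lemma squarefree_dvd (d x : L) : d != 0 -> ringint d -> ringint x ->
  (forall P, prime_ideal P -> P d -> P x) ->
  (forall P pi, prime_ideal P -> P = principal pi -> ~ ringint (d / pi ^+ 2)) ->
  ringint (x / d).
Proof.
move=> d0 hd hx inP sqf.
have [->|x0] := eqVneq x 0; first by rewrite mul0r; exact: ringint0.
have [|e e0 Ee] := pid (I := [set y | ringint y /\ ringint (y * x / d)]).
  split.
  - move=> u v [hu hu'] [hv hv']; split; first exact: ringintD.
    by rewrite !mulrDl; exact: ringintD.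
  - move=> s u hs [hu hu']; split; first exact: ringintM.
    by rewrite -!mulrA; apply: ringintM => //; rewrite mulrA.
  - by exists d => //; split=> //; rewrite mulrAC mulfV // mul1r.
  - exists 1; split; [exact: ringint1|exact: oner_neq0|].
    by move=> y [hy _]; rewrite mul1r.
have [he hex] : [set y | ringint y /\ ringint (y * x / d)] e.
  by rewrite Ee; exact: principal_id.
have hde : ringint (e^-1 * d).
  apply/principalP => //; rewrite -Ee /=; split=> //.
  by rewrite mulrAC mulfV // mul1r.
have [eV|eV] := pselect (ringint e^-1).
  by have := ringintM eV hex; rewrite -mulrA mulKf.
have [P PP Pe] := nonunit_in_prime e0 he eV.
have [pi pi0 [EP hpi piV]] := prime_generator PP.
have fP : fractional P by case: PP => -[].
have Pd : P d by rewrite -(mulVKf e0 d) mulrC; exact: fracM.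
have Px := inP P PP Pd.
exfalso; have h1 : ringint (pi^-1 * x) by apply/principalP => //; rewrite -EP.
have h2 : ringint (pi^-1 * e) by apply/principalP => //; rewrite -EP.
have h3 : ringint (pi^-1 * d) by apply/principalP => //; rewrite -EP.
have : [set y | ringint y /\ ringint (y * x / d)] (pi^-1 * d).
  by split=> //; move: h1; congr ringint; field; rewrite d0.
rewrite Ee => /(principalP _ e0) h4.
apply: (sqf P pi PP EP); have := ringintM h2 h4; congr ringint.
by field; rewrite e0 pi0.
Qed.

End PrincipalIdealDomain.

Lemma ringint_alg (L : fieldExtType rat) (K : fieldExtType L) (x : L) :
  ringint (x%:A : K) <-> ringint x.
Proof. exact: (ringint_rmorph (in_alg K)). Qed.

Lemma ringint_quad (L : fieldExtType rat) (K : fieldExtType L) (z : K) (T N : L) :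
  ringint T -> ringint N -> z ^+ 2 - T%:A * z + N%:A = 0 -> ringint z.
Proof.
move=> hT hN e.
pose P : {poly K} := 'X^2 + ((- T)%:A *: 'X + (N%:A)%:P).
have sP : (size ((- T)%:A *: 'X + (N%:A)%:P : {poly K})%R < 3)%N.
  rewrite ltnS; apply: (leq_trans (size_polyD _ _)); rewrite geq_max; apply/andP; split.
    by apply: (leq_trans (size_scale_leq _ _)); rewrite size_polyX.
  by apply: (leq_trans (size_polyC_leq1 _)).
apply: (@integral_root_monic _ _ (intr : int -> K) z P).
- by rewrite monicE lead_coefDl ?size_polyXn // lead_coefXn.
- by rewrite /root !hornerE; apply/eqP; rewrite -[RHS]e !algN mulNr.
- apply: (integral_poly (intr : {rmorphism int -> K}) P).1 => i.
  rewrite !coefE; apply: ringintD; first exact: ringint_nat.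
  apply: ringintD; last by case: (i == 0%N); [exact/ringint_alg|exact: ringint0].
  by apply: ringintM; [apply/ringint_alg; exact: ringintN|exact: ringint_nat].
Qed.

(** * Ideals of a quadratic extension with conjugation *)

Section Conjugation.
Variables (L : fieldExtType rat) (K : fieldExtType L) (bar : {rmorphism K -> K}).
Hypothesis dimK : \dim {:K} = 2.
Hypothesis barA : forall x : L, bar x%:A = x%:A.
Hypothesis barK : involutive bar.
Hypothesis bar_fix : forall z : K, bar z = z -> exists u : L, z = u%:A.
Hypothesis pid : forall I : set L, fractional I -> exists2 x : L, x != 0 & I = principal x.
Implicit Types (I J C P : set K) (x y z : K).

Lemma ringint_bar z : ringint (bar z) <-> ringint z.
Proof. exact: ringint_rmorph. Qed.

(** z and [bar z] are both roots of the characteristic polynomial of z. If they differ, their sum is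
    the trace and their product the norm; otherwise z lies in L. *)
Lemma relNE z : (relN z)%:A = z * bar z.
Proof.
have [/eqP e|ne] := boolP (bar z == z).
  by rewrite e; have [u ->] := bar_fix e; rewrite relN_scalar // algX expr2.
have h1 := quad_char_eq dimK z.
have h2 : bar z ^+ 2 - (relTr z)%:A * bar z + (relN z)%:A = 0.
  by rewrite -[RHS](rmorph0 bar) -h1 rmorphD rmorphB rmorphXn rmorphM /= !barA.
have : (z - bar z) * (z + bar z - (relTr z)%:A) = 0.
  have : (z ^+ 2 - (relTr z)%:A * z + (relN z)%:A) -
     (bar z ^+ 2 - (relTr z)%:A * bar z + (relN z)%:A) = 0 by rewrite h1 h2 subrr.
  by move=> <-; ring.
move/eqP; rewrite mulf_eq0 subr_eq0 eq_sym (negPf ne) /= subr_eq0 => /eqP e.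
apply/eqP; rewrite -subr_eq0; apply/eqP; rewrite -[RHS]h1 -e; ring.
Qed.

Lemma traceE z : exists T : L, T%:A = z + bar z.
Proof.
by have [|T ->] := @bar_fix (z + bar z); [rewrite rmorphD barK addrC|exists T].
Qed.

Lemma relN_eq0 z : (relN z == 0) = (z == 0).
Proof.
by rewrite -(alg_eq0 K) relNE mulf_eq0 fmorph_eq0 orbb.
Qed.

Lemma relNM y z : relN (y * z) = relN y * relN z.
Proof. by apply: (@alg_inj _ K); rewrite algM !relNE rmorphM /=; ring. Qed.

Lemma relN_bar z : relN (bar z) = relN z.
Proof. by apply: (@alg_inj _ K); rewrite !relNE barK mulrC. Qed.

Lemma ringint_relN z : ringint z -> ringint (relN z).
Proof.
move=> hz; apply/(ringint_alg K); rewrite relNE; apply: ringintM => //.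
exact/ringint_bar.
Qed.

Lemma ringint_TN (z : K) (T : L) : T%:A = z + bar z -> ringint T -> ringint (relN z) -> ringint z.
Proof.
move=> eT hT hN; apply: (ringint_quad hT hN); rewrite eT relNE; ring.
Qed.

Lemma denK z : exists r, [/\ ringint r, r != 0 & ringint (r * z)].
Proof.
have [T eT] := traceE z.
have [s [hs s0 hsT]] := fieldExt_denominator T.
have [t [ht t0 htN]] := fieldExt_denominator (relN z).
exists (s * t)%:A; split; first by apply/ringint_alg; exact: ringintM.
  by rewrite alg_eq0 mulf_neq0.
apply: (@ringint_TN _ (s * t * T)).
- by rewrite algM eT rmorphM /= barA mulrDr.
- by rewrite mulrAC; exact: ringintM.
- rewrite (_ : relN _ = s ^+ 2 * t * (t * relN z)); last first.
    by rewrite relNM relN_scalar //; ring.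
  by do 2?apply: ringintM => //; exact: ringintX.
Qed.

Let fracP z : z != 0 -> fractional (principal z).
Proof. exact: fractional_principal denK _. Qed.

Lemma image_barM I J : bar @` (I &* J) = (bar @` I) &* (bar @` J).
Proof.
have half I' J' : bar @` (I' &* J') `<=` (bar @` I') &* (bar @` J').
  move=> _ [_ [n [u [v [h ->]]]] <-]; exists n, (fun i => bar (u i)), (fun i => bar (v i)).
  split=> [i|]; first by have [? ?] := h i; split; [exists (u i)|exists (v i)].
  by rewrite rmorph_sum; apply: eq_bigr => i _; rewrite rmorphM.
have kk I' : bar @` (bar @` I') = I'.
  apply/seteqP; split=> [_ [_ [z Iz <-] <-]|z Iz]; first by rewrite barK.
  by exists (bar z); [exists z|rewrite barK].
apply/seteqP; split; first exact: half.
have := half (bar @` I) (bar @` J); rewrite !kk => h z hz.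
by exists (bar z); [apply: h; exists z|rewrite barK].
Qed.

Lemma fractional_bar I : fractional I -> fractional (bar @` I).
Proof.
move=> fI; have [_ _ [x Ix x0] [r [hr r0 hrI]]] := fI; split.
- by move=> _ _ [u Iu <-] [v Iv <-]; exists (u + v); [exact: fracD|rewrite rmorphD].
- move=> s _ hs [u Iu <-]; exists (bar s * u); last by rewrite rmorphM barK.
  by apply: fracM => //; exact/ringint_bar.
- by exists (bar x); [exists x|rewrite fmorph_eq0].
- exists (bar r); split; [exact/ringint_bar|by rewrite fmorph_eq0|].
  by move=> _ [y Iy <-]; rewrite -rmorphM; apply/ringint_bar; exact: hrI.
Qed.

Lemma bar_ringint : bar @` ringint = ringint.
Proof.
apply/seteqP; split=> [_ [z hz <-]|z hz]; first exact/ringint_bar.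
by exists (bar z); [exact/ringint_bar|rewrite barK].
Qed.

(* The generator of idealN I divides the norm and, by polarization, the trace
   of x * bar y for all x, y in I. *)
Lemma ideal_mul_bar I : fractional I ->
  exists n : L, [/\ n != 0, idealN I = principal n & I &* (bar @` I) = principal n%:A].
Proof.
move=> fI; have [_ _ [x0 Ix0 x0n] [r [hr r0 hrI]]] := fI.
have NI x : I x -> idealN I (relN x).
  move=> Ix; exists 1%N, (fun=> 1), (fun=> x); rewrite big_ord1 mul1r.
  by split=> // _; split=> //; exact: ringint1.
have fN : fractional (idealN I).
  split.
  - move=> _ _ [n [u [v [h ->]]]] [m [u' [v' [h' ->]]]].
    exists (n + m)%N, (fun i : 'I_(n + m) => match fintype.split i with inl j => u j | inr j => u' j end),
      (fun i : 'I_(n + m) => match fintype.split i with inl j => v j | inr j => v' j end).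
    split=> [i|]; first by case: (fintype.split i).
    rewrite big_split_ord /=; congr (_ + _); apply: eq_bigr => i _.
      by rewrite (unsplitK (inl i)).
    by rewrite (unsplitK (inr i)).
  - move=> s _ hs [n [u [v [h ->]]]]; exists n, (fun i => s * u i), v; split=> [i|].
      by have [? ?] := h i; split=> //; exact: ringintM.
    by rewrite mulr_sumr; apply: eq_bigr => i _; rewrite mulrA.
  - by exists (relN x0); [exact: NI|rewrite relN_eq0].
  - exists (relN r); split; [exact: ringint_relN|by rewrite relN_eq0|].
    move=> _ [n [u [v [h ->]]]]; rewrite mulr_sumr; apply: ringint_sum => i _.
    have [hu Iv] := h i; rewrite mulrCA -relNM; apply: ringintM => //.
    by apply: ringint_relN; exact: hrI.
have [n n0 En] := pid fN; exists n; split=> //.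
have n0A : n%:A != 0 :> K by rewrite alg_eq0.
have divN (c : L) : idealN I c -> ringint (n^-1 * c).
  by rewrite En => /(principalP _ n0).
have fII := fractional_mul fI (fractional_bar fI).
apply/seteqP; split; last first.
  apply: principal_mem => //.
  have [m [u [v [h e]]]] : idealN I n by rewrite En; exact: principal_id.
  rewrite e [_%:A](rmorph_sum (in_alg K)); apply: frac_sum => // i _.
  have [hu Iv] := h i.
  rewrite /= algM relNE mulrA; apply: imul_mem; last by exists (v i).
  by apply: fracM => //; exact/ringint_alg.
apply: imul_subf; first exact: fracP.
move=> x _ Ix [y Iy <-]; apply/principalP => //; rewrite -algV.
have Ixy : I (x + y) by exact: fracD.
pose T := relN (x + y) - relN x - relN y.
have eT : T%:A = x * bar y + bar x * y.
  by rewrite !algB !relNE rmorphD /=; ring.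
apply: (@ringint_TN _ (n^-1 * T)).
- by rewrite algM eT !rmorphM barA barK /=; ring.
- by apply: divN; do 2?apply: fracB => //; exact: NI.
(* The norm of x * bar y / n is N(x)/n times N(y)/n, so no information on x * bar y beyond the
   generators of [idealN I] is needed. *)
- rewrite (_ : relN _ = (n^-1 * relN x) * (n^-1 * relN y)); last first.
    by rewrite !relNM relN_scalar // relN_bar; ring.
  by apply: ringintM; apply: divN; exact: NI.
Qed.

Lemma fractional_iinv I : fractional I -> fractional (iinv I).
Proof. exact: fractional_inv denK _. Qed.

Lemma mul_iinv I : fractional I -> I &* iinv I = ringint.
Proof.
move=> fI; have [n [n0 _ En]] := ideal_mul_bar fI.
have nA0 : n%:A != 0 :> K by rewrite alg_eq0.
have fJ : fractional ((bar @` I) &* principal (n%:A)^-1).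
  by apply: fractional_mul; [exact: fractional_bar|apply: fracP; rewrite invr_eq0].
have e : I &* ((bar @` I) &* principal (n%:A)^-1) = ringint.
  by rewrite imulA En principalM mulfV // principal1.
by rewrite (inv_unique fI fJ e).
Qed.

Lemma imul_cancel I J C : fractional I -> fractional J -> fractional C ->
  I &* C = J &* C -> I = J.
Proof.
move=> fI fJ fC /(congr1 (fun X => X &* iinv C)).
by rewrite -!imulA mul_iinv // !imul1.
Qed.

Lemma imul_cancel_sub I J C : fractional I -> fractional J -> fractional C ->
  I &* C `<=` J &* C -> I `<=` J.
Proof.
move=> fI fJ fC h.
rewrite -(imul1 fI) -(imul1 fJ) -(mul_iinv fC) !imulA.
by apply: imulS.
Qed.

Lemma iinvM I J : fractional I -> fractional J -> iinv (I &* J) = iinv I &* iinv J.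
Proof.
move=> fI fJ; apply: inv_unique; try exact: fractional_mul.
  by apply: fractional_mul; exact: fractional_iinv.
by rewrite imulACA !mul_iinv // imul1 //; exact: fractional_ringint.
Qed.

Lemma subset_idvd C I : integral_ideal C -> fractional I -> I `<=` C -> idvd C I.
Proof.
move=> [fC sC] fI IC; exists (I &* iinv C); last first.
  by rewrite imulCA mul_iinv // imul1.
split; first by apply: fractional_mul => //; exact: fractional_iinv.
rewrite -(mul_iinv fC); exact: imulS.
Qed.

Lemma idvd_subset C I : fractional C -> idvd C I -> I `<=` C.
Proof.
move=> fC [J [fJ sJ] ->]; rewrite -{2}(imul1 fC); exact: imulS.
Qed.

Lemma prime_imul P I J : prime_ideal P -> I `<=` ringint -> J `<=` ringint ->
  I &* J `<=` P -> I `<=` P \/ J `<=` P.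
Proof.
move=> [_ _ pP] sI sJ h; apply: contrapT => /not_orP [].
move=> /existsNP [x /not_implyP [Ix nx]] /existsNP [y /not_implyP [Jy ny]].
by have [] := pP x y (sI _ Ix) (sJ _ Jy) (h _ (imul_mem Ix Jy)).
Qed.

(** * Powers of a prime ideal and exponents *)

Lemma ipowS P n : ipow P n.+1 = P &* ipow P n. Proof. by []. Qed.

Lemma integral_ipow P n : integral_ideal P -> integral_ideal (ipow P n).
Proof.
move=> iP; elim: n => [|n IH]; first exact: integral_ringint.
by rewrite ipowS; exact: integral_ideal_mul.
Qed.

Lemma ipowD P n m : integral_ideal P -> ipow P (n + m) = ipow P n &* ipow P m.
Proof.
move=> iP; elim: n => [|n IH].
  by rewrite add0n mul1i //; case: (integral_ipow m iP).
by rewrite addSn !ipowS IH imulA.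
Qed.

Lemma idvd_trans I J C : idvd I J -> idvd J C -> idvd I C.
Proof.
move=> [A iA ->] [B iB ->]; exists (A &* B); first exact: integral_ideal_mul.
by rewrite imulA.
Qed.

Lemma idvd_ipow P n m : integral_ideal P -> (m <= n)%N -> idvd (ipow P m) (ipow P n).
Proof.
move=> iP mn; exists (ipow P (n - m)); first exact: integral_ipow.
by rewrite -ipowD // subnKC.
Qed.

Lemma principal_alg_inv (c : L) z : c != 0 -> principal c%:A z -> ringint (c^-1%:A * z).
Proof.
by move=> c0; rewrite algV => /(principalP _ _); apply; rewrite alg_eq0.
Qed.

(** With I * Ibar = (i) and P * Pbar = (c), divisibility of I by all powers of P gives divisibility
    of i by all powers of c. Then c is a unit and P contains 1. *)
Lemma ipow_not_dvd P I : prime_ideal P -> integral_ideal I ->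
  exists n, ~ idvd (ipow P n) I.
Proof.
move=> pP [fI sI]; have [iP _ _] := pP; have [fP sP] := iP.
have [i [i0 _ Ei]] := ideal_mul_bar fI.
have [c [c0 _ Ec]] := ideal_mul_bar fP.
apply: contrapT => /forallNP h.
have hc : ringint c.
  apply/(ringint_alg K); have : (P &* (bar @` P)) c%:A by rewrite Ec; exact: principal_id.
  move: (c%:A); apply: imul_subf; first exact: fractional_ringint.
  by move=> x _ /sP hx [y /sP hy <-]; apply: ringintM => //; exact/ringint_bar.
have cV : ringint c^-1.
  apply: (infinite_divisor pid i0 c0 hc) => n.
  have /contrapT [C [fC sC] EC] := h n.
  have Epow m : ipow P m &* (bar @` ipow P m) = principal (c ^+ m)%:A.
    elim: m => [|m IH].
      by rewrite expr0 alg1 principal1 bar_ringint imul1 //; exact: fractional_ringint.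
    by rewrite ipowS image_barM imulACA Ec IH principalM -algM exprS.
  have : principal (i%:A : K) `<=` principal ((c ^+ n)%:A : K).
    rewrite -Ei EC image_barM imulACA Epow.
    have cn0 : (c ^+ n)%:A != 0 :> K by rewrite alg_eq0 expf_neq0.
    rewrite -{2}(imul1 (fracP cn0)); apply: imulS => //.
    apply: imul_subf; first exact: fractional_ringint.
    by move=> x _ /sC hx [y /sC hy <-]; apply: ringintM => //; exact/ringint_bar.
  move=> /(_ _ (principal_id _)) /(principal_alg_inv (expf_neq0 n c0)).
  by rewrite -algM => /ringint_alg.
apply: (prime_proper pP).
have : principal c%:A (1 : K).
  apply/principalP; first by rewrite alg_eq0.
  by rewrite mulr1 -algV; exact/ringint_alg.
rewrite -Ec; move: (1 : K); apply: imul_subf => // x _ Px [y /sP hy <-].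
by rewrite mulrC; apply: fracM => //; exact/ringint_bar.
Qed.

Lemma ival_unique P I n : integral_ideal P ->
  idvd (ipow P n) I -> ~ idvd (ipow P n.+1) I -> ival P I = n.
Proof.
move=> iP h1 h2; rewrite /ival; case: xgetP => [m _ [h3 h4]|/(_ n)]; last by case.
have [lt|lt|//] := ltngtP m n; exfalso.
- by apply: h4; apply: idvd_trans h1; exact: idvd_ipow.
- by apply: h2; apply: idvd_trans h3; exact: idvd_ipow.
Qed.

Lemma ival_spec P I : prime_ideal P -> integral_ideal I ->
  idvd (ipow P (ival P I)) I /\ ~ idvd (ipow P (ival P I).+1) I.
Proof.
move=> pP iI; have [iP _ _] := pP.
have ex : exists n, `[< ~ idvd (ipow P n) I >].
  by have [n hn] := ipow_not_dvd pP iI; exists n; apply/asboolP.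
case: (ex_minnP ex) => -[|n] /asboolP hn hmin.
  case: hn; exists I => //.
  by rewrite mul1i //; case: iI.
have h1 : idvd (ipow P n) I.
  by apply: contrapT => /asboolP /hmin; rewrite ltnn.
by rewrite (ival_unique iP h1 hn).
Qed.

(** The cofactors C and D of the highest powers of P are not contained in P, hence neither is their
    product. *)
Lemma ivalM P I J : prime_ideal P -> integral_ideal I -> integral_ideal J ->
  ival P (I &* J) = (ival P I + ival P J)%N.
Proof.
move=> pP iI iJ; have [iP _ _] := pP; have [fP sP] := iP.
have [[C iC EC] nC] := ival_spec pP iI; have [[D iD ED] nD] := ival_spec pP iJ.
set n := ival P I in EC nC *; set m := ival P J in ED nD *.
have EIJ : I &* J = ipow P (n + m) &* (C &* D).
  by rewrite ipowD // {1}EC {1}ED imulACA.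
have fpow k : fractional (ipow P k) by case: (integral_ipow k iP).
have up k X Y : integral_ideal Y -> X = ipow P k &* Y -> Y `<=` P -> idvd (ipow P k.+1) X.
  move=> iY -> /(subset_idvd iP (iY.1)) [Z iZ ->]; exists Z => //.
  by rewrite ipowS imulA (imulC P).
apply: ival_unique => //.
  by exists (C &* D) => //; exact: integral_ideal_mul.
move=> [E [fE sE] EE].
have fCD : fractional (C &* D) by apply: fractional_mul; [case: iC|case: iD].
have ECD : C &* D = P &* E.
  apply: (@imul_cancel _ _ (ipow P (n + m))) => //; first exact: fractional_mul.
  by rewrite imulC -EIJ EE ipowS imulC imulA (imulC E).
have [] := @prime_imul P C D pP (iC.2) (iD.2).
- by rewrite ECD -{2}(imul1 fP); exact: imulS.
- by move=> /(up n I C iC EC).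
- by move=> /(up m J D iD ED).
Qed.

(** * Norms in a totally imaginary extension *)

Variables (t r : K) (a d : L).
Hypothesis rE : r = 2 * t + a%:A.
Hypothesis r_sqr : r ^+ 2 = d%:A.
Hypothesis bar_r : bar r = - r.
Hypothesis r0 : r != 0.
Hypothesis K_dec : forall z, exists u v : L, z = u%:A + v%:A * r.
Hypothesis K_inj : forall u v u' v' : L,
  u%:A + v%:A * r = u'%:A + v'%:A * r -> u = u' /\ v = v'.
Hypothesis hL : totally_real L.
Hypothesis d_neg : tot_neg d.
Hypothesis int_t : ringint t.
Hypothesis int_a : ringint a.
Hypothesis int_d : ringint d.
Hypothesis int_dec : forall z, ringint z ->
  exists u v : L, [/\ ringint u, ringint v & z = u%:A + v%:A * t].

Lemma d_neq0 : d != 0.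
Proof. by rewrite -(alg_eq0 K) -r_sqr expf_neq0. Qed.

Lemma int_r : ringint r.
Proof.
rewrite rE; apply: ringintD; last exact/ringint_alg.
by apply: ringintM => //; exact: ringint_nat.
Qed.

Lemma relN_dec (u v : L) : relN (u%:A + v%:A * r) = u ^+ 2 - v ^+ 2 * d.
Proof.
apply: (@alg_inj _ K); rewrite relNE rmorphD rmorphM /= !barA bar_r.
by rewrite !algE -r_sqr; ring.
Qed.

Lemma relN_ge0 (f : {rmorphism L -> algC}) z : 0 <= f (relN z).
Proof.
have [u [v ->]] := K_dec z; rewrite relN_dec rmorphB rmorphXn rmorphM rmorphXn subr_ge0.
apply: (@le_trans _ _ 0); last by rewrite real_exprn_even_ge0 ?hL.
by rewrite mulr_ge0_le0 ?real_exprn_even_ge0 ?hL // ltW // d_neg.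
Qed.

(** From r = 2 t + a and bar r = - r follows bar t = t - r: conjugation is the identity modulo r. *)
Lemma int_sub_bar z : ringint z -> exists2 v : L, ringint v & z - bar z = v%:A * r.
Proof.
move=> /int_dec [u [v [hu hv ->]]]; exists v => //.
have bar_t : 2 * bar t = - r - a%:A.
  by rewrite -bar_r rE rmorphD rmorphM /= barA rmorph_nat addrK.
have two0 : 2 != 0 :> K by rewrite -(alg_nat K 2) alg_eq0 -(alg_nat L 2) alg_eq0.
apply: (mulfI two0); rewrite rmorphD rmorphM /= !barA.
have -> : 2 * (u%:A + v%:A * t - (u%:A + v%:A * bar t)) = v%:A * (2 * t - 2 * bar t) by ring.
by rewrite bar_t rE; ring.
Qed.

Lemma int_double z : ringint z ->
  exists u v : L, [/\ ringint u, ringint v & 2 * z = u%:A + v%:A * r].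
Proof.
move=> /int_dec [u [v [hu hv ->]]]; exists (2 * u - v * a), v; split=> //.
  by apply: ringintB; apply: ringintM => //; exact: ringint_nat.
by rewrite rE !algE; ring.
Qed.

Lemma finite_bounded_sqr (c : L) :
  finite_set [set y : L | ringint y /\ forall f : {rmorphism L -> algC}, f y ^+ 2 <= f c].
Proof.
have [n [x [f [f_inj span]]]] := separating_embeddings L.
pose b i := (Num.bound (f i c)).+1.
apply: sub_finite_set (finite_integral_bounded f_inj span b) => y [hy hc].
split=> // i; have yR : f i y \is Num.real by exact: hL.
have c0 : 0 <= f i c by apply: le_trans (hc (f i)); rewrite real_exprn_even_ge0.
have cb : f i c < (Num.bound (f i c))%:R by exact: archi_boundP.
rewrite -(@ler_pXn2r _ 2) ?nnegrE ?normr_ge0 ?ler0n // real_normK //.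
apply: (le_trans (hc (f i))); apply: (le_trans (ltW cb)).
by rewrite /b -natrX ler_nat; nia.
Qed.

(** 4 N(z) = u^2 - d v^2 is a sum of two totally nonnegative terms. Hence u^2 <= 4 c and (d v)^2 <=
    - d * 4 c; the second parameter below is - d v. *)
Lemma finite_relN (c : L) : finite_set [set z : K | ringint z /\ relN z = c].
Proof.
have two0 : 2 != 0 :> K by rewrite -(alg_nat K 2) alg_eq0 -(alg_nat L 2) alg_eq0.
have fu := finite_bounded_sqr (4 * c).
have fv := finite_bounded_sqr (- d * (4 * c)).
apply: (@sub_finite_set _ _ [set ((u%:A : K) + (v / (- d))%:A * r) / 2 |
  u in [set y : L | ringint y /\ forall f : {rmorphism L -> algC}, f y ^+ 2 <= f (4 * c)] &
  v in [set y : L | ringint y /\ forall f : {rmorphism L -> algC}, f y ^+ 2 <= f (- d * (4 * c))]]);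
  last exact: finite_image2.
move=> z [/int_double [u [v [hu hv e]]] Nz].
have ec : 4 * c = u ^+ 2 - v ^+ 2 * d.
  have N2 : relN (2 : K) = 4 by rewrite -(alg_nat K 2) relN_scalar //; ring.
  by rewrite -relN_dec -e relNM Nz N2.
exists u; first split=> // f.
  rewrite ec rmorphB rmorphXn rmorphM rmorphXn lerDl oppr_ge0 mulr_ge0_le0 //.
    by rewrite real_exprn_even_ge0 // hL.
  exact/ltW/d_neg.
exists (- d * v); first split.
- by apply: ringintM => //; exact: ringintN.
- move=> f; rewrite ec -subr_ge0 -rmorphXn -rmorphB.
  have -> : - d * (u ^+ 2 - v ^+ 2 * d) - (- d * v) ^+ 2 = - d * u ^+ 2 by ring.
  rewrite rmorphM rmorphN rmorphXn mulr_ge0 ?real_exprn_even_ge0 ?hL //.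
  by rewrite oppr_ge0 ltW // d_neg.
rewrite mulrAC mulfV ?oppr_eq0 ?d_neq0 // mul1r -e mulrC mulKf //.
Qed.

(** N(z)^k = 1 with N(z) nonnegative at a real place leaves only N(z) = 1. *)
Lemma unit_norm1 (z : K) k : (0 < k)%N -> z ^+ k = 1 -> ringint z /\ relN z = 1.
Proof.
move=> k0 zk; split.
  exists ('X^k - 1); first by rewrite monicXnsubC.
  by rewrite rmorphB /= map_polyXn rmorph1 /root !hornerE zk subrr.
have Nk : relN z ^+ k = 1.
  have relNX j : relN (z ^+ j) = relN z ^+ j.
    elim: j => [|j IH]; first by rewrite !expr0 -(alg1 K) relN_scalar // expr1n.
    by rewrite !exprS relNM IH.
  by rewrite -relNX zk -(alg1 K) relN_scalar // expr1n.
have [n [x [f _]]] := separating_embeddings L.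
apply: (fmorph_inj (f ord0)); rewrite rmorph1.
have := congr1 (f ord0) Nk; rewrite rmorphXn rmorph1 => /eqP.
by rewrite pexpr_eq1 ?relN_ge0 // => /eqP.
Qed.

Lemma finite_roots_of_unity : finite_set (@roots_of_unity K).
Proof.
apply: sub_finite_set (finite_relN 1) => z [k k0 zk].
exact: unit_norm1 zk.
Qed.

(* The powers of z lie in a finite set. *)
Lemma norm1_root_of_unity z : ringint z -> relN z = 1 -> roots_of_unity z.
Proof.
move=> hz Nz; have z0 : z != 0 by rewrite -relN_eq0 Nz oner_neq0.
have /finite_seqP [s Es] := finite_relN 1.
have ins k : z ^+ k \in s.
  suff : [set` s] (z ^+ k) by [].
  rewrite -Es; elim: k => [|k [IH1 IH2]].
    by split; [exact: ringint1|rewrite expr0 -(alg1 K) relN_scalar // expr1n].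
  by rewrite exprS; split; [exact: ringintM|rewrite relNM Nz IH2 mulr1].
have : ~ injective (fun i : 'I_(size s).+1 => z ^+ i).
  move=> inj; have : (size [seq z ^+ i | i : 'I_(size s).+1] <= size s)%N.
    apply: uniq_leq_size; first by rewrite map_inj_uniq ?enum_uniq.
    by move=> y /mapP [i _ ->].
  by rewrite size_map -cardE card_ord ltnn.
move=> /injectiveP/injectivePn [i [j ij e]].
wlog lt : i j ij e / (i < j)%N.
  move=> W; have [lt|lt|/val_inj eij] := ltngtP i j; first exact: (W i j).
    by apply: (W j i) => //; rewrite eq_sym.
  by rewrite eij eqxx in ij.
exists (j - i)%N; first by rewrite subn_gt0.
apply: (mulIf (expf_neq0 i z0)).
by rewrite -exprD subnK 1?ltnW // mul1r.
Qed.

(** * Ramified primes *)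

Variables (tau : nat) (q : 'I_tau -> set L) (qt : 'I_tau -> set K).
Hypothesis q_inj : injective q.
Hypothesis qP : forall P : set L,
  (prime_ideal P /\ idvd P (principal d)) <-> exists i, q i = P.
Hypothesis qtP : forall i, prime_ideal (qt i) /\ iext K (q i) = qt i &* qt i.
Hypothesis cop_d2 : icoprime (principal d) (principal (2 : L)).

Let two0 : 2 != 0 :> L.
Proof. by rewrite -(alg_nat L 2) alg_eq0. Qed.

Let two0K : 2 != 0 :> K.
Proof. by rewrite -(alg_nat K 2) alg_eq0. Qed.

Lemma q_prime i : prime_ideal (q i).
Proof. by have [] := (qP (q i)).2 (ex_intro _ i erefl). Qed.

Lemma q_frac i : fractional (q i).
Proof. by have [[]] := q_prime i. Qed.

Lemma q_int i (x : L) : q i x -> ringint x.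
Proof. by have [[_ s] _ _] := q_prime i; exact: s. Qed.

Lemma q_d i : q i d.
Proof.
have [_ [C [_ sC] E]] := (qP (q i)).2 (ex_intro _ i erefl).
have : principal d d by exact: principal_id.
rewrite E; move: (d); apply: imul_subf; first exact: q_frac.
by move=> x y qx /sC hy; rewrite mulrC; apply: fracM => //; exact: q_frac.
Qed.

Lemma prime_over_d (P : set L) : prime_ideal P -> P d -> exists i, q i = P.
Proof.
move=> pP Pd; apply/qP; split=> //.
have [pi pi0 [E hpi _]] := prime_generator pid pP.
have hc : ringint (pi^-1 * d) by apply/principalP => //; rewrite -E.
exists (principal (pi^-1 * d)); last by rewrite E principalM mulVKf.
apply: integral_principal => //; first exact: fieldExt_denominator.
by rewrite mulf_neq0 ?invr_eq0 ?d_neq0.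
Qed.

Lemma prime_not2 (P : set L) : prime_ideal P -> P d -> ~ P (2 : L).
Proof.
move=> pP Pd P2; have [[fP _] _ _] := pP.
have [u [v [hu hv e]]] := cop_d2.
apply: (prime_proper pP); rewrite -e.
by apply: fracD => //; [apply: (principal_mem fP Pd)|apply: (principal_mem fP P2)].
Qed.

(* r / pi = (2 t + a) / pi, and 2 / pi is not integral. *)
Lemma r_not_div (P : set L) (pi : L) : prime_ideal P -> P d -> P = principal pi ->
  pi != 0 -> ~ ringint (pi^-1%:A * r).
Proof.
move=> pP Pd E pi0 /int_dec [u [v [hu hv e]]].
have : (0 : L)%:A + pi^-1%:A * r = (u - v * a / 2)%:A + (v / 2)%:A * r.
  rewrite alg0 add0r e [in RHS]rE.
  have h2 : (2 : L)%:A = 2 :> K := alg_nat K 2.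
  by rewrite algB !algM algV h2; field.
move/K_inj => [_ e2]; apply: (prime_not2 pP Pd); rewrite E.
exists v => //; rewrite -[v](mulfVK two0) -e2 mulrA mulfV // mul1r.
by [].
Qed.

(** Otherwise r / pi would be a root of X^2 - d / pi^2, hence integral. *)
Lemma squarefree_d (P : set L) (pi : L) : prime_ideal P -> P = principal pi ->
  ~ ringint (d / pi ^+ 2).
Proof.
move=> pP E h; have [[fP sP] _ _] := pP.
have Ppi : P pi by rewrite E; exact: principal_id.
have pi0 : pi != 0.
  apply/eqP => p0; have [[[_ _ [z Pz z0] _] _] _ _] := pP.
  by move: Pz; rewrite E p0 => -[y _]; rewrite mul0r => /esym/eqP; apply/negP.
have Pd : P d.
  have -> : d = (d / pi ^+ 2 * pi) * pi by field.
  by apply: fracM => //; exact: ringintM h (sP _ Ppi).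
apply: (r_not_div pP Pd E pi0).
apply: (@ringint_quad _ _ _ 0 (- (d / pi ^+ 2))); first exact: ringint0.
  exact: ringintN.
have piA0 : pi%:A != 0 :> K by rewrite alg_eq0.
by rewrite exprMn r_sqr !algE; field.
Qed.

Lemma iext_principal (pi : L) : iext K (principal pi) = principal (pi%:A : K).
Proof.
apply/seteqP; split=> [_ [n [u [v [h ->]]]]|_ [z hz <-]].
  exists (\sum_(i < n) (if pi == 0 then 0 else (pi^-1 * u i)%:A) * v i).
    apply: ringint_sum => i _; have [[y hy <-] hv] := h i.
    apply: ringintM => //; case: eqP => [_|/eqP pi0]; first exact: ringint0.
    by rewrite mulKf //; exact/ringint_alg.
  rewrite mulr_sumr; apply: eq_bigr => i _; have [[y hy <-] hv] := h i.
  case: eqP => [->|/eqP pi0]; first by rewrite !mul0r !alg0 !mul0r.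
  by rewrite mulKf // mulrA algM.
exists 1%N, (fun=> pi), (fun=> z); rewrite big_ord1; split=> // _.
by split=> //; exact: principal_id.
Qed.

Lemma qt_frac i : fractional (qt i).
Proof. by have [[[]]] := qtP i. Qed.

Lemma qt_int i z : qt i z -> ringint z.
Proof. by have [[[_ s] _ _] _] := qtP i; exact: s. Qed.

Lemma qt_prod i y z : ringint y -> ringint z -> qt i (y * z) -> qt i y \/ qt i z.
Proof. by have [[_ _ h] _] := qtP i; exact: h. Qed.

Lemma qt_sqr i z : ringint z -> qt i (z ^+ 2) -> qt i z.
Proof. by rewrite expr2 => hz /(qt_prod hz hz) []. Qed.

Lemma q_generator i : exists2 pi, pi != 0 & [/\ q i = principal pi,
  ringint pi & qt i &* qt i = principal (pi%:A : K)].
Proof.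
have [pi pi0 [E hpi _]] := prime_generator pid (q_prime i).
by exists pi => //; split=> //; have [_ <-] := qtP i; rewrite E iext_principal.
Qed.

Lemma q_qt i (x : L) : q i x -> qt i x%:A.
Proof.
have [pi pi0 [-> hpi E]] := q_generator i => -[y hy <-].
have : principal (pi%:A : K) (pi * y)%:A.
  by exists y%:A; [exact/ringint_alg|rewrite algM].
rewrite -E; move: (_%:A); apply: imul_subf; first exact: qt_frac.
by move=> u v hu hv; apply: fracM => //; [exact: qt_frac|exact: qt_int hu].
Qed.

(** x^2 lies in the square of [qt i], which is generated by the generator pi of [q i]; so pi divides
    x^2 in L. *)
Lemma qt_q i (x : L) : ringint x -> qt i x%:A -> q i x.
Proof.
move=> hx qx; have [pi pi0 [Eq hpi E]] := q_generator i.
have : (qt i &* qt i) (x%:A * x%:A) by exact: imul_mem.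
rewrite E -algM => /(principal_alg_inv pi0); rewrite -algM => /ringint_alg h.
have qxx : q i (x * x) by rewrite Eq; apply/principalP.
by have [_ _ pq] := q_prime i; case: (pq x x).
Qed.

Lemma qt_r i : qt i r.
Proof.
by apply: qt_sqr; [exact: int_r|rewrite r_sqr; apply: q_qt; exact: q_d].
Qed.

Lemma qt_sub_bar i z : ringint z -> qt i (z - bar z).
Proof.
move=> /int_sub_bar [v hv ->]; apply: fracM; [exact: qt_frac| |exact: qt_r].
exact/ringint_alg.
Qed.

Lemma qt_bar i : bar @` qt i = qt i.
Proof.
have h z : qt i z -> qt i (bar z).
  move=> qz; have := qt_sub_bar i (qt_int qz).
  move=> /(fracB (qt_frac i) qz); rewrite opprB addrC subrK.
  by [].
apply/seteqP; split=> [_ [z qz <-]|z qz]; first exact: h.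
by exists (bar z); [exact: h|exact: barK].
Qed.

Lemma not_qt_two i : ~ qt i 2.
Proof.
rewrite -(alg_nat K 2) => /(qt_q (ringint_nat _ 2)).
by apply: prime_not2; [exact: q_prime|exact: q_d].
Qed.

(** Write 2 z = x + v r. Then x lies in every q i, and d squarefree gives d | x, so 2 (z / r) is
    integral. So is d (z / r) = r z, and 2 and d are coprime. *)
Lemma all_qt_div_r z : ringint z -> (forall i, qt i z) -> ringint (z / r).
Proof.
move=> hz qz; have [x [v [hx hv e]]] := int_double hz.
have hxd : ringint (x / d).
  apply: (squarefree_dvd pid d_neq0 int_d hx).
    move=> P pP Pd; have [i <-] := prime_over_d pP Pd.
    apply: qt_q => //; have -> : x%:A = 2 * z - v%:A * r by rewrite e addrK.
    apply: fracB; first exact: qt_frac.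
      by apply: fracM => //; [exact: qt_frac|exact: ringint_nat].
    by apply: fracM; [exact: qt_frac|exact/ringint_alg|exact: qt_r].
  exact: squarefree_d.
have h2 : ringint (2 * (z / r)).
  have dA0 : d%:A != 0 :> K by rewrite alg_eq0 d_neq0.
  rewrite mulrA e mulrDl mulfK //; apply: ringintD; last exact/ringint_alg.
  have -> : x%:A / r = (x / d)%:A * r.
    by rewrite algM algV -r_sqr; field.
  by apply: ringintM; [exact/ringint_alg|exact: int_r].
have hd : ringint (d%:A * (z / r)).
  by rewrite -r_sqr expr2 mulrCA -mulrA mulfV // mulr1 mulrC; apply: ringintM => //; exact: int_r.
have [u0 [v0 [[u hu eu] [w hw ew] euw]]] := cop_d2.
have e1 : u%:A * d%:A + w%:A * 2 = 1 :> K.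
  by rewrite -(alg_nat K 2) -!algM (mulrC u) eu (mulrC w) ew -algD euw alg1.
have -> : z / r = u%:A * (d%:A * (z / r)) + w%:A * (2 * (z / r)).
  by rewrite -[LHS]mul1r -{1}e1; ring.
by apply: ringintD; apply: ringintM => //; exact/ringint_alg.
Qed.

Lemma div_r_qt i z : ringint (z / r) -> qt i z.
Proof.
by move=> h; rewrite -(mulfVK r0 z); apply: fracM => //; [exact: qt_frac|exact: qt_r].
Qed.

Lemma r_not_qt_sqr i : ~ (qt i &* qt i) r.
Proof.
have [pi pi0 [Eq hpi E]] := q_generator i; rewrite E => /(principal_alg_inv pi0).
exact: (r_not_div (q_prime i) (q_d i) Eq pi0).
Qed.

(** * Parametrization of S *)

Variables (p : nat) (alpha0 : L) (A : set K) (s n d' ell : L).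
Hypothesis alpha0_neg : tot_neg alpha0.
Hypothesis alpha0_int : ringint alpha0.
Hypothesis p_gt0 : (0 < p)%N.
Hypothesis q_not_alpha0 : forall i, ~ q i alpha0.
Hypothesis q_not_p : forall i, ~ q i p%:R.
Hypothesis int_A : integral_ideal A.
Hypothesis A_conj : principal (alpha0%:A : K) = A &* (bar @` A).
Hypothesis diff_r : rel_different K = principal r.
Hypothesis int_s : ringint s.
Hypothesis int_d' : ringint d'.
Hypothesis d'E : d' = s ^+ 2 - 4 * n.
Hypothesis not_sqr : forall x : L, x ^+ 2 != d * d'.
Hypothesis int_ell : ringint ell.
Hypothesis ell0 : ell != 0.

Let some_embedding : exists f : {rmorphism L -> algC}, True.
Proof. by have [k [x [f _]]] := separating_embeddings L; exists (f ord0). Qed.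

Let alpha00 : alpha0 != 0.
Proof. by have [f _] := some_embedding; rewrite -(fmorph_eq0 f) lt_eqF ?alpha0_neg. Qed.

Let p0 : p%:R != 0 :> L.
Proof. by rewrite -(alg_nat L p) alg_eq0 pnatr_eq0 -lt0n. Qed.

Let J fb := iinv A &* twist bar fb.

Lemma image_bar_iinv I : fractional I -> bar @` (iinv I) = iinv (bar @` I).
Proof.
move=> fI; apply/esym; apply: inv_unique; try exact: fractional_bar.
  exact/fractional_bar/fractional_iinv.
by rewrite -image_barM mul_iinv // bar_ringint.
Qed.

Lemma twist_frac fb : integral_ideal fb -> fractional (twist bar fb).
Proof.
by move=> [ffb _]; apply: fractional_mul; [exact: fractional_iinv|exact: fractional_bar].
Qed.

Lemma J_frac fb : integral_ideal fb -> fractional (J fb).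
Proof.
move=> ifb; apply: fractional_mul; last exact: twist_frac.
by apply: fractional_iinv; case: int_A.
Qed.

Lemma image_barK I : bar @` (bar @` I) = I.
Proof.
apply/seteqP; split=> [_ [_ [z Iz <-] <-]|z Iz]; first by rewrite barK.
by exists (bar z); [exists z|exact: barK].
Qed.

Lemma twist_mul_bar fb : integral_ideal fb ->
  twist bar fb &* (bar @` twist bar fb) = ringint.
Proof.
move=> [ffb _]; have fB := fractional_bar ffb.
rewrite /twist image_barM image_barK image_bar_iinv //.
by rewrite (imulC (iinv (bar @` _))) imulACA (imulC (iinv _)) !mul_iinv // imul1 //; exact: fractional_ringint.
Qed.

(** The twist cancels against its conjugate, and A against Abar leaves alpha0: this is why alpha0
    N(g) is integral for g in [J fb]. *)
Lemma J_mul_bar fb : integral_ideal fb ->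
  J fb &* (bar @` J fb) = principal (alpha0^-1%:A : K).
Proof.
move=> ifb; have [fA _] := int_A.
rewrite /J image_barM imulACA twist_mul_bar // imul1; last first.
  by apply: fractional_mul; [exact: fractional_iinv|exact/fractional_bar/fractional_iinv].
rewrite image_bar_iinv // -iinvM //; last exact: fractional_bar.
by rewrite -A_conj inv_principal ?alg_eq0 // algV.
Qed.

Lemma J_norm fb g : integral_ideal fb -> J fb g -> ringint (alpha0 * relN g).
Proof.
move=> ifb Jg; have : (J fb &* (bar @` J fb)) (g * bar g) by apply: imul_mem => //; exists g.
rewrite J_mul_bar // => /principal_alg_inv; rewrite invr_eq0 invrK => /(_ alpha00).
by rewrite -relNE -algM => /ringint_alg.
Qed.

Lemma finite_J_norm fb (c : L) : integral_ideal fb ->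
  finite_set [set g | J fb g /\ relN g = c].
Proof.
move=> ifb; have [_ _ _ [rho [hrho rho0 hJ]]] := J_frac ifb.
apply: (@sub_finite_set _ _ [set rho^-1 * z | z in [set z : K | ringint z /\ relN z = relN rho * c]]).
  move=> g [Jg Ng]; exists (rho * g); last by rewrite mulKf.
  by split; [exact: hJ|rewrite relNM Ng].
exact/finite_image/finite_relN.
Qed.

Let u (x : L) : K := (x%:A + s%:A * r) / 2.

(** With r = 2 t + a, [u x] becomes (x + a s) / 2 + s t: the origin of the congruence modulo 2 in
    (C). *)
Lemma u_int (x : L) : ringint (u x) <-> ringint x /\ principal (2 : L) (x - a * s).
Proof.
have h2 : (2 : L)%:A = 2 :> K := alg_nat K 2.
split=> [/int_dec [y [v [hy hv e]]]|[hx [y hy e]]].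
  have : x%:A + s%:A * r = (2 * y - v * a)%:A + v%:A * r.
    by rewrite -[LHS](mulfVK two0K) -/(u x) e [in RHS]rE algB !algM h2; ring.
  move=> /K_inj [-> ->]; split.
    by apply: ringintB; apply: ringintM => //; exact: ringint_nat.
  by exists (y - v * a); [apply: ringintB => //; exact: ringintM|ring].
have -> : u x = (y + a * s)%:A + s%:A * t.
  have -> : x = 2 * y + a * s by rewrite e subrK.
  by rewrite /u rE !algD !algM h2; field.
apply: ringintD; first by apply/ringint_alg; apply: ringintD => //; exact: ringintM.
by apply: ringintM => //; exact/ringint_alg.
Qed.

Lemma u_trace (x : L) : u x + bar (u x) = x%:A /\ u x - bar (u x) = s%:A * r.
Proof.
have -> : bar (u x) = (x%:A - s%:A * r) / 2.
  by rewrite /u fmorph_div rmorphD rmorphM /= !barA bar_r rmorph_nat mulrN.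
by split; rewrite /u; field.
Qed.

Let Q (x : L) (g : K) : 'M[K]_2 := quat bar p alpha0 (u x / r) (ell%:A * g / r).

Lemma Q_inj (x y : L) g h : Q x g = Q y h -> x = y /\ g = h.
Proof.
have ellA0 : ell%:A != 0 :> K by rewrite alg_eq0.
move=> /matrixP e.
have := e ord0 ord0; rewrite !mxE /= => /(mulIf (invr_neq0 r0)).
rewrite /u => /(mulIf (invr_neq0 two0K))/addIr/alg_inj ->.
have := e ord0 (lift ord0 ord0); rewrite !mxE /= => /(mulIf (invr_neq0 r0)).
by move/(mulfI ellA0).
Qed.

Let normval (x : L) : L := (x ^+ 2 - d * d') / (4 * alpha0 * p%:R * ell ^+ 2).

Let four0 : 4 != 0 :> L.
Proof. by rewrite -(alg_nat L 4) alg_eq0. Qed.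

Lemma S1setP fb (x : L) g : S1set bar p alpha0 A d d' fb x ell g <->
  J fb g /\ relN g = normval x.
Proof.
split=> [[Jg e]|[Jg e]]; split=> //; last by rewrite -relNE e.
by apply: (@alg_inj _ K); rewrite relNE.
Qed.

Lemma normvalE (x : L) : 4 * alpha0 * p%:R * ell ^+ 2 * normval x = x ^+ 2 - d * d'.
Proof. by rewrite /normval mulrC mulfVK // !mulf_neq0 // expf_neq0. Qed.

(* The trace equation says u x - bar (u x) = s r, and the norm equation is
   then relN g = normval x. *)
Lemma quat_norm (x : L) g :
  (u x / r * bar (u x / r) - alpha0%:A * p%:R * (ell%:A * g / r * bar (ell%:A * g / r)) = n%:A)
  <-> relN g = normval x.
Proof.
(* The minus signs here and in [N2] come from N(r) = - d. *)
have N1 : u x / r * bar (u x / r) = (- (x ^+ 2 - s ^+ 2 * d) / (4 * d))%:A.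
  rewrite -relNE; congr (_ *: _).
  have -> : u x / r = (s / 2)%:A + (x / (2 * d))%:A * r.
    rewrite /u !algM !algV algM (alg_nat K 2) -r_sqr; field.
    by rewrite r0 two0K.
  by rewrite relN_dec; field; rewrite d_neq0 two0 four0.
have N2 : ell%:A * g / r * bar (ell%:A * g / r) = (- (ell ^+ 2 * relN g / d))%:A.
  rewrite -relNE; congr (_ *: _); rewrite !relNM relN_scalar //.
  have -> : relN r^-1 = - d^-1.
    have -> : r^-1 = (0 : L)%:A + (d^-1)%:A * r by rewrite alg0 add0r algV -r_sqr; field.
    by rewrite relN_dec; field; rewrite d_neq0.
  by ring.
rewrite N1 N2 -(alg_nat K p) -!algM -algB.
have d0 := d_neq0; split=> [/alg_inj e|->].
  have := normvalE x; rewrite d'E -e => e2.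
  apply: (mulfI (_ : 4 * alpha0 * p%:R * ell ^+ 2 != 0)).
    by rewrite !mulf_neq0 // expf_neq0.
  by rewrite e2; field; rewrite d0 four0.
congr (_ *: _).
have -> : alpha0 * p%:R * - (ell ^+ 2 * normval x / d) =
  - (4 * alpha0 * p%:R * ell ^+ 2 * normval x) / (4 * d) by field; rewrite d0 four0.
by rewrite normvalE d'E; field; rewrite d0 four0.
Qed.

Lemma beta_ideal fb : integral_ideal fb ->
  iinv (rel_different K) &* iinv A &* principal (ell%:A : K) &* twist bar fb =
  principal (ell%:A / r) &* J fb.
Proof.
move=> ifb; rewrite diff_r inv_principal // /J.
rewrite -!imulA (imulCA (iinv A)) !imulA principalM mulrC.
by [].
Qed.

Lemma SsetP fb lam M : integral_ideal fb ->
  Sset bar p alpha0 A s n fb lam ell M <->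
  exists (x : L) g, [/\ condC p a s d d' ell x, S1set bar p alpha0 A d d' fb x ell g,
    ringint ((u x - lam%:A * ell%:A * g) / r) & M = Q x g].
Proof.
move=> ifb; have ellA0 : ell%:A != 0 :> K by rewrite alg_eq0.
have er0 : ell%:A / r != 0 by rewrite mulf_neq0 ?invr_eq0.
have uniq_ab al be al' be' : quat bar p alpha0 al be = quat bar p alpha0 al' be' ->
    al = al' /\ be = be'.
  move=> /matrixP e; have := e ord0 ord0; have := e ord0 (lift ord0 ord0).
  by rewrite !mxE.
split.
  move=> [al [be [-> [al' [be' [/uniq_ab [<- <-] Dal Dbe hint]]] Tr Nm]]].
  move: Dal; rewrite diff_r inv_principal // => -[z hz Ez].
  move: Dbe; rewrite beta_ideal // => /(principal_mulP _ er0 (J_frac ifb)).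
  set g := _ * be => Jg.
  have Eb : be = ell%:A * g / r by rewrite /g; field; rewrite r0 ellA0.
  (* x is the trace of z = alpha r, and the trace equation fixes z - bar z = s r; together they
     determine z. *)
  have [x Ex] := traceE z.
  have Ea : al = z / r by rewrite -Ez mulrC.
  have Ezb : z - bar z = s%:A * r.
    rewrite -Tr Ea fmorph_div bar_r; field.
    by rewrite oppr_eq0 r0.
  have Eu : z = u x by rewrite /u Ex -Ezb; field.
  rewrite Eu in Ea hz.
  move: Nm; rewrite Ea Eb => /quat_norm Ng.
  have [hx hxs] := (u_int x).1 hz.
  have hC : condC p a s d d' ell x.
    split=> //.
      (* The third condition of (C) is the integrality of alpha0 N(g). *)
      have := J_norm ifb Jg; rewrite Ng /normval; congr ringint.
      by field; rewrite ell0 p0 alpha00 four0.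
    move=> f; rewrite lt_neqAle; apply/andP; split.
      by rewrite fmorph_eq0 subr_eq0; exact: not_sqr.
    rewrite -normvalE -Ng rmorphM mulr_le0_ge0 ?relN_ge0 //.
    have -> : 4 * alpha0 * p%:R * ell ^+ 2 = alpha0 * ((4 * p)%N%:R * ell ^+ 2).
      by rewrite natrM; ring.
    rewrite rmorphM mulr_le0_ge0 //; first exact/ltW/alpha0_neg.
    by rewrite rmorphM rmorph_nat rmorphXn mulr_ge0 ?ler0n ?real_exprn_even_ge0 ?hL.
  exists x, g; split=> //; first exact/S1setP.
    by move: hint; rewrite Ea Eb mulrBl !mulrA.
move=> [x [g [[hx hxs hxd hneg] /S1setP [Jg Ng] hint ->]]].
have hu : ringint (u x) by exact/u_int.
exists (u x / r), (ell%:A * g / r); split=> //.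
- exists (u x / r), (ell%:A * g / r); split=> //.
  + by rewrite diff_r inv_principal //; exists (u x) => //; rewrite mulrC.
  + rewrite beta_ideal //; apply/principal_mulP => //; first exact: J_frac.
    by rewrite (_ : _ * _ = g) //; field; rewrite r0 ellA0.
  + by move: hint; rewrite mulrBl !mulrA.
- rewrite fmorph_div bar_r invrN mulrN -mulrBl.
  by have [_ ->] := u_trace x; rewrite mulfK.
- exact/quat_norm.
Qed.

Lemma finite_condC : finite_set (condC p a s d d' ell).
Proof.
apply: sub_finite_set (finite_bounded_sqr (d * d')) => x [hx _ _ hneg].
by split=> // f; rewrite -subr_le0 -rmorphXn -rmorphB; exact/ltW/hneg.
Qed.

Lemma finite_S1 fb (x : L) : integral_ideal fb ->
  finite_set (S1set bar p alpha0 A d d' fb x ell).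
Proof.
move=> ifb; apply: sub_finite_set (finite_J_norm (normval x) ifb) => g.
by move/S1setP.
Qed.

Lemma normval_neq0 (x : L) : normval x != 0.
Proof.
by rewrite /normval mulf_neq0 ?subr_eq0 ?not_sqr // invr_eq0 !mulf_neq0 // expf_neq0.
Qed.

(** * Signs *)

Variables (lamq : 'I_tau -> L).
Hypothesis lamqP : forall i, ringint (lamq i) /\ q i (lamq i ^+ 2 - alpha0 * p%:R).

Let is_lam fb e l := is_lambda bar A q lamq fb e l.

Lemma lam_int fb e l g : is_lam fb e l -> J fb g -> ringint (l%:A * g).
Proof.
move=> [_ _ sub] Jg; apply: sub; rewrite -imulA; apply: imul_mem => //.
exact: principal_id.
Qed.

Lemma qt_notM i (x : L) z : ringint x -> ~ q i x -> ringint z -> qt i (x%:A * z) -> qt i z.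
Proof.
move=> hx nx hz; have hxA : ringint (x%:A : K) by exact/ringint_alg.
by move=> /(qt_prod hxA hz) [/(qt_q hx)|].
Qed.

Lemma qt_of_norm i z : ringint z -> qt i (z * bar z) -> qt i z.
Proof.
move=> hz h; apply: qt_sqr => //.
have -> : z ^+ 2 = z * bar z + z * (z - bar z) by ring.
by apply: fracD => //; [exact: qt_frac|apply: fracM => //; [exact: qt_frac|exact: qt_sub_bar]].
Qed.

(** alpha0 N(m g) = m * (m * alpha0 N(g)) lies in q i. As alpha0 does not, N(m g) lies in [qt i],
    where it is congruent to (m g)^2. *)
Lemma qt_mulJ i fb (m : L) g : integral_ideal fb -> J fb g -> q i m ->
  ringint (m%:A * g) -> qt i (m%:A * g).
Proof.
move=> ifb Jg qm hmg; apply: qt_of_norm => //.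
have hb : ringint (m%:A * g * bar (m%:A * g)) by apply: ringintM => //; exact/ringint_bar.
apply: (qt_notM alpha0_int (@q_not_alpha0 i) hb).
rewrite -relNE -algM; apply: q_qt.
have -> : alpha0 * relN (m%:A * g) = (m * (alpha0 * relN g)) * m.
  by rewrite relNM relN_scalar //; ring.
apply: fracM => //; [exact: q_frac|apply: ringintM].
  exact: q_int qm.
exact: J_norm Jg.
Qed.

(** Modulo q i both l and l' are [lamq i] up to sign, so a combination m of them lies in q i;
    [qt_mulJ] transfers this to m g although g itself may not be integral. *)
Lemma lam_congr i fb e e' l l' g : integral_ideal fb -> J fb g ->
  is_lam fb e l -> is_lam fb e' l' ->
  qt i (l%:A * g - (-1) ^+ (e i (+) e' i) * (l'%:A * g)).
Proof.
move=> ifb Jg hl hl'; pose m := l - (-1) ^+ (e i (+) e' i) * l'.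
have Em : l%:A * g - (-1) ^+ (e i (+) e' i) * (l'%:A * g) = m%:A * g.
  by rewrite /m !algE; ring.
rewrite Em; apply: (qt_mulJ ifb Jg).
  have [_ ql _] := hl; have [_ ql' _] := hl'.
  have -> : m = (l - (-1) ^+ e i * lamq i) - (-1) ^+ (e i (+) e' i) * (l' - (-1) ^+ e' i * lamq i).
    by rewrite /m signr_addb; case: (e i); case: (e' i); ring.
  apply: fracB; [exact: q_frac|exact: ql|].
  apply: fracM; [exact: q_frac| |exact: ql'].
  by apply: ringintX; apply: ringintN; exact: ringint1.
rewrite -Em; apply: ringintB; first exact: lam_int hl Jg.
apply: ringintM; last exact: lam_int hl' Jg.
by apply: ringintX; apply: ringintN; exact: ringint1.
Qed.

(** w will be built from a fixed reference lambda; a change of sign vector then only changes b. *)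
Let sign_test i (x : L) (w : K) (b : bool) := qt i (u x - (-1) ^+ b * w).

Lemma integral_pair fb e l (x : L) g : integral_ideal fb -> J fb g -> is_lam fb e l ->
  ringint x -> principal (2 : L) (x - a * s) ->
  ringint (u x - l%:A * ell%:A * g).
Proof.
move=> ifb Jg hl hx hxs; apply: ringintB; first exact/u_int.
rewrite mulrAC; apply: ringintM; first exact: lam_int hl Jg.
exact/ringint_alg.
Qed.

(** Divisibility by r splits over the [qt i], and modulo [qt i] replacing l by the reference l0
    costs only the sign in which e and e0 differ. *)
Lemma test_congr fb e l e0 l0 (x : L) g : integral_ideal fb -> J fb g ->
  is_lam fb e l -> is_lam fb e0 l0 -> ringint x -> principal (2 : L) (x - a * s) ->
  (ringint ((u x - l%:A * ell%:A * g) / r) <->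
   forall i, sign_test i x (l0%:A * ell%:A * g) (e i (+) e0 i)).
Proof.
move=> ifb Jg hl hl0 hx hxs.
have hd i : qt i (ell%:A * (l%:A * g - (-1) ^+ (e i (+) e0 i) * (l0%:A * g))).
  by apply: fracM; [exact: qt_frac|exact/ringint_alg|exact: lam_congr hl hl0].
have hint := integral_pair ifb Jg hl hx hxs.
split=> [/div_r_qt h i|h].
  have := fracD (qt_frac i) (h i) (hd i); congr (qt i _); ring.
apply: all_qt_div_r => // i.
have := fracB (qt_frac i) (h i) (hd i); congr (qt i _); ring.
Qed.

(** Only the signs of lambda matter: both tests reduce to the same congruences with m as reference.
    This allows lambdas chosen for different ideals to be compared. *)
Lemma S_congr fb e l l' : integral_ideal fb -> is_lam fb e l -> is_lam fb e l' ->
  Sset bar p alpha0 A s n fb l ell = Sset bar p alpha0 A s n fb l' ell.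
Proof.
move=> ifb hl hl'; have half m m' : is_lam fb e m -> is_lam fb e m' ->
    Sset bar p alpha0 A s n fb m ell `<=` Sset bar p alpha0 A s n fb m' ell.
  move=> hm hm' M /(SsetP _ _ ifb) [x [g [hC hS hint EM]]]; apply/SsetP => //.
  exists x, g; split=> //; have [hx hxs _ _] := hC; have [Jg _] := (S1setP _ _ _).1 hS.
  by apply/(test_congr ifb Jg hm' hm hx hxs)/(test_congr ifb Jg hm hm hx hxs).
by apply/seteqP; split; apply: half.
Qed.

(* (2 w) ^ 2 = x ^ 2 modulo qt i, so that 2 w is x or - x, and both when
   x lies in q i. *)
Lemma sign_test_count fb e l (x : L) g i : integral_ideal fb -> is_lam fb e l ->
  condC p a s d d' ell x -> S1set bar p alpha0 A d d' fb x ell g ->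
  (\sum_(b : bool) `[< sign_test i x (l%:A * ell%:A * g) b >] =
   if `[< q i x >] then 2 else 1)%N.
Proof.
move=> ifb hl [hx hxs _ _] /S1setP [Jg Ng].
set w := l%:A * ell%:A * g.
have hw : ringint w.
  by rewrite /w mulrAC; apply: ringintM; [exact: lam_int hl Jg|exact/ringint_alg].
have fq := qt_frac i; have h2 : ringint (2 : K) := ringint_nat _ 2.
have hxA : ringint (x%:A : K) by exact/ringint_alg.
have hu : ringint (u x) by exact/u_int.
have hsr : qt i (s%:A * r) by apply: fracM => //; [exact/ringint_alg|exact: qt_r].
have Eu : 2 * u x = x%:A + s%:A * r by rewrite /u; field.
(* 2 is invertible modulo [qt i] and s r vanishes there, so 2 u x may be replaced by x. *)
have testP b : sign_test i x w b <-> qt i (x%:A - (-1) ^+ b * (2 * w)).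
  have hb : ringint (u x - (-1) ^+ b * w).
    apply: ringintB => //; apply: ringintM => //; apply: ringintX; apply: ringintN.
    exact: ringint1.
  have E : 2 * (u x - (-1) ^+ b * w) = x%:A - (-1) ^+ b * (2 * w) + s%:A * r.
    by rewrite mulrBr Eu; ring.
  split=> [h|h].
    have := fracB fq (fracM fq h2 h) hsr; rewrite E addrK; exact.
  have := fracD fq h hsr; rewrite -E => /(qt_prod h2 hb) [/not_qt_two|//].
  by [].
(* Modulo [qt i], w * bar w is w^2; multiplication by alpha0 p, outside q i, makes the norm equation
   applicable, and l^2 is congruent to alpha0 p. *)
have hww : qt i ((2 * w) ^+ 2 - x%:A ^+ 2).
  have hapc : ringint (alpha0 * p%:R) by apply: ringintM => //; exact: ringint_nat.
  have hz : ringint (4 * (w * bar w) - x%:A ^+ 2).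
    apply: ringintB; last exact: ringintX.
    apply: ringintM; first exact: (ringint_nat _ 4).
    by apply: ringintM => //; exact/ringint_bar.
  have h1 : qt i (4 * (w * bar w) - x%:A ^+ 2).
    apply: (qt_notM hapc _ hz).
      have [_ _ pq] := q_prime i => /(pq _ _ alpha0_int (ringint_nat _ p)) [].
        exact: q_not_alpha0.
      exact: q_not_p.
    have -> : (alpha0 * p%:R)%:A * (4 * (w * bar w) - x%:A ^+ 2) =
        ((l ^+ 2 - alpha0 * p%:R) * x ^+ 2 - l ^+ 2 * d * d')%:A.
      have <- : (4 * relN w - x ^+ 2)%:A = 4 * (w * bar w) - x%:A ^+ 2.
        by rewrite algB algM (alg_nat K 4) relNE algX.
      rewrite -algM; congr (_ *: _).
      rewrite /w !relNM !relN_scalar //.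
      have -> : (l ^+ 2 - alpha0 * p%:R) * x ^+ 2 - l ^+ 2 * d * d' =
        l ^+ 2 * (x ^+ 2 - d * d') - alpha0 * p%:R * x ^+ 2 by ring.
      by rewrite -normvalE Ng; ring.
    apply: q_qt; have fqi := q_frac i; have [hl0 ql _] := hl.
    apply: fracB => //; last first.
      rewrite mulrAC; apply: fracM => //; last exact: q_d.
      by apply: ringintM => //; exact: ringintX.
    rewrite mulrC; apply: fracM => //; first exact: ringintX.
    have [hlq hlq2] := lamqP i.
    have -> : l ^+ 2 - alpha0 * p%:R = (l + (-1) ^+ e i * lamq i) * (l - (-1) ^+ e i * lamq i)
        + (lamq i ^+ 2 - alpha0 * p%:R) by case: (e i); ring.
    apply: fracD => //; apply: fracM => //.
    apply: ringintD => //; apply: ringintM => //; apply: ringintX; apply: ringintN.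
    exact: ringint1.
  have -> : (2 * w) ^+ 2 - x%:A ^+ 2 = (4 * (w * bar w) - x%:A ^+ 2) + 4 * w * (w - bar w) by ring.
  apply: fracD => //; apply: fracM => //; last exact: qt_sub_bar.
  by apply: ringintM => //; exact: (ringint_nat _ 4).
have some : sign_test i x w false \/ sign_test i x w true.
  have hp : ringint (x%:A - 2 * w) by apply: ringintB => //; exact: ringintM.
  have hm : ringint (x%:A + 2 * w) by apply: ringintD => //; exact: ringintM.
  have : qt i ((x%:A - 2 * w) * (x%:A + 2 * w)).
    by have := fracN fq hww; congr (qt i _); ring.
  move=> /(qt_prod hp hm) [h|h]; [left|right]; apply/testP; move: h; congr (qt i _); ring.
have both : (sign_test i x w false /\ sign_test i x w true) <-> q i x.
  split=> [[/testP h1 /testP h2']|qx].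
    apply: qt_q => //; have := fracD fq h1 h2'.
    have -> : x%:A - (-1) ^+ false * (2 * w) + (x%:A - (-1) ^+ true * (2 * w)) = 2 * x%:A by ring.
    by move=> /(qt_prod h2 hxA) [/not_qt_two|].
  have qx' := q_qt qx.
  have h2w : qt i (2 * w).
    apply: qt_sqr; first exact: ringintM.
    have := fracD fq hww (fracM fq hxA qx'); congr (qt i _); ring.
  split; apply/testP; apply: fracB => //; apply: fracM => //; apply: ringintX.
    by apply: ringintN; exact: ringint1.
  by apply: ringintN; exact: ringint1.
rewrite big_bool /=; have [qx|nqx] := pselect (q i x).
  by have [hf ht'] := both.2 qx; rewrite (asboolT hf) (asboolT ht') (asboolT qx).
rewrite (asboolF nqx); case: asboolP => ht'; case: asboolP => hf //.
  by case: nqx; apply/both.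
by case: some.
Qed.

(** The conditions at different i are independent, so the sum over sign vectors factors into local
    counts, 2 where q i contains x and 1 elsewhere. The reference signs are trivial, so that the
    exclusive or disappears. *)
Lemma card_signs fb e0 l0 (x : L) g : integral_ideal fb -> is_lam fb e0 l0 ->
  condC p a s d d' ell x -> S1set bar p alpha0 A d d' fb x ell g ->
  (forall i, e0 i = false) ->
  (\sum_(e : {ffun 'I_tau -> bool})
     `[< forall i, sign_test i x (l0%:A * ell%:A * g) (e i (+) e0 i) >] = delta q x)%N.
Proof.
move=> ifb hl hC hS e00; pose T i b := `[< sign_test i x (l0%:A * ell%:A * g) b >].
transitivity (\sum_(e : {ffun 'I_tau -> bool}) \prod_i (T i (e i) : nat))%N.
  apply: eq_bigr => e _.
  case: asboolP => h.
    rewrite big1 // => i _; have := h i; rewrite e00 addbF => hi.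
    by rewrite /T asboolT.
  have [i hi] : exists i, ~ sign_test i x (l0%:A * ell%:A * g) (e i).
    by apply/existsNP => h'; apply: h => i; rewrite e00 addbF.
  by rewrite (bigD1 i) //= /T asboolF.
rewrite -(bigA_distr_bigA (fun i b => (T i b : nat))).
rewrite (eq_bigr (fun i => if `[< q i x >] then 2 else 1)%N); last first.
  by move=> i _; exact: (sign_test_count i ifb hl hC hS).
rewrite -big_mkcond /= prod_nat_const /delta.
by [].
Qed.

Section SumOverSigns.
Variables (fb : set K) (lam : {ffun 'I_tau -> bool} -> L).
Hypothesis int_fb : integral_ideal fb.
Hypothesis lamP : forall e, is_lam fb e (lam e).
Let C := condC p a s d d' ell.
Let S1 (x : L) := S1set bar p alpha0 A d d' fb x ell.
Let S e := Sset bar p alpha0 A s n fb (lam e) ell.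
(** A list of candidates independent of the signs: each [S e] corresponds to the sublist that passes
    [test e], which permits exchanging the sums. *)
Let pairs : seq (L * K) := [seq (xx, g) | xx <- fset_set C, g <- fset_set (S1 xx)].

Let mem_pairs (x : L) g : (x, g) \in pairs <-> C x /\ S1 x g.
Proof.
have fC : finite_set C := finite_condC.
split=> [/allpairsPdep [x' [g' [hx hg [-> ->]]]]|[Cx Sg]].
  split; first exact/(mem_fset_set _ fC).
  by apply/(mem_fset_set _ (finite_S1 _ int_fb)).
apply/allpairsPdep; exists x, g; split=> //; first exact/(mem_fset_set _ fC).
by apply/(mem_fset_set _ (finite_S1 _ int_fb)).
Qed.

Let uniq_pairs : uniq pairs.
Proof.
by apply: allpairs_uniq_dep => [|x _|[x g] [y h] _ _ []]; rewrite ?fset_uniq // => -> ->.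
Qed.

Let test e (z : L * K) := `[< ringint ((u z.1 - (lam e)%:A * ell%:A * z.2) / r) >].

Let card_S e : finite_set (S e) /\ card_of (S e) = (\sum_(pr <- pairs) test e pr)%N.
Proof.
have [|M|fS ->] := @card_of_uniq _ (S e) [seq Q pr.1 pr.2 | pr <- pairs & test e pr].
- rewrite map_inj_in_uniq ?filter_uniq // => -[x g] [y h] _ _ /= /Q_inj [-> ->].
  by [].
- split=> [/mapP [[x g]]|/(SsetP _ _ int_fb) [x [g [hC hS hint ->]]]].
    rewrite mem_filter => /andP [/asboolP ht /mem_pairs [hC hS] ->].
    by apply/SsetP => //; exists x, g.
  apply/mapP; exists (x, g) => //; rewrite mem_filter; apply/andP; split.
    exact/asboolP.
  exact/mem_pairs.
- by split=> //; rewrite size_map size_filter -sum1_count big_mkcond.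
Qed.

Lemma finite_S e : finite_set (S e).
Proof. by case: (card_S e). Qed.

Lemma sum_card_S : (\sum_(e : {ffun 'I_tau -> bool}) card_of (S e) =
  \sum_(xx <- fset_set C) delta q xx * card_of (S1 xx))%N.
Proof.
rewrite (eq_bigr (fun e => \sum_(pr <- pairs) test e pr)%N); last first.
  by move=> e _; case: (card_S e).
rewrite exchange_big /= big_allpairs_dep /= big_seq [RHS]big_seq.
apply: eq_bigr => x hx; rewrite [RHS]mulnC.
rewrite /card_of -sum1_size big_distrl /= big_seq [RHS]big_seq; apply: eq_bigr => g hg.
rewrite mul1n; have [hC hS] : C x /\ S1 x g by apply/mem_pairs/allpairsPdep; exists x, g.
pose e0 : {ffun 'I_tau -> bool} := [ffun=> false].
rewrite -(card_signs (e0 := e0) int_fb (lamP e0) hC hS); last by move=> i; rewrite ffunE.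
apply: eq_bigr => e _; rewrite /test /=; congr (nat_of_bool _).
have [hx1 hxs _ _] := hC; have [Jg _] := (S1setP _ _ _).1 hS.
apply/asboolP/asboolP.
  by move/(test_congr int_fb Jg (lamP e) (lamP e0) hx1 hxs).
by move=> h; apply/(test_congr int_fb Jg (lamP e) (lamP e0) hx1 hxs).
Qed.

End SumOverSigns.

(** * From S1 to S2 *)

Hypothesis hcl : strict_class_number_one L.

Lemma principal_eqP (F : fieldType) (y z : F) : y != 0 -> z != 0 ->
  principal y = principal z <-> ringint (y^-1 * z) /\ ringint (z^-1 * y).
Proof.
move=> y0 z0; split=> [E|[h1 h2]].
  split; apply/principalP => //; first by rewrite E; exact: principal_id.
  by rewrite -E; exact: principal_id.
apply/seteqP; split=> _ [c hc <-]; apply/principalP => //; rewrite mulrA; exact: ringintM.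
Qed.

Lemma principal_alg_eq (b c : L) : b != 0 -> c != 0 ->
  principal (b%:A : K) = principal (c%:A : K) -> principal b = principal c.
Proof.
move=> b0 c0 /principal_eqP; rewrite !alg_eq0 => /(_ b0 c0).
rewrite -!algV -!algM => -[/ringint_alg h1 /ringint_alg h2].
exact/principal_eqP.
Qed.

Lemma iinvK I : fractional I -> iinv (iinv I) = I.
Proof.
move=> fI; apply: inv_unique => //; first exact: fractional_iinv.
by rewrite imulC mul_iinv.
Qed.

Lemma image_bar_principal z : bar @` principal z = principal (bar z).
Proof.
apply/seteqP; split=> [_ [_ [y hy <-] <-]|_ [y hy <-]].
  by exists (bar y); [exact/ringint_bar|rewrite rmorphM].
by exists (z * bar y); [exists (bar y) => //; exact/ringint_bar|rewrite rmorphM barK].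
Qed.

(** The inverse of the conjugate of fb is fb divided by a generator of its norm, which turns fb *
    fbar^-1 into fb^2 up to a principal ideal: hence the class in S2. *)
Lemma iinv_J fb : integral_ideal fb -> exists2 i : L, i != 0 &
  iinv (J fb) = principal (i%:A : K) &* (fb &* fb &* A).
Proof.
move=> ifb; have [ffb _] := ifb; have [fA _] := int_A; have fB := fractional_bar ffb.
have [i [i0 _ Ei]] := ideal_mul_bar ffb; exists i^-1; first by rewrite invr_eq0.
have i0A : i%:A != 0 :> K by rewrite alg_eq0.
have fi : fractional (principal (i^-1%:A : K)).
  by apply: fracP; rewrite alg_eq0 invr_eq0.
have EB : iinv (bar @` fb) = fb &* principal (i^-1%:A : K).
  apply: inv_unique => //; first exact: fractional_mul.
  by rewrite imulA (imulC _ fb) Ei principalM -algM mulfV // alg1 principal1.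
rewrite /J iinvM //; [|exact: fractional_iinv|exact: twist_frac].
rewrite /twist iinvM //; last exact: fractional_iinv.
rewrite !iinvK // EB (imulC (principal _)) -!imulA.
by rewrite imulC -!imulA (imulC _ A) !imulA -!imulA.
Qed.

Let phi fb (g : K) := principal g &* iinv (J fb).

Lemma phi_frac fb g : integral_ideal fb -> g != 0 -> fractional (phi fb g).
Proof.
by move=> ifb g0; apply: fractional_mul; [exact: fracP|exact/fractional_iinv/J_frac].
Qed.

Lemma phi_conj fb g : integral_ideal fb -> g != 0 ->
  phi fb g &* (bar @` phi fb g) = principal ((alpha0 * relN g)%:A : K).
Proof.
move=> ifb g0; have fJ := J_frac ifb.
rewrite /phi image_barM imulACA image_bar_principal principalM -relNE.
rewrite image_bar_iinv // -iinvM //; last exact: fractional_bar.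
rewrite J_mul_bar // inv_principal ?alg_eq0 ?invr_eq0 // -algV invrK principalM -algM mulrC.
by [].
Qed.

Lemma phi_inj fb g h : integral_ideal fb -> g != 0 -> h != 0 ->
  phi fb g = phi fb h -> ringint (g^-1 * h) /\ ringint (h^-1 * g).
Proof.
move=> ifb g0 h0 E; apply/principal_eqP => //.
apply: imul_cancel E; [exact: fracP|exact: fracP|exact/fractional_iinv/J_frac].
Qed.

Lemma totally_positive_square (e : L) : ringint e -> ringint e^-1 -> tot_pos e ->
  exists v, e = v ^+ 2.
Proof.
move=> h1 h2 pos; have [k [x [f [f_inj span]]]] := separating_embeddings L.
apply: (totally_positive_unit_square f_inj span hL hcl) => //; split=> //.
by rewrite -(fmorph_eq0 (f ord0)) gt_eqF // pos.
Qed.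

Let ideal_value (x : L) : L := (x ^+ 2 - d * d') / (4 * p%:R * ell ^+ 2).

Lemma ideal_valueE (x : L) : ideal_value x = alpha0 * normval x.
Proof. by rewrite /ideal_value /normval; field; rewrite ell0 p0 alpha00 four0. Qed.

Lemma relN_unit (e : K) : relN e = 1 -> e != 0.
Proof. by move=> Ne; rewrite -relN_eq0 Ne oner_neq0. Qed.

Lemma card_S1_S2 fb (x : L) : integral_ideal fb -> condC p a s d d' ell x ->
  finite_set (S2set p A d d' fb x ell) /\
  card_of (S1set bar p alpha0 A d d' fb x ell) =
    (card_of (@roots_of_unity K) * card_of (S2set p A d d' fb x ell))%N.
Proof.
move=> ifb hC; have fJ := J_frac ifb; have fiJ := fractional_iinv fJ.
have Jg0 (g : K) : relN g = normval x -> g != 0.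
  by move=> Ng; rewrite -relN_eq0 Ng normval_neq0.
have m0 : alpha0 * normval x != 0 by rewrite mulf_neq0 ?normval_neq0.
have [i i0 EiJ] := iinv_J ifb.
have phiS2 g : S1set bar p alpha0 A d d' fb x ell g -> S2set p A d d' fb x ell (phi fb g).
  move=> /S1setP [Jg Ng]; have g0 := Jg0 g Ng; have fphi := phi_frac ifb g0.
  split.
  - split=> //; rewrite -(mul_iinv fJ); apply: imulS => //.
    exact: principal_mem.
  - have [k [k0 -> Ek]] := ideal_mul_bar fphi.
    rewrite -/(ideal_value x) ideal_valueE; apply: principal_alg_eq => //.
    by rewrite -Ek phi_conj // Ng.
  - exists (g * i%:A); first by rewrite mulf_neq0 ?alg_eq0.
    by rewrite /phi EiJ imulA principalM.
apply: (@card_of_fibers _ _ _ _ _ (fun c g => c * g) (phi fb)) => //.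
- exact: finite_roots_of_unity.
- exact: finite_S1.
- move=> b [[fb' sb] Nb [y y0 Eb]].
  pose g0 := y / i%:A; have iA0 : i%:A != 0 :> K by rewrite alg_eq0.
  have g00 : g0 != 0 by rewrite mulf_neq0 ?invr_eq0.
  have Ephi : phi fb g0 = b.
    by rewrite /phi EiJ imulA principalM /g0 mulfVK.
  have [k [k0 Ek1 Ek2]] := ideal_mul_bar fb'.
  have N0 : alpha0 * relN g0 != 0 by rewrite mulf_neq0 ?relN_eq0.
  have Pk : principal k = principal (alpha0 * relN g0).
    by apply: principal_alg_eq => //; rewrite -Ek2 -Ephi phi_conj.
  move: Nb; rewrite -/(ideal_value x) ideal_valueE Ek1 Pk => /(principal_eqP N0 m0).
  (* g0 has the right image but its norm is off by e, a unit because both norms generate the same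
     ideal after multiplication by alpha0. *)
  pose e := relN g0 / normval x.
  have -> : (alpha0 * relN g0)^-1 * (alpha0 * normval x) = e^-1.
    by rewrite /e; field; rewrite normval_neq0 relN_eq0 g00 alpha00.
  have -> : (alpha0 * normval x)^-1 * (alpha0 * relN g0) = e.
    by rewrite /e; field; rewrite normval_neq0 alpha00.
  move=> [hV he]; have [v Ev] : exists v, e = v ^+ 2.
    apply: totally_positive_square => // f.
    have f1 : 0 < f (relN g0) by rewrite lt_neqAle relN_ge0 eq_sym fmorph_eq0 relN_eq0 g00.
    have f2 : 0 < f (normval x).
      have [_ _ _ hneg] := hC; have := hneg f; rewrite -normvalE.
      have -> : 4 * alpha0 * p%:R * ell ^+ 2 = alpha0 * ((4 * p)%N%:R * ell ^+ 2).
        by rewrite natrM; ring.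
      have h1 : f (alpha0 * ((4 * p)%N%:R * ell ^+ 2)) < 0.
        rewrite rmorphM pmulr_llt0; first exact: alpha0_neg.
        rewrite rmorphM rmorph_nat rmorphXn mulr_gt0 ?ltr0n ?muln_gt0 ?p_gt0 //.
        by rewrite lt_neqAle real_exprn_even_ge0 ?hL // eq_sym expf_neq0 ?fmorph_eq0.
      by rewrite rmorphM (nmulr_rlt0 _ h1).
    by rewrite fmorph_div divr_gt0.
  have e0 : e != 0 by rewrite mulf_neq0 ?invr_eq0 ?normval_neq0 // relN_eq0.
  have v0 : v != 0 by apply: contraNneq e0 => v0; rewrite Ev v0 expr0n.
  have hv : ringint v.
    apply/(ringint_alg K).
    apply: (@ringint_quad _ _ _ 0 (- e)); [exact: ringint0|exact: ringintN|].
    by rewrite Ev !algE; ring.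
  have hv1 : ringint v^-1.
    have -> : v^-1 = e^-1 * v by rewrite Ev; field.
    exact: ringintM.
  have vA0 : v%:A != 0 :> K by rewrite alg_eq0.
  pose g := g0 / v%:A; have Ng : relN g = normval x.
    rewrite /g relNM -algV relN_scalar //.
    have -> : v^-1 ^+ 2 = normval x / relN g0.
      by rewrite exprVn -Ev /e invf_div.
    by rewrite mulrC mulfVK // relN_eq0.
  have gg : principal g = principal g0.
    apply/principal_eqP => //; first exact: Jg0.
    split.
      have -> : g^-1 * g0 = v%:A by rewrite /g; field; rewrite g00 vA0.
      exact/ringint_alg.
    have -> : g0^-1 * g = v^-1%:A by rewrite /g algV; field; rewrite g00 vA0.
    exact/ringint_alg.
  exists g; last by rewrite /phi gg.
  apply/S1setP; split=> //.
  (* (g) times the inverse of [J fb] is the integral ideal b; multiplying back gives the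
     inclusion. *)
  have sub : principal g `<=` J fb.
    apply: (@imul_cancel_sub _ _ (iinv (J fb))) => //; first exact/fracP/Jg0.
    by rewrite mul_iinv // gg -/(phi fb g0) Ephi.
  by apply: sub; exact: principal_id.
- move=> g c /S1setP [Jg Ng] [k k0 ck]; have [hc Nc] := unit_norm1 k0 ck.
  have g0 := Jg0 g Ng; have c0 := relN_unit Nc.
  split; first by apply/S1setP; split; [exact: fracM|rewrite relNM Nc mul1r].
  rewrite /phi; congr (_ &* _); apply/principal_eqP => //; first exact: mulf_neq0.
  split; last by rewrite mulrCA mulVf // mulr1.
  rewrite invfM -mulrA mulVf // mulr1.
  have -> : c^-1 = bar c by apply: (mulfI c0); rewrite mulfV // -relNE Nc alg1.
  exact/ringint_bar.
- move=> g h /S1setP [Jg Ng] /S1setP [Jh Nh] E; have g0 := Jg0 g Ng; have h0 := Jg0 h Nh.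
  have [h1 h2] := phi_inj ifb g0 h0 E.
  exists (g^-1 * h); last by rewrite mulrC mulVKf.
  apply: norm1_root_of_unity => //; rewrite relNM Nh -Ng -relNM mulVf //.
  by rewrite -(alg1 K) relN_scalar // expr1n.
- move=> g c c' /S1setP [_ Ng]; apply: mulIf; exact: Jg0.
Qed.

(** * Divisors of the different *)

Let divs := [set c : set K | integral_ideal c /\ idvd c (principal r)].
Let cut (T : {ffun 'I_tau -> bool}) := [set z : K | ringint z /\ forall i, T i -> qt i z].

Lemma cut_div T : divs (cut T).
Proof.
have cr : cut T r by split=> [|i _]; [exact: int_r|exact: qt_r].
have fc : fractional (cut T).
  split.
  - move=> y z [hy qy] [hz qz]; split=> [|i Ti]; first exact: ringintD.
    by apply: fracD; [exact: qt_frac|exact: qy|exact: qz].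
  - move=> c z hc [hz qz]; split=> [|i Ti]; first exact: ringintM.
    by apply: fracM => //; [exact: qt_frac|exact: qz].
  - by exists r.
  - exists 1; split; [exact: ringint1|exact: oner_neq0|].
    by move=> z [hz _]; rewrite mul1r.
have ic : integral_ideal (cut T) by split=> // z [].
split=> //; apply: subset_idvd => //; first exact: fracP.
exact: principal_mem.
Qed.

(* The product over j != i of generators of the q j lies in cut T but not
   in qt i. *)
Lemma cut_subset T i : cut T `<=` qt i <-> T i.
Proof.
split=> [h|Ti z [_ qz]]; last exact: qz.
apply: contrapT => /negP nTi.
have ex j : exists pi : L, q j = principal pi.
  by have [pi _ [E _ _]] := q_generator j; exists pi.
have [pi Epi] := choice ex.
have qpi j : q j (pi j) by rewrite Epi; exact: principal_id.
have hpi j : ringint (pi j) := q_int (qpi j).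
pose z := \prod_(j | j != i) pi j.
have hz : ringint z by apply: ringint_prod.
have : qt i z%:A.
  apply: h; split=> [|j Tj]; first exact/ringint_alg.
  have ji : j != i by apply: contraNneq nTi => <-.
  apply: q_qt; rewrite /z (bigD1 j) //= mulrC; apply: fracM => //; first exact: q_frac.
  exact: ringint_prod.
move=> /(qt_q hz); rewrite /z; have [_ _ pq] := q_prime i.
suff : forall r : seq 'I_tau, ~ q i (\prod_(j <- r | j != i) pi j) by apply.
elim=> [|j l IH]; first by rewrite big_nil; apply: prime_proper; exact: q_prime.
rewrite big_cons; case: ifP => // ji /(pq _ _ (hpi j)) [|h'|//].
  by apply: ringint_prod.
by move: ji; rewrite (q_inj (prime_subset_eq pid (q_prime j) (q_prime i) _)) ?eqxx // Epi; apply: principal_mem h'; exact: q_frac.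
Qed.

Lemma div_eq_cut c : divs c -> c = cut [ffun i => `[< c `<=` qt i >]].
Proof.
move=> [[fc sc] [c1 [fc1 sc1] E]]; apply/seteqP; split=> z.
  by move=> cz; split=> [|i]; [exact: sc|rewrite ffunE => /asboolP; apply].
move=> [hz qz].
(* z c1 is contained in every qt i, hence in (r) = c c1 *)
have [->|z0] := eqVneq z 0; first exact: frac0.
have sub : principal z `<=` c.
  apply: (@imul_cancel_sub _ _ c1) => //; first exact: fracP.
  rewrite -E => y hy; apply/principalP => //; rewrite mulrC.
  have Cy : c1 (z^-1 * y) by apply/principal_mulP.
  have hy0 : ringint y by rewrite -(mulVKf z0 y); apply: ringintM => //; exact: sc1.
  apply: all_qt_div_r => // i.
  (* If [qt i] contains c, it contains z by the choice of z. If not, it contains c1, since c c1 =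
     (r) lies in the prime [qt i]. *)
  have [ci|nci] := pselect (c `<=` qt i).
    rewrite -(mulVKf z0 y) mulrC; apply: fracM; [exact: qt_frac|exact: sc1|].
    by apply: qz; rewrite ffunE; apply/asboolP.
  have [|//|c1i] := prime_imul (I := c) (J := c1) (qtP i).1 sc sc1.
    rewrite -E => _ [w hw <-]; rewrite mulrC.
    by apply: fracM => //; [exact: qt_frac|exact: qt_r].
  by rewrite -(mulVKf z0 y); apply: fracM => //; [exact: qt_frac|exact: c1i].
by apply: sub; exact: principal_id.
Qed.

(** The exponent is at most 1 because c contains r, which is not in the square of [qt i]. *)
Lemma ival_div c i : divs c -> ival (qt i) c = `[< c `<=` qt i >] :> nat.
Proof.
move=> [[fc sc] dc]; have [pq _] := qtP i; have [iq _ _] := pq.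
have fq := qt_frac i; have E1 : ipow (qt i) 1 = qt i by rewrite ipowS imul1.
have cr : c r.
  by have := idvd_subset fc dc; apply; exact: principal_id.
apply: ival_unique => //; case: asboolP => h.
- by rewrite E1; exact: subset_idvd.
- by exists c => //; rewrite mul1i.
- move=> /(idvd_subset _) h2; apply: (@r_not_qt_sqr i).
  have -> : qt i &* qt i = ipow (qt i) 2 by rewrite ipowS E1.
  by apply: h2 => //; case: (integral_ipow 2 iq).
- by rewrite E1 => /(idvd_subset fq).
Qed.

Lemma bar_div c : divs c -> bar @` c = c.
Proof.
move=> hc; have half z : c z -> c (bar z).
  rewrite (div_eq_cut hc) => -[hz qz]; split=> [|i Ti]; first exact/ringint_bar.
  by rewrite -(qt_bar i); exists z => //; exact: qz.
apply/seteqP; split=> [_ [z cz <-]|z cz]; first exact: half.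
by exists (bar z); [exact: half|exact: barK].
Qed.

Lemma twist_div fb c : integral_ideal fb -> divs c -> twist bar (fb &* c) = twist bar fb.
Proof.
move=> [ffb _] hc; have [[fc _] _] := hc.
rewrite /twist iinvM // image_barM (bar_div hc) imulACA (imulC (iinv c)) mul_iinv //.
apply: imul1; apply: fractional_mul; [exact: fractional_iinv|exact: fractional_bar].
Qed.

Lemma sign_of_div fb c i : integral_ideal fb -> divs c ->
  sign_of qt (fb &* c) i = sign_of qt fb i (+) `[< c `<=` qt i >].
Proof.
move=> ifb hc; have [ic _] := hc; rewrite !ffunE ivalM //; last by case: (qtP i).
by rewrite oddD (ival_div i hc) oddb.
Qed.

(** An ideal enters [is_lambda] and [Rset] only through its twist, which c does not change; the two
    lambdas are then both admissible for fb and [S_congr] applies. *)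
Lemma Sset_div fb c e l l' : integral_ideal fb -> divs c -> is_lam (fb &* c) e l ->
  is_lam fb e l' ->
  Sset bar p alpha0 A s n (fb &* c) l ell = Sset bar p alpha0 A s n fb l' ell.
Proof.
move=> ifb hc; rewrite /is_lam /is_lambda twist_div // => hl hl'.
rewrite -(S_congr ifb hl hl') /Sset /Rset twist_div //.
Qed.

Lemma sum_over_divisors fb (lam : set K -> {ffun 'I_tau -> bool} -> L) :
  integral_ideal fb ->
  (forall fc e, integral_ideal fc -> is_lam fc e (lam fc e)) ->
  let S fc e := Sset bar p alpha0 A s n fc (lam fc e) ell in
  [/\ finite_set divs,
      forall c, divs c -> finite_set (S (fb &* c) (sign_of qt (fb &* c))) &
      (\sum_(e : {ffun 'I_tau -> bool}) card_of (S fb e) =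
       \sum_(c <- fset_set divs) card_of (S (fb &* c) (sign_of qt (fb &* c))))%N].
Proof.
move=> ifb lamP S; pose enumT := enum {ffun 'I_tau -> bool}.
have SE c : divs c -> S (fb &* c) (sign_of qt (fb &* c)) = S fb (sign_of qt (fb &* c)).
  move=> hc; have [ic _] := hc; apply: (Sset_div ifb hc); apply: lamP => //.
  exact: integral_ideal_mul.
have cut_inj : injective cut.
  move=> T T' E; apply/ffunP => i; apply/idP/idP => /cut_subset h.
    by apply/cut_subset; rewrite -E.
  by apply/cut_subset; rewrite E.
have um : uniq (map cut enumT) by rewrite map_inj_uniq // enum_uniq.
have mem c : c \in map cut enumT <-> divs c.
  split=> [/mapP [T _ ->]|hc]; first exact: cut_div.
  by rewrite (div_eq_cut hc); apply: map_f; rewrite mem_enum.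
have [fd _] := card_of_uniq um mem.
split=> //; first by move=> c hc; rewrite SE //; apply: finite_S => // e; exact: lamP.
have pe : perm_eq (fset_set divs) (map cut enumT).
  apply: uniq_perm => // c; apply/idP/idP; first by move/(mem_fset_set _ fd)/mem.
  by move/mem/(mem_fset_set _ fd).
rewrite (perm_big _ pe) big_map /= big_enum /=.
(* Multiplication by [cut T] flips the signs of fb at T; this translation permutes all sign
   vectors. *)
pose h (T : {ffun 'I_tau -> bool}) := [ffun i => sign_of qt fb i (+) T i] : {ffun 'I_tau -> bool}.
have h_inj : injective h.
  move=> T T' /ffunP E; apply/ffunP => i; have := E i; rewrite !ffunE.
  by move/addbI.
rewrite (reindex_inj h_inj) /=; apply: eq_bigr => T _.
rewrite SE; last exact: cut_div.
congr (card_of (S fb _)); apply/ffunP => i.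
rewrite (sign_of_div i ifb (cut_div T)) [LHS]ffunE; congr (_ (+) _).
by apply/idP/asboolP => /cut_subset.
Qed.

Lemma counting_identities (lam : set K -> {ffun 'I_tau -> bool} -> L) (fa : set K) :
  (forall fc e, integral_ideal fc -> is_lambda bar A q lamq fc e (lam fc e)) ->
  integral_ideal fa ->
  let S := Sset bar p alpha0 A s n in
  let C := condC p a s d d' ell in
  let S1 := S1set bar p alpha0 A d d' in
  let S2 := S2set p A d d' in
  let divs := [set c : set K | integral_ideal c /\ idvd c (principal r)] in
  let lam_ fc := lam fc (sign_of qt fc) in
  let wK := card_of (@roots_of_unity K) in
  [/\ forall e, finite_set (S fa (lam fa e) ell),
      finite_set C,
      forall x : L, C x -> finite_set (S1 fa x ell) /\ finite_set (S2 fa x ell),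
      finite_set (@roots_of_unity K) &
      finite_set divs /\
      forall c, divs c -> finite_set (S (fa &* c) (lam_ (fa &* c)) ell)] /\
  [/\ \sum_(e : {ffun 'I_tau -> bool}) card_of (S fa (lam fa e) ell)
        = \sum_(k \in C) (delta q k * card_of (S1 fa k ell))%N,
      \sum_(k \in C) (delta q k * card_of (S1 fa k ell))%N
        = (wK * \sum_(x \in C) (delta q x * card_of (S2 fa x ell)))%N &
      \sum_(e : {ffun 'I_tau -> bool}) card_of (S fa (lam fa e) ell)
        = \sum_(c \in divs)
            card_of (S (fa &* c) (lam_ (fa &* c)) ell)].
Proof.
move=> lamP ifa /=.
have [fd fSd sumd] := sum_over_divisors ifa lamP.
have lamPa e : is_lam fa e (lam fa e) by exact: lamP.
have fC := finite_condC.
split; first split=> //.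
- by move=> e; apply: (finite_S (lam fa)).
- by move=> x hC; split; [exact: finite_S1|exact: (card_S1_S2 ifa hC).1].
- exact: finite_roots_of_unity.
split.
- by rewrite (fsbig_finite _ _ fC); exact: sum_card_S ifa lamPa.
- rewrite !(fsbig_finite _ _ fC) /= big_distrr /= big_seq [RHS]big_seq.
  apply: eq_bigr => x /(mem_fset_set _ fC) hC.
  by rewrite (card_S1_S2 ifa hC).2 mulnCA.
- by rewrite (fsbig_finite _ _ fd).
Qed.

End Conjugation.

(** * CM fields *)

Section CMSetup.
Variables (L : fieldExtType rat) (hL : totally_real L).

Lemma neg_not_sqr (c d : L) : tot_neg d -> c ^+ 2 != d.
Proof.
move=> dneg; have [n [x [f _]]] := separating_embeddings L.
apply/eqP => E; have := dneg (f ord0); rewrite -E rmorphXn.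
by rewrite lt_gtF // lt_neqAle real_exprn_even_ge0 ?hL // andbT eq_sym -rmorphXn E lt_eqF // dneg.
Qed.

Lemma tot_neg_neq0 (d : L) : tot_neg d -> d != 0.
Proof. by move=> dneg; rewrite eq_sym -[0](expr0n L 2); exact: neg_not_sqr. Qed.

Lemma strict_class_number_one_pid : strict_class_number_one L ->
  forall I : set L, fractional I -> exists2 x : L, x != 0 & I = principal x.
Proof.
move=> hcl I /hcl [x xpos E]; exists x => //.
have [n [y [f _]]] := separating_embeddings L.
by rewrite -(fmorph_eq0 (f ord0)) gt_eqF // xpos.
Qed.

Variables (K : fieldExtType L) (hK : CM_over K).
Variables (r : K) (d : L).
Hypothesis r_sqr : r ^+ 2 = d%:A.
Hypothesis d_neg : tot_neg d.

Lemma sqrt_notin (c : L) : r != c%:A.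
Proof.
apply/eqP => E; have /eqP := neg_not_sqr c d_neg; apply.
by apply: (@alg_inj _ K); rewrite -r_sqr E algX.
Qed.

Lemma CM_dim : \dim {:K} = 2. Proof. by case: hK. Qed.

(** Complex conjugation and total imaginarity are stated for all complex embeddings of K; an actual
    one is needed to exploit them. *)
Lemma CM_embedding : exists F : {rmorphism K -> algC}, True.
Proof.
have [n [x [f _]]] := separating_embeddings L.
have [F _] := quad_extend CM_dim r_sqr sqrt_notin (sqrtCK (f ord0 d)).
by exists F.
Qed.

Variables (bar : {rmorphism K -> K}) (hbar : complex_conjugation bar).

Lemma CM_barA (x : L) : bar x%:A = x%:A.
Proof.
have [F _] := CM_embedding; apply: (fmorph_inj F); rewrite hbar.
apply/CrealP; exact: (hL (F \o in_alg K)).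
Qed.

Lemma CM_barK : involutive bar.
Proof.
by move=> z; have [F _] := CM_embedding; apply: (fmorph_inj F); rewrite !hbar conjCK.
Qed.

(** If bar fixed r it would fix all of K, and the embedding F would be real. *)
Lemma CM_bar_sqrt : bar r = - r.
Proof.
have : bar r ^+ 2 = r ^+ 2 by rewrite -rmorphXn r_sqr CM_barA.
move/eqP; rewrite eqf_sqr => /orP [/eqP e|/eqP //].
have [F _] := CM_embedding; have [_ _ /(_ F) [z]] := hK; case/negP.
have [u [v ->]] := quad_decomp CM_dim sqrt_notin z.
apply/CrealP; rewrite -hbar rmorphD rmorphM /= !CM_barA e.
by [].
Qed.

Lemma CM_bar_fix z : bar z = z -> exists u : L, z = u%:A.
Proof.
have [u [v ->]] := quad_decomp CM_dim sqrt_notin z.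
rewrite rmorphD rmorphM /= !CM_barA CM_bar_sqrt mulrN -mulNr -algN.
move=> /(quad_inj sqrt_notin) [_ ev]; exists u.
have -> : v = 0.
  have : v + v = 0 by rewrite -{1}ev addNr.
  by move/eqP; rewrite -mulr2n -mulr_natl mulf_eq0 -(alg_nat L 2) alg_eq0 => /orP [//|/eqP].
by rewrite alg0 mul0r addr0.
Qed.

End CMSetup.

Lemma adjoin_int_quad (L : fieldExtType rat) (K : fieldExtType L) (t : K) (a b : L) :
  ringint a -> ringint b -> t ^+ 2 + a%:A * t + b%:A = 0 ->
  forall z, adjoin_int t z ->
  exists u v : L, [/\ ringint u, ringint v & z = u%:A + v%:A * t].
Proof.
move=> ha hb e z [P hP ->].
have pow i : exists u v : L, [/\ ringint u, ringint v & t ^+ i = u%:A + v%:A * t].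
  elim: i => [|i [u [v [hu hv E]]]].
    exists 1, 0; split; [exact: ringint1|exact: ringint0|].
    by rewrite alg1 alg0 mul0r addr0.
  exists (- (v * b)), (u - v * a); split.
  - by apply: ringintN; exact: ringintM.
  - by apply: ringintB => //; exact: ringintM.
  - have e2 : t ^+ 2 = - (a%:A * t + b%:A).
      by apply/eqP; rewrite -addr_eq0 addrA e.
    rewrite exprS E mulrDr mulrCA -expr2 e2 !algE; ring.
rewrite horner_coef; set m := size _.
elim/big_ind: _ => [|x y [u [v [hu hv ->]]] [u' [v' [hu' hv' ->]]]|i _].
- exists 0, 0; split; [exact: ringint0|exact: ringint0|].
  by rewrite alg0 mul0r addr0.
- exists (u + u'), (v + v'); split; [exact: ringintD|exact: ringintD|].
  by rewrite !algD; ring.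
- have [u [v [hu hv ->]]] := pow i; rewrite coef_map /=.
  exists (P`_i * u), (P`_i * v); split; [exact: ringintM|exact: ringintM|].
  by rewrite !algM; ring.
Qed.

Lemma adjoin_int_gen (L : fieldExtType rat) (K : fieldExtType L) (t : K) : adjoin_int t t.
Proof.
exists 'X; last by rewrite map_polyX hornerX.
by move=> i; rewrite coefX; exact: ringint_nat.
Qed.

(** * The field K': integrality of the trace and norm of w, and its distinctness from K *)

Section SecondField.
Variables (L : fieldExtType rat) (hL : totally_real L).
Variables (K' : fieldExtType L) (hK' : CM_over K') (w : K').
Let s := relTr w.
Let n := relN w.
Hypothesis d'_neg : tot_neg (s ^+ 2 - 4 * n).

Let r' : K' := 2 * w - s%:A.

Lemma disc_sqrt : r' ^+ 2 = (s ^+ 2 - 4 * n)%:A.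
Proof.
have e := quad_char_eq (CM_dim hK') w.
have h4 : (4 : L)%:A = 4 :> K' := alg_nat K' 4.
rewrite algB algX algM h4 /r' -[RHS]addr0 -(mulr0 4) -e; rewrite -/s -/n; ring.
Qed.

(* w and s - w are conjugate over L. *)
Lemma ringint_trace_norm : ringint w -> ringint s /\ ringint n.
Proof.
move=> hw; have rn c := sqrt_notin hL disc_sqrt d'_neg c.
have rs : (- r') ^+ 2 = in_alg K' (s ^+ 2 - 4 * n) by rewrite sqrrN disc_sqrt.
(* F is the conjugation of K' over L, constructed as the automorphism r' |-> - r'. *)
have [F [FA Fr]] := quad_extend (CM_dim hK') disc_sqrt rn rs.
have two0 : 2 != 0 :> K' by rewrite -(alg_nat K' 2) alg_eq0 -(alg_nat L 2) alg_eq0.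
have Fw : F w = s%:A - w.
  have E : F (2 * w) = - r' + s%:A.
    have -> : 2 * w = r' + s%:A by rewrite /r' subrK.
    by rewrite rmorphD Fr FA.
  rewrite rmorphM rmorph_nat in E.
  by apply: (mulfI two0); rewrite E /r'; ring.
have hFw : ringint (F w) by apply/ringint_rmorph.
have hs : ringint s.
  by apply/(ringint_alg K'); rewrite -(subrK w s%:A) -Fw; exact: ringintD.
split=> //; apply/(ringint_alg K').
have e := quad_char_eq (CM_dim hK') w.
have -> : (relN w)%:A = w * F w.
  by rewrite Fw; apply/eqP; rewrite -subr_eq0; apply/eqP; rewrite -[RHS]e; ring.
exact: ringintM.
Qed.

(** If x^2 = d d', then (x / d') r' is a square root of d in K' and (x / d) r one of d' in K. The
    resulting maps are mutually inverse, as (x / d') (x / d) = 1. *)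
Lemma disc_not_sqr (K : fieldExtType L) (hK : CM_over K) (r : K) (d x : L) :
  r ^+ 2 = d%:A -> tot_neg d ->
  ~ (exists f : {lrmorphism K -> K'}, bijective f) ->
  x ^+ 2 != d * (s ^+ 2 - 4 * n).
Proof.
set d' := s ^+ 2 - 4 * n => r_sqr d_neg; apply: contra_notN => /eqP ex.
have d0 := tot_neg_neq0 hL d_neg; have d'0 : d' != 0 := tot_neg_neq0 hL d'_neg.
have rn c := sqrt_notin hL r_sqr d_neg c.
have rn' c := sqrt_notin hL disc_sqrt d'_neg c.
have e1 : ((x / d')%:A * r') ^+ 2 = in_alg K' d.
  rewrite exprMn disc_sqrt -/d' -algX -algM; congr (_ *: _).
  by rewrite expr_div_n ex; field.
have e2 : ((x / d)%:A * r) ^+ 2 = in_alg K d'.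
  rewrite exprMn r_sqr -algX -algM; congr (_ *: _).
  by rewrite expr_div_n ex; field.
have [F [FA Fr]] := quad_extend (CM_dim hK) r_sqr rn e1.
have [G [GA Gr]] := quad_extend (CM_dim hK') disc_sqrt rn' e2.
have Flin : scalable F.
  by move=> c z; rewrite -mulr_algl rmorphM FA mulr_algl.
pose F1 := GRing.isScalable.Build L K K' *:%R F Flin.
pose FF : {lrmorphism K -> K'} := HB.pack (F : K -> K') F F1.
exists FF; have FE z : FF z = F z by [].
have xx : x / d' * (x / d) = 1.
  by rewrite mulf_div -expr2 ex (mulrC d') mulfV // mulf_neq0.
exists G => z.
  have [u [v ->]] := quad_decomp (CM_dim hK) rn z.
  rewrite FE !rmorphD !rmorphM /= !FA Fr rmorphM /= !GA Gr.
  have h c e : c%:A * (e%:A * r) = (c * e)%:A * r by rewrite algM mulrA.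
  by rewrite !h xx mulr1.
have [u [v ->]] := quad_decomp (CM_dim hK') rn' z.
rewrite FE !rmorphD !rmorphM /= !GA Gr rmorphM /= !FA Fr.
have h c e : c%:A * (e%:A * r') = (c * e)%:A * r' by rewrite algM mulrA.
by rewrite !h (mulrC (x / d)) xx mulr1.
Qed.

End SecondField.

(** * The counting identities for the given fields *)

Theorem theorem6p5
  (L : fieldExtType rat) (g : nat)
  (hL : totally_real L) (hg : \dim {:L} = g)
  (hcl : strict_class_number_one L)
  (K : fieldExtType L) (hK : CM_over K)
  (bar : {rmorphism K -> K}) (hbar : complex_conjugation bar)
  (t : K) (a b : L)
  (ht : @ringint K = adjoin_int t)
  (ha : ringint a) (hb : ringint b)
  (htab : t ^+ 2 + a%:A * t + b%:A = 0)
  (d : L) (hd : d = a ^+ 2 - 4 * b) (hdneg : tot_neg d)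
  (sqrtd : K) (hsqrtd : sqrtd ^+ 2 = d%:A)
  (hD : rel_different K = principal sqrtd)
  (hd2 : icoprime (principal d) (principal 2))
  (p : nat) (hp : prime p) (hpodd : odd p)
  (hpK : unramified_at K p)
  (hdp : icoprime (principal d) (principal p%:R))
  (hsplit : forall (P : set L) (f : nat), prime_ideal P -> P p%:R ->
     residue_degree p P f -> ~~ odd f -> splits K P)
  (hinert : forall (P : set L) (f : nat), prime_ideal P -> P p%:R ->
     residue_degree p P f -> odd f -> inert K P)
  (* q enumerates the primes of L dividing d *)
  (tau : nat) (q : 'I_tau -> set L)
  (hqinj : injective q)
  (hq : forall P : set L,
     (prime_ideal P /\ idvd P (principal d)) <-> exists i, q i = P)
  (qt : 'I_tau -> set K)
  (hqt : forall i, prime_ideal (qt i) /\ iext K (q i) = qt i &* qt i)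
  (Bp : falgType rat) (hBp : is_Bpinf p Bp)
  (BpL : falgType L) (iota : {rmorphism Bp -> BpL})
  (hBpL : scalar_extension iota)
  (alpha0 : L)
  (ha0prime : prime_ideal (principal alpha0)) (ha0neg : tot_neg alpha0)
  (ha0cop : icoprime (principal alpha0) (principal (2 * p%:R * d)))
  (ha0q : forall i, q i (alpha0 - p%:R))
  (ha0p : principal (p%:R : L) (alpha0 - 1))
  (hquat : quaternion_algebra d (alpha0 * p%:R) BpL)
  (A : set K) (hA : integral_ideal A)
  (hAA : principal (alpha0%:A : K) = A &* (bar @` A))
  (lamq : 'I_tau -> L)
  (hlamq : forall i, ringint (lamq i) /\ q i (lamq i ^+ 2 - alpha0 * p%:R))
  (* lam fa e is the chosen lambda for the ideal fa and the signs e *)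
  (lam : set K -> {ffun 'I_tau -> bool} -> L)
  (hlam : forall fa e, integral_ideal fa ->
     is_lambda bar A q lamq fa e (lam fa e))
  (K' : fieldExtType L) (hK' : CM_over K')
  (* K and K' are distinct: they are not isomorphic over L *)
  (hKK' : ~ exists f : {lrmorphism K -> K'}, bijective f)
  (w : K') (hw : @ringint K' = adjoin_int w)
  (d' : L) (hd' : d' = relTr w ^+ 2 - 4 * relN w) (hd'neg : tot_neg d')
  (fa : set K) (hfa : integral_ideal fa)
  (ell : L) (hell : ringint ell) (hell0 : ell != 0)
  (hellcop : icoprime_frac (principal (ell%:A : K))
     (principal ((alpha0 * d)%:A : K) &* twist bar fa)) :
  let S := Sset bar p alpha0 A (relTr w) (relN w) in
  let C := condC p a (relTr w) d d' ell in
  let S1 := S1set bar p alpha0 A d d' in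
  let S2 := S2set p A d d' in
  let divs := [set c : set K | integral_ideal c /\ idvd c (principal sqrtd)] in
  let lam_ fc := lam fc (sign_of qt fc) in
  let wK := card_of (@roots_of_unity K) in
  (* all the sets that are counted or summed over are finite *)
  [/\ forall e, finite_set (S fa (lam fa e) ell),
      finite_set C,
      forall x, C x -> finite_set (S1 fa x ell) /\ finite_set (S2 fa x ell),
      finite_set (@roots_of_unity K) &
      finite_set divs /\
      forall c, divs c -> finite_set (S (fa &* c) (lam_ (fa &* c)) ell)] /\
  [/\ \sum_(e : {ffun 'I_tau -> bool}) card_of (S fa (lam fa e) ell)
        = \sum_(x \in C) (delta q x * card_of (S1 fa x ell))%N,
      \sum_(x \in C) (delta q x * card_of (S1 fa x ell))%N
        = (wK * \sum_(x \in C) (delta q x * card_of (S2 fa x ell)))%N &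
      \sum_(e : {ffun 'I_tau -> bool}) card_of (S fa (lam fa e) ell)
        = \sum_(c \in divs)
            card_of (S (fa &* c) (lam_ (fa &* c)) ell)].
Proof.
pose r := 2 * t + a%:A.
have r_sqr : r ^+ 2 = d%:A.
  have h4 : (4 : L)%:A = 4 :> K := alg_nat K 4.
  rewrite hd algB algX algM h4 -[RHS]addr0 -(mulr0 4) -htab /r; ring.
have d0 := tot_neg_neq0 hL hdneg.
have r0 : r != 0 by have := alg_eq0 K d; rewrite -r_sqr (negPf d0) expf_eq0 /= => ->.
have rn := sqrt_notin hL r_sqr hdneg.
have dimK := CM_dim hK.
(* [sqrtd] is r or - r, and the ideal does not see the sign; so r = 2 t + a, tied to the integral
   basis 1, t, may replace it. *)
have Er : principal sqrtd = principal r.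
  have /eqP := hsqrtd; rewrite -r_sqr eqf_sqr => /orP [/eqP -> //|/eqP ->].
  have hN1 : ringint (-1 : K) by apply: ringintN; exact: ringint1.
  apply/seteqP; split=> _ [y hy <-]; exists (- y); rewrite ?mulrNN ?mulNr ?mulrN ?opprK //;
    exact: ringintN.
rewrite Er in hD *.
have pid := strict_class_number_one_pid hcl.
have barA := CM_barA hL hK r_sqr hdneg hbar.
have barK := CM_barK hL hK r_sqr hdneg hbar.
have bar_r := CM_bar_sqrt hL hK r_sqr hdneg hbar.
have bar_fix := CM_bar_fix hL hK r_sqr hdneg hbar.
have int_t : ringint t by rewrite ht; exact: adjoin_int_gen.
have int_d : ringint d.
  rewrite hd; apply: ringintB; first exact: ringintX.
  by apply: ringintM => //; exact: (ringint_nat _ 4).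
have int_dec z : ringint z -> exists u v : L,
    [/\ ringint u, ringint v & z = u%:A + v%:A * t].
  by rewrite ht; exact: adjoin_int_quad htab _.
have q_d i : q i d := q_d hq i.
have q_prime i : prime_ideal (q i) := q_prime hq i.
have q_frac i : fractional (q i) by case: (q_prime i) => -[].
have not_cop i (x : L) : icoprime (principal d) (principal x) -> ~ q i x.
  move=> [_ [_ [[u hu <-] [v hv <-] e]]] qx; apply: (prime_proper (q_prime i)).
  by rewrite -e (mulrC d) (mulrC x); apply: fracD => //; apply: fracM.
have q_not_p i : ~ q i p%:R by exact: not_cop.
have q_not_a i : ~ q i alpha0.
  have [_ [_ [[u hu <-] [v hv <-] e]]] := ha0cop => qx.
  apply: (prime_proper (q_prime i)); rewrite -e; apply: fracD => //.
    by rewrite mulrC; exact: fracM.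
  have -> : 2 * p%:R * d * v = (2 * p%:R * v) * d by ring.
  apply: fracM => //; apply: ringintM => //.
  by apply: ringintM; exact: ringint_nat.
have int_alpha0 : ringint alpha0.
  by case: ha0prime => -[_ sub] _ _; apply: sub; exact: principal_id.
have int_w : ringint w by rewrite hw; exact: adjoin_int_gen.
have d'_neg : tot_neg (relTr w ^+ 2 - 4 * relN w) by rewrite -hd'.
have [int_s int_n] := ringint_trace_norm hL hK' d'_neg int_w.
have int_d' : ringint d'.
  rewrite hd'; apply: ringintB; first exact: ringintX.
  by apply: ringintM => //; exact: (ringint_nat _ 4).
have nsq (x : L) : x ^+ 2 != d * d'.
  by rewrite hd'; exact: (disc_not_sqr hL hK' d'_neg hK x r_sqr hdneg hKK').
have K_dec z := quad_decomp dimK rn z.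
have K_inj := quad_inj rn.
have rE : r = 2 * t + a%:A by [].
exact: (counting_identities dimK barA barK bar_fix pid rE r_sqr bar_r r0 K_dec K_inj
  hL hdneg int_t ha int_d int_dec hqinj hq hqt hd2 ha0neg int_alpha0 (prime_gt0 hp)
  q_not_a q_not_p hA hAA hD int_s int_d' hd' nsq hell hell0 hlamq hcl hlam hfa).
Qed.
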